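(* As $l\to+\infty$, the functionals $F^l$ $\Gamma$-converge with respect to the weak topology of $H^{\frac12}(0,1)$ to the functional $F^\infty$ given by $$F^\infty(w)=\begin{cases}\displaystyle \int_0^1\int_0^1\frac{|w(x)-w(y)|^2}{|x-y|^2}\,dx\,dy+c_\infty & \text{if } w\in H^{\frac12}(0,1),\\ +\infty & \text{otherwise.}\end{cases}$$
   Context: Fix constants $\lambda,\Lambda>0$ with $\Lambda\ge\lambda$, and $\delta>0$. For $l>0$ let $\mathcal{AD}_l$ be the family of finite sets $X=\{x_1,\dots,x_N\}\subset(-\frac\delta2,\,l+\frac\delta2)$, $N\in\mathbb N$, $x_1<x_2<\dots<x_N$, such that the intervals $(x_i-\frac\delta2,x_i+\frac\delta2)$ are mutually disjoint; the empty set is also allowed, $\emptyset\in\mathcal{AD}_l$. For $X\in\mathcal{AD}_l$, $u_X\in W^{1,\infty}(0,l)$ denotes a function, determined up to an additive constant, with $$u_X'=\lambda-(\Lambda+\lambda)\,\chi_{(0,l)}\sum_{i=1}^N\chi_{(x_i-\frac\delta2,x_i+\frac\delta2)}.$$ Let $\mathcal U_l:=\{u_X : X\in\mathcal{AD}_l\}$ (all choices of additive constants are included). Rescaled displacements: $\mathcal W_l:=\{w_u : u\in\mathcal U_l\}\subset W^{1,\infty}(0,1)$, where $w_u(z):=\frac{u(lz)}{\sqrt l}$ for $z\in(0,1)$. Energy: $F^l(w):=\int_0^1\int_0^1\frac{|w(x)-w(y)|^2}{|x-y|^2}\,dx\,dy$ for $w\in\mathcal W_l$, and $F^l(w):=+\infty$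 for $w\in H^{\frac12}(0,1)\setminus\mathcal W_l$. Constant: $c_l:=\min_{u\in\mathcal U_l}\frac1l\int_0^l\int_0^l\frac{|u(x)-u(y)|^2}{|x-y|^2}\,dx\,dy$ for $l>0$ (the minimum exists), and $c_\infty:=\lim_{l\to+\infty}c_l$, which exists and satisfies $0<c_\infty<+\infty$. $\Gamma$-convergence with respect to the weak topology of $H^{\frac12}(0,1)$ means: (liminf inequality) whenever $w_l\in\mathcal W_l$ and $w_l\rightharpoonup w$ weakly in $H^{\frac12}(0,1)$ as $l\to+\infty$, one has $\liminf_{l\to+\infty}F^l(w_l)\ge F^\infty(w)$, and the same along any sequence $l_n\to+\infty$; (limsup inequality) for every $w\in H^{\frac12}(0,1)$ there exist $g_l\in\mathcal W_l$ with $g_l\rightharpoonup w$ weakly in $H^{\frac12}(0,1)$ and $\limsup_{l\to+\infty}F^l(g_l)\le F^\infty(w)$. Here $H^{\frac12}(0,1)$ carries the norm given by the $L^2$ norm plus the seminorm $\big(\int_0^1\int_0^1\frac{|w(x)-w(y)|^2}{|x-y|^2}dx\,dy\big)^{1/2}$. *)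

(* Defs.v *)
From HB Require Import structures.
From mathcomp Require Import all_boot all_order all_algebra.
From mathcomp Require Import all_classical all_reals all_analysis.

Set Implicit Arguments.
Unset Strict Implicit.
Unset Printing Implicit Defensive.

Import Order.TTheory GRing.Theory Num.Theory.
Import numFieldNormedType.Exports.

Local Open Scope classical_set_scope.
Local Open Scope ring_scope.

(* Functions on an interval (0, l) are represented by total functions R -> R
   whose values outside (0, l) are irrelevant. Elements of the Lebesgue and
   Sobolev spaces are represented by their Borel measurable representatives, so
   the sets of functions below are closed under modification on a null set
   (within Borel functions). *)

Section SobolevSpaces.
Context {R : realType}.
Implicit Types (l : R) (u g phi w f : R -> R).

Local Notation mu := (@lebesgue_measure R).

Definition gagliardo l u : \bar R :=
  (\int[mu]_(y in `]0%R, l[) \int[mu]_(x in `]0%R, l[)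
     (`|u x - u y| ^+ 2 / `|x - y| ^+ 2)%:E)%E.

Definition Linfty l u : Prop :=
  measurable_fun `]0, l[ u /\
  exists M : R, {ae mu, forall x : R, x \in `]0, l[ -> `|u x| <= M}.

Definition test_function l phi : Prop :=
  [/\ forall x : R, derivable phi x 1,
      continuous (derive1 phi),
      compact (closure [set x : R | phi x != 0]) &
      closure [set x : R | phi x != 0] `<=` `]0, l[ ].

(* Weak derivatives are tested against C^1_c(0, l), as in Brezis, Functional
   Analysis, Sobolev Spaces and Partial Differential Equations, Section 8.2. *)
Definition weak_deriv l u g : Prop :=
  forall phi, test_function l phi ->
    \int[mu]_(x in `]0, l[) (u x * derive1 phi x) =
    - \int[mu]_(x in `]0, l[) (g x * phi x).

Definition W1infty l u : Prop :=
  Linfty l u /\ exists2 g, Linfty l g & weak_deriv l u g.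

Definition sqL2 w : \bar R := (\int[mu]_(x in `]0%R, 1%R[) (`|w x| ^+ 2)%:E)%E.

Definition H12 : set (R -> R) :=
  [set w : R -> R | [/\ measurable_fun (`]0, 1[ : set R) w,
               (sqL2 w < +oo)%E & (gagliardo 1 w < +oo)%E]].

Definition H12norm w : R :=
  Num.sqrt (fine (sqL2 w)) + Num.sqrt (fine (gagliardo 1 w)).

(* The bound makes T vanish on functions of zero norm, so that T factors
   through a.e. equality. *)
Definition H12_dual (T : (R -> R) -> R) : Prop :=
  (forall (a : R) f g, H12 f -> H12 g ->
     T (fun x => a * f x + g x) = a * T f + T g) /\
  exists C : R, forall f, H12 f -> `|T f| <= C * H12norm f.

Definition H12_weak_cvg {I : Type} (F : set_system I) (v : I -> R -> R) w :
    Prop :=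
  [/\ \forall i \near F, H12 (v i), H12 w &
      forall T, H12_dual T -> T (v i) @[i --> F] --> T w].

(* Gamma-convergence as l -> +oo of functionals G l with admissible classes
   W l, w.r.t. the weak topology of H^{1/2}(0, 1). *)
Definition Gamma_cvg (W : R -> set (R -> R)) (G : R -> (R -> R) -> \bar R)
    (Ginf : (R -> R) -> \bar R) : Prop :=
  [/\ forall (v : R -> R -> R) w,
        (forall l, 0 < l -> W l (v l)) ->
        H12_weak_cvg +oo%R v w ->
        (Ginf w <= limf_einf (fun l => G l (v l)) +oo%R)%E,
      forall (l_ : nat -> R) (v : nat -> R -> R) w,
        (forall n, 0 < l_ n) -> l_ n @[n --> \oo] --> +oo ->
        (forall n, W (l_ n) (v n)) ->
        H12_weak_cvg \oo v w ->
        (Ginf w <= limn_einf (fun n => G (l_ n) (v n)))%E &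
      forall w, H12 w -> exists v : R -> R -> R,
        [/\ forall l, 0 < l -> W l (v l),
            H12_weak_cvg +oo%R v w &
            (limf_esup (fun l => G l (v l)) +oo%R <= Ginf w)%E]].

End SobolevSpaces.

Section Model.
Context {R : realType} (lam Lam delta : R).
Implicit Types (l : R) (X : seq R) (u w : R -> R).

Definition core (c : R) : set R := `]c - delta / 2, c + delta / 2[.

Definition AD l : set (seq R) :=
  [set X : seq R | [/\ sorted <%R X,
               forall c : R, c \in X -> c \in `](- (delta / 2)), (l + delta / 2)[ &
               trivIset [set` X] core]].

Definition strain l X (x : R) : R :=
  lam - (Lam + lam) * (\1_(`]0, l[%classic) x * \sum_(c <- X) \1_(core c) x).

Definition displacement l : set (R -> R) :=
  [set u : R -> R | exists2 X, AD l X & W1infty l u /\ weak_deriv l u (strain l X)].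

Definition rescaled l : set (R -> R) :=
  [set w : R -> R | exists2 u, displacement l u &
           forall z : R, z \in `]0, 1[ -> w z = u (l * z) / Num.sqrt l].

Definition energy l w : \bar R :=
  if w \in rescaled l then gagliardo 1 w else +oo%E.

Definition c_ l : \bar R :=
  ereal_inf [set ((l^-1)%:E * gagliardo l u)%E | u in displacement l].

Definition c_infty : \bar R := lim (c_ l @[l --> +oo]).

Definition energy_infty w : \bar R :=
  if w \in @H12 R then (gagliardo 1 w + c_infty)%E else +oo%E.

End Model.

(* Main.v *)
From HB Require Import structures.
From mathcomp Require Import all_boot all_order all_algebra.
From mathcomp Require Import all_classical all_reals all_analysis.
From mathcomp Require Import measurable_realfun.
From mathcomp Require Import ring lra.
Require Import Defs.
Set Implicit Arguments.
Unset Strict Implicit.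
Unset Printing Implicit Defensive.
Import Order.TTheory GRing.Theory Num.Theory.
Import numFieldNormedType.Exports.
Local Open Scope classical_set_scope.
Local Open Scope ring_scope.

(** The displacements can be described explicitly. A weak derivative determines
    its function up to a constant, so a displacement agrees almost everywhere
    with a constant plus a profile, which climbs with slope lam and falls behind
    by D = (Lam + lam) delta at each dislocation ([displacement_profile]). The
    restriction of a profile to a subinterval is again a profile, up to a
    constant; cutting (0, l) into blocks therefore shows that l c_l is
    superadditive. A configuration with one dislocation per length D / lam has a
    bounded profile, which bounds c_l, and c_l converges to its supremum
    c_infty ([c_infty_spec]).

    Lower bound. Cut (0, l) into n blocks. After rescaling, the diagonal blocks
    carry at least c_{l/n}, and the interactions at distance at least 1/n are
    not touched by the cutting ([scaled_blocks]). On those pairs the energy is a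
    continuous nonnegative quadratic form, hence weakly lower semicontinuous.
    Letting l and then n tend to infinity gives the two terms of the limit
    ([liminf_bound]).

    Upper bound. Truncation and averaging do not increase the energy, so w may
    be taken Lipschitz ([lipschitz_approx]). Take a nearly optimal configuration
    Y on (0, N s) and cut it into N cells of length s; between consecutive cells
    insert a gap of fixed length B, filled with as many dislocations as it takes
    for the new profile to follow the slowly varying V x = sqrt l * w (x / l) up
    to a bounded error ([dislocations_fit]). The new profile on (0, l), with l
    at most N (s + B), is then the sum of the profile of Y composed with a map
    that contracts the gaps, of V, and of an error which is bounded, Lipschitz,
    and as flat as V away from the gaps. The energy of such an error is a small
    fraction of l once s and l are large ([sparse_energy], [small_error]). The energies of the first two
    summands add up: nearly optimal profiles have little energy at long range,
    since the diagonal blocks already use up c_infty ([near_optimal]), while w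
    has little energy at short range ([energy_separated]). The lack of long
    range energy also makes the first summand small in L2 after subtraction of
    a constant ([spread_near_far], [recenter]). Finally, L2 convergence with
    bounded energy implies weak convergence, because bounded functionals are
    almost inner products ([approx_riesz], [weak_cvg_criterion]). *)

(** * Change of variables *)

Section Transfer.
Context {R : realType}.
Local Notation mu := (@lebesgue_measure R).
Variables (K : R) (pi : R -> R).
Hypothesis K0 : 0 < K.
Hypothesis mpi : measurable_fun setT pi.
Hypothesis Kpi : forall x y, `|x - y| <= K * `|pi x - pi y|.

(** Two points of the preimage are at distance at most K (b - a), so the preimage
    lies in an interval of that length. *)
Lemma preimage_ocitv_le (a b : R) : a < b ->
  (mu (pi @^-1` `]a, b]%classic) <= K%:E * (b - a)%:E)%E.
Proof.
move=> ab; set S := (X in mu X).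
have mS : measurable S by rewrite -[S]setTI; exact: mpi.
have [->|/set0P[x0 Sx0]] := eqVneq S set0.
  by rewrite measure0 -EFinM lee_fin mulr_ge0 ?ltW// subr_gt0.
have dS x y : S x -> S y -> y - x <= K * (b - a).
  rewrite /S/= !in_itv/= => /andP[ax xb] /andP[ay yb].
  apply: le_trans (ler_norm _) _; apply: le_trans (Kpi _ _) _.
  by rewrite ler_pM2l// ler_norml; apply/andP; split; lra.
have hS : has_sup S.
  by split; [exists x0|exists (x0 + K * (b - a)) => y Sy; move: (dS _ _ Sx0 Sy); lra].
have hI : has_inf S.
  by split; [exists x0|exists (x0 - K * (b - a)) => y Sy; move: (dS _ _ Sy Sx0); lra].
have dd : sup S - inf S <= K * (b - a).
  rewrite lerBlDr; apply: sup_le_ub; first by exists x0.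
  move=> y Sy; rewrite -lerBlDl; apply: lb_le_inf; first by exists x0.
  by move=> x Sx; have := dS _ _ Sx Sy; lra.
have SI : S `<=` `[inf S, sup S].
  move=> x Sx /=; rewrite in_itv/=; apply/andP; split.
    by apply: ge_inf => //; case: hI.
  by apply: ub_le_sup => //; case: hS.
apply: (@le_trans _ _ (mu `[inf S, sup S]%classic)).
  by apply: le_measure => //; rewrite inE.
rewrite lebesgue_measure_itv/=; case: ifP => _.
  by rewrite -EFinB -EFinM lee_fin.
by rewrite -EFinM lee_fin mulr_ge0 ?ltW// subr_gt0.
Qed.

(** Lebesgue measure is computed from countable covers by intervals, so a bound
    on the preimages of intervals is enough. *)
Lemma preimage_measure_le (A : set R) : measurable A ->
  (mu (pi @^-1` A) <= K%:E * mu A)%E.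
Proof.
move=> mA.
have mp (B : set R) : measurable B -> measurable (pi @^-1` B).
  by move=> mB; rewrite -[_ @^-1` _]setTI; exact: mpi.
have [->|muA] := eqVneq (mu A) +oo%E; first by rewrite gt0_muley ?lte_fin// leey.
have fA : mu A \is a fin_num by rewrite ge0_fin_numE// ltey.
apply/lee_addgt0Pr => e e0.
have eK : 0 < e / K by rewrite divr_gt0.
have /ereal_inf_lt[z [/= M covM sMz zDe]] : (mu A < mu A + (e / K)%:E)%E.
  by rewrite lte_spaddre ?lte_fin.
apply: (@le_trans _ _ (K%:E * z)%E); last first.
  apply: (@le_trans _ _ (K%:E * (mu A + (e / K)%:E))%E).
    by rewrite lee_wpmul2l ?lee_fin ?ltW.
  rewrite muleDr// ?fin_num_adde_defl//; apply: leeD2l.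
  by rewrite -EFinM lee_fin mulrC divfK ?gt_eqF.
rewrite -sMz -nneseriesZl//=.
have cM k : ocitv (M k) by have [h _] := covM; exact: h.
have cov : pi @^-1` A `<=` \bigcup_k (pi @^-1` (M k)).
  by move=> x Ax; have [_ /(_ _ Ax)[k _ kx]] := covM; exists k.
have mM k : measurable (M k : set R).
  by have /ocitvP[->|[x _ ->]] := cM k.
apply: (@le_trans _ _ (\sum_(0 <= k <oo) mu (pi @^-1` (M k)))%E).
  apply: measure_sigma_subadditive => //; first by move=> k; exact: mp.
  exact: mp.
apply: lee_nneseries => // k _ .
have /ocitvP[->|[[a b] /= ab ->]] := cM k.
  by rewrite preimage_set0 measure0 wlength0 mule0.
rewrite wlength_itv_bnd/=; first exact: preimage_ocitv_le.
exact: ltW.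
Qed.

Lemma integral_comp_le (E : set R) (f : R -> \bar R) : measurable E ->
  measurable_fun [set: R] f -> (forall x, 0 <= f x)%E ->
  (\int[mu]_(x in pi @^-1` E) f (pi x) <= K%:E * \int[mu]_(x in E) f x)%E.
Proof.
move=> mE mf f0.
have <- := @ge0_integral_pushforward _ _ (measurableTypeR R) (measurableTypeR R) R
  pi mpi (@lebesgue_measure R) E f mE (measurable_funTS mf) (fun y _ => f0 y).
pose k := NngNum (ltW K0).
have <- := @ge0_integral_mscale _ (measurableTypeR R) R (@lebesgue_measure R) E mE k f
  (measurable_funTS mf) (fun x _ => f0 x).
apply: ge0_le_measure_integral => // A mA /=.
by rewrite /mscale/= /pushforward; exact: preimage_measure_le.
Qed.

End Transfer.

(** * Iterated integrals *)

Section Iterated.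
Context d1 d2 (T1 : measurableType d1) (T2 : measurableType d2) (R : realType).
Variables (m1 : {sigma_finite_measure set T1 -> \bar R}).
Variables (m2 : {sigma_finite_measure set T2 -> \bar R}).
Variables (I : set T1) (J : set T2) (f : T1 * T2 -> \bar R).
Hypotheses (mI : measurable I) (mJ : measurable J).
Hypothesis mf : measurable_fun (I `*` J) f.
Hypothesis f0 : forall z, (0 <= f z)%E.

Let g := (f \_ (I `*` J))%E.
Let mg : measurable_fun setT g.
Proof. by apply/(measurable_restrictT f) => //; exact: measurableX. Qed.
Let g0 z : (0 <= g z)%E. Proof. exact: erestrict_ge0. Qed.
Let inner y : J y -> (\int[m1]_x g (x, y) = \int[m1]_(x in I) f (x, y))%E.
Proof.
move=> Jy; rewrite [RHS]integral_mkcond; apply: eq_integral => x _.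
rewrite /g !patchE; case: ifPn; case: ifPn => //.
- by move=> /negP xI; rewrite inE => -[/mem_set].
- by move=> /set_mem xI /negP; rewrite inE; case.
Qed.

Lemma integral_rectangle :
  (\int[(m1 \x m2)%E]_(z in I `*` J) f z =
   \int[m2]_(y in J) \int[m1]_(x in I) f (x, y))%E.
Proof.
rewrite integral_mkcond (fubini_tonelli2 g mg g0) [RHS]integral_mkcond.
apply: eq_integral => y _; rewrite /fubini_G patchE; case: ifPn => [/set_mem|/negP] yJ.
  exact: inner.
apply: integral0_eq => x _; rewrite /g patchE ifF//; apply/negP.
by rewrite inE => -[_ /mem_set].
Qed.

Lemma measurable_inner_integral :
  measurable_fun J (fun y => \int[m1]_(x in I) f (x, y))%E.
Proof.
apply: (@eq_measurable_fun _ _ _ _ _ (fun y => \int[m1]_x g (x, y))%E).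
  by move=> y /set_mem; exact: inner.
apply: measurable_funTS; exact: (measurable_fun_fubini_tonelli_G g mg g0).
Qed.

Lemma integral_swap : (\int[m2]_(y in J) \int[m1]_(x in I) f (x, y) =
  \int[m1]_(x in I) \int[m2]_(y in J) f (x, y))%E.
Proof.
rewrite -integral_rectangle integral_mkcond (fubini_tonelli1 g mg g0) [RHS]integral_mkcond.
apply: eq_integral => x _; rewrite /fubini_F patchE; case: ifPn => [/set_mem|/negP] xI.
  rewrite [RHS]integral_mkcond; apply: eq_integral => y _.
  rewrite /g !patchE; case: ifPn; case: ifPn => //.
  - by move=> /negP yJ; rewrite inE => -[_ /mem_set].
  - by move=> /set_mem yJ /negP; rewrite inE; case.
apply: integral0_eq => y _; rewrite /g patchE ifF//; apply/negP.
by rewrite inE => -[/mem_set].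
Qed.
End Iterated.

Section Measurability.
Context {R : realType}.
Local Notation mu := (@lebesgue_measure R).
Local Notation mu2 := (mu \x mu)%E.

Lemma measurable_invr : measurable_fun [set: R] (@GRing.inv R).
Proof.
have -> : @GRing.inv R = fun x => x * powR (x ^+ 2) (- 1).
  apply/funext => x; have [->|x0] := eqVneq x 0; first by rewrite invr0 mul0r.
  by rewrite powR_inv1 ?sqr_ge0// expr2 invfM mulrA mulfV// mul1r.
apply: measurable_funM => //.
exact: (measurableT_comp (measurable_powR (- 1)) (exprn_measurable (D := setT) 2)).
Qed.

Lemma measurable_sqrE d (T : measurableType d) (A : set T) (f : T -> R) :
  measurable_fun A f -> measurable_fun A (fun x => (f x ^+ 2)%:E).
Proof. by move=> mf; apply/measurable_EFinP; exact: measurable_funX. Qed.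

Section Plane.
Variables (I J : set R) (f : R * R -> \bar R).
Hypotheses (mI : measurable I) (mJ : measurable J).
Hypotheses (mf : measurable_fun (I `*` J) f) (f0 : forall z, (0 <= f z)%E).

Lemma iterated_integral : (\int[mu2]_(z in I `*` J) f z =
  \int[mu]_(y in J) \int[mu]_(x in I) f (x, y))%E.
Proof.
exact: (@integral_rectangle _ _ (measurableTypeR R) (measurableTypeR R) R mu mu I J f mI mJ mf f0).
Qed.

Lemma measurable_iterated : measurable_fun J (fun y => \int[mu]_(x in I) f (x, y))%E.
Proof.
exact: (@measurable_inner_integral _ _ (measurableTypeR R) (measurableTypeR R) R mu I J f mI mJ mf f0).
Qed.
End Plane.

(** The Gagliardo integrand is the square of this quotient, which vanishes on the
    diagonal because there the inverse is that of zero. *)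
Definition dq (u : R -> R) (z : R * R) : R := (u z.1 - u z.2) / (z.1 - z.2).

Lemma measurable_dq (I : set R) (u : R -> R) : measurable I ->
  measurable_fun I u -> measurable_fun (I `*` I) (dq u).
Proof.
move=> mI mf; apply: measurable_funM.
  have mII : measurable (I `*` I) by exact: measurableX.
  apply: measurable_funB.
    apply: (measurable_comp (F := I) (g := fst) _ _ mf) => //.
      by move=> _ [[x y] [/= Ix _] <-].
    exact: measurable_funS measurable_fst.
  apply: (measurable_comp (F := I) (g := snd) _ _ mf) => //.
    by move=> _ [[x y] [/= _ Ix] <-].
  exact: measurable_funS measurable_snd.
apply: (measurableT_comp measurable_invr).
apply: (measurable_funS measurableT) => //; exact: measurable_funB.
Qed.

Lemma integral_comp2_le (K : R) (p : R -> R) (f : R * R -> \bar R) :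
  0 < K -> measurable_fun [set: R] p ->
  (forall x y, `|x - y| <= K * `|p x - p y|) ->
  measurable_fun [set: R * R] f -> (forall z, 0 <= f z)%E ->
  (\int[mu2]_z f (p z.1, p z.2) <= (K ^+ 2)%:E * \int[mu2]_z f z)%E.
Proof.
move=> K0 mp Kp mf f0.
have mp2 : measurable_fun [set: R * R] (fun z : R * R => (p z.1, p z.2)).
  by apply/measurable_fun_pairP; split => /=; exact: (measurableT_comp mp).
have mp1 : measurable_fun [set: R * R] (fun z : R * R => (z.1, p z.2)).
  by apply/measurable_fun_pairP; split => /=; [exact: measurable_fst|exact: (measurableT_comp mp)].
have mfp := measurableT_comp mf mp2; have mf1 := measurableT_comp mf mp1.
rewrite -setXTT !iterated_integral ?setXTT//.
apply: (@le_trans _ _ (\int[mu]_y (K%:E * \int[mu]_x f (x, p y)))%E).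
  apply: ge0_le_integral => //.
  - by move=> y _; exact: integral_ge0.
  - by apply: (@measurable_iterated setT setT (fun z => f (p z.1, p z.2))); rewrite ?setXTT.
  - apply: measurable_funeM.
    by apply: (@measurable_iterated setT setT (fun z => f (z.1, p z.2))); rewrite ?setXTT.
  - move=> y _; apply: (@integral_comp_le R K p K0 mp Kp setT (fun x => f (x, p y))) => //.
    exact: (measurable_fun_pair1 (p y)).
have mG : measurable_fun [set: R] (fun y => \int[mu]_x f (x, y))%E.
  by apply: (@measurable_iterated setT setT f); rewrite ?setXTT.
apply: le_trans (@integral_comp_le R K p K0 mp Kp setT
   (fun y => (K%:E * \int[mu]_x f (x, y))%E) measurableT _ _) _.
- exact: measurable_funeM.
- by move=> y; apply: mule_ge0; [rewrite lee_fin; exact: ltW|exact: integral_ge0].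
rewrite ge0_integralZl//; last 2 first.
- by move=> y _; exact: integral_ge0.
- by rewrite lee_fin ltW.
by rewrite muleA -EFinM expr2.
Qed.

Lemma integral_comp2_set_le (K : R) (p : R -> R) (A : set (R * R))
    (f : R * R -> \bar R) :
  0 < K -> measurable_fun [set: R] p ->
  (forall x y, `|x - y| <= K * `|p x - p y|) ->
  measurable A -> measurable_fun [set: R * R] f -> (forall z, 0 <= f z)%E ->
  (\int[mu2]_(z in [set z | A (p z.1, p z.2)]) f (p z.1, p z.2) <=
   (K ^+ 2)%:E * \int[mu2]_(z in A) f z)%E.
Proof.
move=> K0 mp Kp mA mf f0.
rewrite integral_mkcond [in leRHS]integral_mkcond.
apply: le_trans (@integral_comp2_le K p (f \_ A)%E K0 mp Kp _ _) => //.
- by apply/(measurable_restrictT f) => //; exact: measurable_funTS.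
- by move=> z; exact: erestrict_ge0.
Qed.

End Measurability.

(** * Energy on regions of the square *)

Section Energy.
Context {R : realType}.
Local Notation mu := (@lebesgue_measure R).
Local Notation mu2 := (mu \x mu)%E.
Implicit Types (u f g : R -> R) (A B C : set (R * R)).

Definition box (l : R) : set (R * R) := `]0, l[%classic `*` `]0, l[%classic.
(** Long-range interactions survive the cutting of an interval into blocks, and on
    them the energy is continuous for the L2 norm. *)
Definition far (r : R) : set (R * R) := [set z | r <= `|z.1 - z.2|].

Definition energy_on A u : \bar R := (\int[mu2]_(z in A) (dq u z ^+ 2)%:E)%E.
(** Twice the variance when A is the unit square. *)
Definition spread_on A u : \bar R := (\int[mu2]_(z in A) ((u z.1 - u z.2) ^+ 2)%:E)%E.

Lemma measurable_box l : measurable (box l).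
Proof. exact: measurableX. Qed.

Lemma measurable_far r : measurable (far r).
Proof.
rewrite -[far r]setTI.
have h : measurable_fun [set: R * R] (fun z : R * R => `|z.1 - z.2|).
  by apply: (measurableT_comp (@normr_measurable R setT)); exact: measurable_funB.
have -> : far r = (fun z : R * R => `|z.1 - z.2|) @^-1` `[r, +oo[%classic.
  by apply/seteqP; split => z /=; rewrite in_itv/= andbT.
exact: h.
Qed.

Lemma measurable_dqT u : measurable_fun [set: R] u -> measurable_fun [set: R * R] (dq u).
Proof. by move=> mf; rewrite -setXTT; exact: measurable_dq. Qed.

Lemma measurable_diffT u : measurable_fun [set: R] u ->
  measurable_fun [set: R * R] (fun z : R * R => u z.1 - u z.2).
Proof.
by move=> mf; apply: measurable_funB;
  [exact: (measurableT_comp mf measurable_fst)|exact: (measurableT_comp mf measurable_snd)].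
Qed.

Lemma measurable_dq2 u : measurable_fun [set: R] u ->
  measurable_fun [set: R * R] (fun z => (dq u z ^+ 2)%:E).
Proof.
move=> mf; apply: measurable_sqrE; exact: measurable_dqT.
Qed.

Lemma measurable_diff2 u : measurable_fun [set: R] u ->
  measurable_fun [set: R * R] (fun z => ((u z.1 - u z.2) ^+ 2)%:E).
Proof.
move=> mf; apply: measurable_sqrE; exact: measurable_diffT.
Qed.

Lemma gagliardoE l u : measurable_fun (`]0, l[%classic : set R) u ->
  gagliardo l u = energy_on (box l) u.
Proof.
move=> mf.
have mfd : measurable_fun (`]0, l[%classic `*` `]0, l[%classic : set (R * R))
    (fun z => (dq u z ^+ 2)%:E).
  by apply: measurable_sqrE; exact: measurable_dq.
rewrite /energy_on iterated_integral//; last by move=> z; rewrite lee_fin sqr_ge0.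
apply: eq_integral => y _; apply: eq_integral => x _.
by rewrite /dq expr_div_n !real_normK ?num_real.
Qed.

Lemma energy_on_ge0 A u : (0 <= energy_on A u)%E.
Proof. by apply: integral_ge0 => z _; rewrite lee_fin sqr_ge0. Qed.

Lemma spread_on_ge0 A u : (0 <= spread_on A u)%E.
Proof. by apply: integral_ge0 => z _; rewrite lee_fin sqr_ge0. Qed.

Hint Resolve energy_on_ge0 spread_on_ge0 : core.

Lemma energy_on_subset A B u : measurable_fun [set: R] u -> measurable A -> measurable B ->
  A `<=` B -> (energy_on A u <= energy_on B u)%E.
Proof.
move=> mf mA mB AB; apply: ge0_subset_integral => //.
- by apply: measurable_funTS; exact: measurable_dq2.
- by move=> z _; rewrite lee_fin sqr_ge0.
Qed.

Lemma energy_onU A B C u : measurable_fun [set: R] u -> measurable A -> measurable B ->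
  measurable C -> A `|` B `<=` C -> [disjoint A & B] ->
  (energy_on A u + energy_on B u <= energy_on C u)%E.
Proof.
move=> mf mA mB mC ABC AB; rewrite /energy_on -ge0_integral_setU//.
- apply: energy_on_subset => //; exact: measurableU.
- by apply: measurable_funTS; exact: measurable_dq2.
- by move=> z _; rewrite lee_fin sqr_ge0.
Qed.

Lemma energy_onU_le A B C u : measurable_fun [set: R] u -> measurable A -> measurable B ->
  measurable C -> C `<=` A `|` B ->
  (energy_on C u <= energy_on A u + energy_on B u)%E.
Proof.
move=> mf mA mB mC CAB.
have mBA : measurable (B `\` A) by exact: measurableD.
apply: (@le_trans _ _ (energy_on (A `|` (B `\` A)) u)).
  apply: energy_on_subset => //; first exact: measurableU.
  by move=> z /CAB[Az|Bz]; [left|have [Az|Az] := pselect (A z); [left|right]].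
rewrite /energy_on ge0_integral_setU//.
- by apply: leeD2l; apply: energy_on_subset => //; exact: subDsetl.
- by apply: measurable_funTS; exact: measurable_dq2.
- by move=> z _; rewrite lee_fin sqr_ge0.
- by rewrite disj_set2E setDIK.
Qed.

Lemma young_sq (a b t : R) : 0 < t -> (a + b) ^+ 2 <= (1 + t) * a ^+ 2 + (1 + t^-1) * b ^+ 2.
Proof.
move=> t0; rewrite -subr_ge0.
have -> : (1 + t) * a ^+ 2 + (1 + t^-1) * b ^+ 2 - (a + b) ^+ 2 = t^-1 * (t * a - b) ^+ 2.
  by field; rewrite gt_eqF.
by rewrite mulr_ge0 ?sqr_ge0 ?invr_ge0// ltW.
Qed.

Lemma sqr_le_norm (a b : R) : `|a| <= `|b| -> a ^+ 2 <= b ^+ 2.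
Proof.
by move=> ab; rewrite -(real_normK (num_real a)) -(real_normK (num_real b)) lerXn2r ?nnegrE.
Qed.

Lemma dqD f g z : dq (fun x => f x + g x) z = dq f z + dq g z.
Proof. by rewrite /dq -mulrDl opprD addrACA. Qed.

Lemma energy_on_young A f g (t : R) : measurable_fun [set: R] f -> measurable_fun [set: R] g ->
  measurable A -> 0 < t ->
  (energy_on A (fun x => f x + g x)%R <=
   (1 + t)%:E * energy_on A f + (1 + t^-1)%:E * energy_on A g)%E.
Proof.
move=> mf mg mA t0.
have t1 : 0 <= 1 + t by rewrite addr_ge0// ltW.
have t2 : 0 <= 1 + t^-1 by rewrite addr_ge0// invr_ge0 ltW.
have mf2 : measurable_fun A (fun z => (dq f z ^+ 2)%:E) by apply: measurable_funTS; exact: measurable_dq2.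
have mg2 : measurable_fun A (fun z => (dq g z ^+ 2)%:E) by apply: measurable_funTS; exact: measurable_dq2.
rewrite /energy_on -ge0_integralZl//; last by move=> z _; rewrite lee_fin sqr_ge0.
rewrite -ge0_integralZl//; last by move=> z _; rewrite lee_fin sqr_ge0.
rewrite -ge0_integralD//.
- apply: ge0_le_integral => //.
  + by move=> z _; rewrite lee_fin sqr_ge0.
  + by apply: measurable_funTS; apply: measurable_dq2; exact: measurable_funD.
  + by apply: emeasurable_funD; exact: measurable_funeM.
  + by move=> z _; rewrite -!EFinM -EFinD lee_fin dqD young_sq.
- by move=> z _; rewrite mule_ge0// lee_fin sqr_ge0.
- exact: measurable_funeM.
- by move=> z _; rewrite mule_ge0// lee_fin sqr_ge0.
- exact: measurable_funeM.
Qed.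

Lemma measurable_pair_preim (p : R -> R) A : measurable_fun [set: R] p -> measurable A ->
  measurable [set z : R * R | A (p z.1, p z.2)].
Proof.
move=> mp mA.
have mp2 : measurable_fun [set: R * R] (fun z : R * R => (p z.1, p z.2)).
  by apply/measurable_fun_pairP; split => /=; exact: (measurableT_comp mp).
by rewrite -[X in measurable X]setTI; exact: mp2.
Qed.

(** The change of variables p shortens distances, so difference quotients only
    grow when they are measured along p; each variable costs a factor K. *)
Lemma energy_on_comp (K : R) (p : R -> R) A u : 0 < K ->
  measurable_fun [set: R] p -> measurable_fun [set: R] u -> measurable A ->
  (forall x y, `|x - y| <= K * `|p x - p y|) -> (forall x y, `|p x - p y| <= `|x - y|) ->
  (energy_on [set z | A (p z.1, p z.2)] (u \o p) <= (K ^+ 2)%:E * energy_on A u)%E.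
Proof.
move=> K0 mp mf mA Kp p1.
apply: le_trans (integral_comp2_set_le K0 mp Kp mA (measurable_dq2 mf) _); last first.
  by move=> z; rewrite lee_fin sqr_ge0.
have mp2 : measurable_fun [set: R * R] (fun z : R * R => (p z.1, p z.2)).
  by apply/measurable_fun_pairP; split => /=; exact: (measurableT_comp mp).
apply: ge0_le_integral => //.
- exact: (measurable_pair_preim mp mA).
- by move=> z _; rewrite lee_fin sqr_ge0.
- by apply: measurable_funTS; apply: measurable_dq2; exact: measurableT_comp.
- by apply: measurable_funTS; exact: (measurableT_comp (measurable_dq2 mf) mp2).
- move=> z _; rewrite lee_fin /dq/=; apply: sqr_le_norm; rewrite !normrM !normfV.
  have [->|pz] := eqVneq (p z.1) (p z.2); first by rewrite !subrr normr0 !mul0r.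
  apply: ler_wpM2l => //; rewrite lef_pV2 ?posrE ?normr_gt0 ?subr_eq0//.
  by apply: contra_neq pz => ->.
Qed.

Lemma affine_lip (a b x y : R) : 0 < a -> `|x - y| = a^-1 * `|(a * x + b) - (a * y + b)|.
Proof.
move=> a0; have -> : a * x + b - (a * y + b) = a * (x - y) by ring.
by rewrite normrM (gtr0_norm a0) mulrA mulVf ?gt_eqF// mul1r.
Qed.

Lemma measurable_affine (a b : R) : measurable_fun [set: R] (fun x : R => a * x + b).
Proof. by apply: measurable_funD => //; exact: measurable_funM. Qed.

(** The kernel is homogeneous of degree - 2, which compensates the Jacobian of a
    dilation of the plane. The reverse inequality is this one for the inverse
    map. *)
Lemma energy_on_affine (a b : R) A u : 0 < a -> measurable_fun [set: R] u -> measurable A ->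
  (energy_on [set z | A (a * z.1 + b, a * z.2 + b)%R] (fun x => u (a * x + b)%R) <=
   energy_on A u)%E.
Proof.
move=> a0 mf mA.
have mp := measurable_affine a b.
have Kp x y : `|x - y| <= a^-1 * `|(a * x + b) - (a * y + b)| by rewrite -affine_lip.
have a0' : 0 < a^-1 by rewrite invr_gt0.
have := integral_comp2_set_le a0' mp Kp mA (measurable_dq2 mf).
move=> /(_ _) h; have {}h := h (fun z => ltac:(by rewrite lee_fin sqr_ge0)).
have mp2 : measurable_fun [set: R * R] (fun z : R * R => (a * z.1 + b, a * z.2 + b)).
  by apply/measurable_fun_pairP; split => /=; exact: (measurableT_comp mp).
have mpA := measurable_pair_preim mp mA.
rewrite /energy_on.
under eq_integral => z _.
  have -> : dq (fun x => u (a * x + b)) z ^+ 2 = a ^+ 2 * dq u (a * z.1 + b, a * z.2 + b) ^+ 2.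
    rewrite -exprMn /dq/=; congr (_ ^+ 2).
    have -> : a * z.1 + b - (a * z.2 + b) = a * (z.1 - z.2) by ring.
    by rewrite invfM mulrCA mulVKf ?gt_eqF.
  rewrite EFinM.
  over.
rewrite ge0_integralZl//.
- rewrite -[leRHS]mul1e -(_ : (a ^+ 2)%:E * (a^-1 ^+ 2)%:E = 1)%E; last first.
    by rewrite -EFinM -exprMn mulfV ?gt_eqF// expr1n.
  by rewrite -muleA; apply: lee_wpmul2l => //; rewrite lee_fin sqr_ge0.
- apply: measurable_funTS; exact: (measurableT_comp (measurable_dq2 mf) mp2).
- by move=> z _; rewrite lee_fin sqr_ge0.
- by rewrite lee_fin sqr_ge0.
Qed.

Lemma energy_on_dilate (l : R) A u : 0 < l -> measurable A -> measurable_fun [set: R] u ->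
  (energy_on [set z | A (l * z.1, l * z.2)%R] (fun x => u (l * x)%R) <= energy_on A u)%E.
Proof.
move=> l0 mA mp; have := energy_on_affine 0 l0 mp mA.
rewrite (_ : (fun x => u (l * x + 0)) = (fun x => u (l * x))); last first.
  by apply/funext => x; rewrite addr0.
by rewrite (_ : [set z | A (l * z.1 + 0, l * z.2 + 0)] = [set z | A (l * z.1, l * z.2)])//;
  apply/seteqP; split => z /=; rewrite !addr0.
Qed.

Lemma energy_on_addc A u (c : R) : energy_on A (fun x => u x + c) = energy_on A u.
Proof.
apply: eq_integral => z _; congr ((_ ^+ 2)%:E); rewrite /dq; congr (_ / _); ring.
Qed.

Definition rescale (l : R) u (z : R) : R := u (l * z) / Num.sqrt l.

Lemma measurable_rescale l u : measurable_fun [set: R] u -> measurable_fun [set: R] (rescale l u).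
Proof.
move=> mf; apply: measurable_funM => //; apply: (measurableT_comp mf); exact: measurable_funM.
Qed.

Lemma energy_rescaleE (l : R) A u : 0 < l -> measurable A -> measurable_fun [set: R] u ->
  energy_on A (rescale l u) = ((l^-1)%:E * energy_on A (fun x => u (l * x)%R))%E.
Proof.
move=> l0 mA mf.
have mfl : measurable_fun [set: R] (fun x => u (l * x)).
  by apply: (measurableT_comp mf); exact: measurable_funM.
rewrite /energy_on -ge0_integralZl//; last 3 first.
- by apply: measurable_funTS; exact: measurable_dq2.
- by move=> z _; rewrite lee_fin sqr_ge0.
- by rewrite lee_fin invr_ge0 ltW.
apply: eq_integral => z _; rewrite -EFinM; congr (_ %:E); rewrite /dq /rescale -mulrBl mulrAC.
by rewrite [LHS]exprMn exprVn sqr_sqrtr ?(ltW l0)// mulrC.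
Qed.

Lemma energy_rescale (l : R) A u : 0 < l -> measurable A -> measurable_fun [set: R] u ->
  (energy_on [set z | A (l * z.1, l * z.2)%R] (rescale l u) <= (l^-1)%:E * energy_on A u)%E.
Proof.
move=> l0 mA mf; rewrite energy_rescaleE//.
  by apply: lee_wpmul2l; [rewrite lee_fin invr_ge0 ltW|exact: energy_on_dilate].
have ml : measurable_fun [set: R] (fun x : R => l * x) by exact: measurable_funM.
exact: (measurable_pair_preim ml mA).
Qed.

(** Cutting an interval into blocks discards the interactions between blocks;
    those at distance at least the block length can be kept. *)
Lemma energy_blocks (L l : R) (k : nat) u : 0 < L -> k%:R * L <= l ->
  measurable_fun [set: R] u ->
  (\sum_(j < k) energy_on (box L) (fun x => u (x + j%:R * L)%R) +
   energy_on (box l `&` far L) u <= energy_on (box l) u)%E.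
Proof.
move=> L0 kl mf.
have mF : measurable (box l `&` far L) by apply: measurableI; [exact: measurable_box|exact: measurable_far].
apply: (@le_trans _ _ (energy_on (box (k%:R * L) `|` (box l `&` far L)) u)); last first.
  apply: energy_on_subset => //; [apply: measurableU => //|..]; try exact: measurable_box.
  rewrite subUset; split; last exact: subIsetl.
  move=> [x y]; rewrite /box/= !in_itv/= => -[/andP[-> h1] /andP[-> h2]]; split => /=;
  exact: lt_le_trans kl.
elim: k kl => [_|k IH kl].
  rewrite big_ord0 add0e; apply: (energy_on_subset mf mF).
    by apply: measurableU => //; exact: measurable_box.
  exact: subsetUr.
have kl' : k%:R * L <= l by apply: le_trans kl; rewrite ler_pM2r// ler_nat.
rewrite big_ord_recr/= addeAC.
apply: (@le_trans _ _ (energy_on (box (k%:R * L) `|` (box l `&` far L)) u +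
   energy_on [set z | box L (1 * z.1 + (- (k%:R * L)), 1 * z.2 + (- (k%:R * L)))%R] u)%E).
  apply: leeD; first exact: IH.
  have := @energy_on_affine 1 (k%:R * L)
    [set z | box L (1 * z.1 + (- (k%:R * L)), 1 * z.2 + (- (k%:R * L)))] u ltr01 mf.
  have -> : (fun x => u (1 * x + k%:R * L)) = (fun x => u (x + k%:R * L)).
    by apply/funext => x; rewrite mul1r.
  have -> : [set z | [set z | box L (1 * z.1 + (- (k%:R * L)), 1 * z.2 + (- (k%:R * L)))]
      (1 * z.1 + k%:R * L, 1 * z.2 + k%:R * L)] = box L.
    by apply/seteqP; split => -[x y]; rewrite /box/= !mul1r !addrK.
  apply; apply: (@measurable_pair_preim (fun x => 1 * x + (- (k%:R * L)))).
    exact: measurable_affine.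
  exact: measurable_box.
apply: energy_onU => //.
- by apply: measurableU => //; exact: measurable_box.
- apply: (@measurable_pair_preim (fun x => 1 * x + (- (k%:R * L)))).
    exact: measurable_affine.
  exact: measurable_box.
- by apply: measurableU => //; exact: measurable_box.
- rewrite -natr1 mulrDl mul1r; move=> [x y] [[|]|].
  + rewrite /box/= !in_itv/= => -[/andP[-> h1] /andP[-> h2]]; left; split => /=; lra.
  + by right.
  + rewrite /box/= !in_itv/= !mul1r => -[/andP[h1 h2] /andP[h3 h4]]; left.
    have : 0 <= k%:R * L by rewrite mulr_ge0// ltW.
    by split => /=; lra.
- apply/disj_setPS => -[x y] []; rewrite /box/far/= !in_itv/= !mul1r => h [/andP[h1 h2] /andP[h3 h4]].
  case: h => [[/andP[h5 h6] /andP[h7 h8]]|[_ ]]; first by lra.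
  by apply/negP; rewrite -ltNge ltr_norml; lra.
Qed.

End Energy.
#[global] Hint Resolve energy_on_ge0 spread_on_ge0 : core.

(** * Ramps and profiles *)

Section Ramps.
Context {R : realType}.
Implicit Types (x y w a c : R) (X : seq R).

(** A primitive of the indicator of the core of width w at 0, written with positive
    parts so that only their weak derivative has to be computed. *)
Definition ramp w x : R := Num.max 0 (x + w / 2) - Num.max 0 (x - w / 2).
Definition rampsum w X x : R := \sum_(c <- X) ramp w (x - c).
Definition spaced w X : bool := sorted (fun a b => a + w <= b) X.

Lemma ramp_le w x : 0 <= w -> x <= - (w / 2) -> ramp w x = 0.
Proof. by move=> w0 h; rewrite /ramp /Num.max; case: ltP => ?; case: ltP => ?; lra. Qed.

Lemma ramp_ge w x : 0 <= w -> w / 2 <= x -> ramp w x = w.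
Proof. by move=> w0 h; rewrite /ramp /Num.max; case: ltP => ?; case: ltP => ?; lra. Qed.

Lemma spaced_trans w : 0 <= w -> transitive (fun a b : R => a + w <= b).
Proof. by move=> w0 y x z h1 h2; lra. Qed.

Lemma spaced_cons w c X : 0 <= w -> spaced w (c :: X) ->
  spaced w X /\ (forall d, d \in X -> c + w <= d).
Proof.
move=> w0; rewrite /spaced /= (path_sortedE (spaced_trans w0)) => /andP[/allP h1 h2].
by split.
Qed.

Lemma spaced_filter w (P : pred R) X : 0 <= w -> spaced w X -> spaced w (seq.filter P X).
Proof. by move=> w0; apply: sorted_filter; exact: spaced_trans. Qed.

Lemma spaced_map w (f : R -> R) X : (forall a b, a + w <= b -> f a + w <= f b) ->
  spaced w X -> spaced w (map f X).
Proof. by move=> h; rewrite /spaced sorted_map; apply: sub_sorted => x y /=; exact: h. Qed.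

Lemma max0_incr (p q p' q' : R) : p <= q -> p' <= p -> q' + p = p' + q ->
  Num.max 0 p - Num.max 0 p' <= Num.max 0 q - Num.max 0 q'.
Proof.
move=> pq p'p e; have -> : q' = p' + q - p by rewrite -e addrK.
rewrite /Num.max; case: (ltP 0 p) => ?; case: (ltP 0 p') => ?; case: (ltP 0 q) => ?;
  case: ltP => ?; lra.
Qed.

(** The induction hypothesis is localized to the right of the first ramp: the
    increments of the sum are compared with those of the positive part at a. *)
Lemma rampsum_incr_from w X a x y : 0 <= w -> spaced w X ->
  (forall c, c \in X -> a + w / 2 <= c) -> x <= y ->
  0 <= rampsum w X y - rampsum w X x <= Num.max 0 (y - a) - Num.max 0 (x - a).
Proof.
move=> w0; elim: X a => [|c X IH] a sX aX xy.
  by rewrite /rampsum !big_nil subrr lexx /= /Num.max; case: ltP => ?; case: ltP => ?; lra.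
have [sX' cX] := spaced_cons w0 sX.
have ac : a + w / 2 <= c by apply: aX; rewrite mem_head.
have h : forall d, d \in X -> (c + w / 2) + w / 2 <= d by move=> d /cX; lra.
have /andP[] := IH _ sX' h xy.
rewrite /rampsum !big_cons -/(rampsum _ _ _) -/(rampsum _ _ _).
move: (rampsum w X y) (rampsum w X x) => s t; rewrite /ramp.
have -> : y - (c + w / 2) = y - c - w / 2 by ring.
have h1 := max0_incr (_ : y - c + w / 2 <= y - a) (_ : x - c + w / 2 <= y - c + w / 2)
  (_ : x - a + (y - c + w / 2) = (x - c + w / 2) + (y - a)).
have {}h1 := h1 ltac:(lra) ltac:(lra) ltac:(ring).
have h2 := max0_incr (_ : y - c - w / 2 <= y - c + w / 2) (_ : x - c - w / 2 <= y - c - w / 2)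
  (_ : x - c + w / 2 + (y - c - w / 2) = (x - c - w / 2) + (y - c + w / 2)).
have {}h2 := h2 ltac:(lra) ltac:(lra) ltac:(ring).
have -> : x - (c + w / 2) = x - c - w / 2 by ring.
move: h1 h2.
move: (Num.max 0 (y - c + w / 2)) (Num.max 0 (x - c + w / 2)) (Num.max 0 (y - c - w / 2)).
move: (Num.max 0 (x - c - w / 2)) (Num.max 0 (y - a)) (Num.max 0 (x - a)) => *; lra.
Qed.

(** Disjoint ramps never climb simultaneously, so their sum is nondecreasing and
    1-Lipschitz. *)
Lemma rampsum_incr w X x y : 0 <= w -> spaced w X -> x <= y ->
  0 <= rampsum w X y - rampsum w X x <= y - x.
Proof.
move=> w0 sX xy; case: X sX => [|c X] sX.
  by rewrite /rampsum !big_nil subrr lexx subr_ge0.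
have [sX' cX] := spaced_cons w0 sX.
have := @rampsum_incr_from w (c :: X) (Num.min (c - w / 2) x) x y w0 sX _ xy.
have -> : Num.max 0 (y - Num.min (c - w / 2) x) - Num.max 0 (x - Num.min (c - w / 2) x) = y - x.
  by rewrite /Num.max /Num.min; case: (ltP (c - w / 2) x) => ?; case: ltP => ?; case: ltP => ?; lra.
apply=> d; have : Num.min (c - w / 2) x <= c - w / 2 by rewrite ge_min lexx.
by move=> h; rewrite inE => /orP[/eqP ->|/cX]; lra.
Qed.

(** A ramp to the left of the interval has already reached its full height, a ramp
    to the right has not started. *)
Lemma rampsum_localize w X (P : pred R) a b x : 0 <= w ->
  (forall c, c \in X -> [|| c <= a - w / 2, P c | b + w / 2 <= c]) -> a <= x <= b ->
  rampsum w X x = rampsum w (seq.filter P X) x +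
    w * (count (fun c => (c <= a - w / 2) && ~~ P c) X)%:R.
Proof.
move=> w0; elim: X => [|c X IH] h /andP[ax xb].
  by rewrite /rampsum !big_nil mulr0 addr0.
have {}IH := IH (fun d dX => h d (mem_behead (s := c :: X) dX)) ltac:(by rewrite ax xb).
have /or3P hc := h c (mem_head _ _).
rewrite /= /rampsum big_cons -/(rampsum w X x) IH.
have [Pc|nPc] /= := boolP (P c).
  by rewrite big_cons andbF add0n addrA.
rewrite andbT natrD mulrDr [RHS]addrCA; congr (_ + _).
have [ca|ca] /= := leP c (a - w / 2); first by rewrite ramp_ge ?mulr1//; lra.
rewrite mulr0 ramp_le//; case: hc => [?|Pc|?]; [lra|by rewrite Pc in nPc|lra].
Qed.

Lemma rampsum_shift w X a x :
  rampsum w X (x + a) = rampsum w [seq c - a | c <- X] x.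
Proof. by rewrite /rampsum big_map; apply: eq_bigr => c _; congr ramp; ring. Qed.

Lemma rampsum_cat w X Y x : rampsum w (X ++ Y) x = rampsum w X x + rampsum w Y x.
Proof. by rewrite /rampsum big_cat. Qed.

Lemma rampsum_ge w X x : 0 <= w -> (forall c, c \in X -> c <= x - w / 2) ->
  rampsum w X x = w * (size X)%:R.
Proof.
move=> w0; elim: X => [|c X IH] h; first by rewrite /rampsum big_nil mulr0.
rewrite /rampsum big_cons -/(rampsum w X x) IH; last by move=> d dX; apply: h; rewrite inE dX orbT.
rewrite ramp_ge//; first by rewrite /= -natr1; ring.
by have := h c (mem_head _ _); lra.
Qed.

Lemma rampsum_le w X x : 0 <= w -> (forall c, c \in X -> x + w / 2 <= c) ->
  rampsum w X x = 0.
Proof.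
move=> w0 h; rewrite /rampsum big_seq big1// => c cX; rewrite ramp_le//.
by have := h c cX; lra.
Qed.

End Ramps.

Section Profiles.
Context {R : realType} (lam Lam delta : R).
Hypotheses (lam_gt0 : 0 < lam) (le_lam_Lam : lam <= Lam) (delta_gt0 : 0 < delta).
Implicit Types (X : seq R) (x y a m l K : R).

Ltac hlra := move: (lam_gt0) (le_lam_Lam) (delta_gt0) => ? ? ?; lra.

Definition profile X x : R := lam * x - (Lam + lam) * rampsum delta X x.

Lemma profileE X x : profile X x = lam * x - (Lam + lam) * rampsum delta X x.
Proof. by []. Qed.

Lemma profile_incr X x y : spaced delta X -> x <= y ->
  - Lam * (y - x) <= profile X y - profile X x <= lam * (y - x).
Proof.
move=> sX xy; have /andP[h1 h2] := rampsum_incr (ltW delta_gt0) sX xy.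
rewrite /profile; apply/andP; split; last first.
  have : 0 <= (Lam + lam) * (rampsum delta X y - rampsum delta X x) by apply: mulr_ge0; [hlra|exact: h1].
  lra.
have : (Lam + lam) * (rampsum delta X y - rampsum delta X x) <= (Lam + lam) * (y - x).
  by apply: ler_wpM2l => //; hlra.
lra.
Qed.

Lemma profile_lip X x y : spaced delta X -> `|profile X x - profile X y| <= Lam * `|x - y|.
Proof.
move=> sX; wlog xy : x y / x <= y.
  by move=> h; have [/h //|/ltW/h] := leP x y; rewrite distrC [`|y - x|]distrC.
have /andP[h1 h2] := profile_incr sX xy.
rewrite distrC [`|x - y|]distrC [`|y - x|]ger0_norm ?subr_ge0//.
rewrite ler_norml -mulNr h1/=; apply: le_trans h2 _.
by rewrite ler_wpM2r// subr_ge0.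
Qed.

(** Open intervals of length delta are disjoint exactly when their centres are
    delta apart; sorting makes this a condition on consecutive centres. *)
Lemma AD_spaced l X : AD delta l X <->
  spaced delta X /\ forall c : R, c \in X -> - (delta / 2) < c < l + delta / 2.
Proof.
split => [[sX rX dX]|[sX rX]].
  split; last by move=> c /rX; rewrite in_itv.
  move: sX; rewrite /spaced (sorted_pairwise lt_trans) (sorted_pairwise (spaced_trans (ltW delta_gt0))).
  apply: (sub_in_pairwise (P := fun c => c \in X)); last exact/allP.
  move=> a b aX bX ab; rewrite leNgt; apply/negP => ba.
  have := dX a b aX bX; rewrite /core => h.
  suff : a = b by move=> e; rewrite e ltxx in ab.
  apply: h; exists ((a + b) / 2); split => /=; rewrite in_itv/=; hlra.
split; last 1 first.
- move: sX; rewrite /spaced (sorted_pairwise (spaced_trans (ltW delta_gt0))) => sX.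
  move=> a b /= aX bX; rewrite /core => -[z [/=]]; rewrite !in_itv/= => za zb.
  apply/eqP/negPn/negP => ab.
  have : (a + delta <= b) || (b + delta <= a); last by lra.
  elim: X sX aX bX {rX} => //= c X IH /andP[/allP h1 h2].
  rewrite !inE => /orP[/eqP ac|aX] /orP[/eqP bc|bX].
  + by rewrite ac bc eqxx in ab.
  + by rewrite ac h1.
  + by rewrite bc h1// orbT.
  + exact: IH.
- have h (a b : R) : a + delta <= b -> a < b by move=> ?; hlra.
  exact: (sub_sorted h).
- by move=> c /rX; rewrite in_itv.
Qed.

(** The dislocations whose cores meet (a, a + m), seen from a. *)
Definition window a m X : seq R :=
  [seq c - a | c <- X & (a - delta / 2 < c) && (c < a + m + delta / 2)].

Lemma window_AD a m X : spaced delta X -> AD delta m (window a m X).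
Proof.
move=> sX; apply/AD_spaced; split.
  apply: spaced_map; first by move=> x y ?; lra.
  exact: spaced_filter (ltW delta_gt0) sX.
move=> _ /mapP[c + ->]; rewrite mem_filter => /andP[/andP[h1 h2] _]; lra.
Qed.

Lemma profile_window a m X : exists k, forall x, 0 <= x <= m ->
  profile X (x + a) = profile (window a m X) x + k.
Proof.
pose P c := (a - delta / 2 < c) && (c < a + m + delta / 2).
exists (lam * a - (Lam + lam) * (delta * (count (fun c => (c <= a - delta / 2) && ~~ P c) X)%:R)).
move=> x x0m; rewrite /profile (@rampsum_localize _ _ X P a (a + m)) ?(ltW delta_gt0)//.
- by rewrite rampsum_shift; ring.
- by move=> c _; rewrite /P; case: leP => //= _; case: ltP.
- by lra.
Qed.

Lemma continuous_lip (f : R -> R) K : (forall x y, `|f x - f y| <= K * `|x - y|) -> continuous f.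
Proof.
move=> h x; apply/cvgrPdist_le => e e0.
have K0 : 0 <= K by have := h 1 0; rewrite subr0 normr1 mulr1; apply: le_trans.
near=> y.
apply: le_trans (h _ _) _.
apply: (@le_trans _ _ ((K + 1) * `|x - y|)); first by rewrite ler_wpM2r//; lra.
rewrite mulrC -ler_pdivlMr; last lra.
near: y; apply: cvgr_dist_le; first exact: cvg_id.
by apply: divr_gt0; [exact: e0|lra].
Unshelve. all: by end_near. Qed.

Lemma measurable_profile X : spaced delta X -> measurable_fun [set: R] (profile X).
Proof.
move=> sX; apply: continuous_measurable_fun.
by apply: continuous_lip => x y; exact: profile_lip.
Qed.

End Profiles.

(** * Weak derivatives of profiles *)

Section WeakDerivatives.
Context {R : realType}.
Local Notation mu := (@lebesgue_measure R).
Implicit Types (l a b e h k x : R) (f g u phi r : R -> R).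

Lemma test_out l phi x : test_function l phi -> x \notin `]0, l[ -> phi x = 0.
Proof.
move=> [_ _ _ sub] xl; apply/eqP/negPn/negP => px; move/negP: xl; apply.
by apply: sub; apply: subset_closure.
Qed.

Lemma test_continuous l phi : test_function l phi -> continuous phi.
Proof.
by move=> [dphi _ _ _] x; apply: differentiable_continuous; apply/derivable1_diffP.
Qed.

Lemma continuous_bounded_itv l g : continuous g -> [bounded g x | x in (`]0, l[%classic : set R)].
Proof.
move=> cg.
have /compact_bounded[M [Mr hM]] := continuous_compact
  (continuous_subspaceT (A := `[0, l]%classic) cg) (@segment_compact R 0 l).
exists M; split => // N MN x /= xl; apply: hM => //.
exists x => //=; move: xl; rewrite !in_itv/= => /andP[/ltW -> /ltW ->] //.
Qed.

Lemma integrable_mul l u g : mu.-integrable `]0, l[ (EFin \o u) -> continuous g ->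
  mu.-integrable `]0, l[ (fun x => (u x * g x)%:E).
Proof.
move=> iu cg.
have mg : measurable_fun (`]0, l[%classic : set R) g.
  by apply: measurable_funTS; exact: continuous_measurable_fun.
have -> : (fun x => (u x * g x)%:E) = ((EFin \o u) \* (EFin \o g))%E by [].
exact: (@integrableMl _ (measurableTypeR R) R (@lebesgue_measure R) _ (measurable_itv _) _ _ iu mg (@continuous_bounded_itv l g cg)).
Qed.

Lemma integrable_continuous l g : continuous g -> mu.-integrable `]0, l[ (EFin \o g).
Proof.
move=> cg; apply: (@integrableS _ _ _ mu `[0, l]%classic) => //.
  by move=> x /=; rewrite !in_itv/= => /andP[/ltW -> /ltW ->].
apply: continuous_compact_integrable; first exact: segment_compact.
exact: continuous_subspaceT.
Qed.

Lemma integral_by_parts_test l a b phi : test_function l phi -> b < l ->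
  (b - a) * phi b = 0 ->
  \int[mu]_(x in `]b, l[) ((x - a) * derive1 phi x) = - \int[mu]_(x in `]b, l[) phi x.
Proof.
move=> tphi bl hb; have cphi := test_continuous tphi; have [dphi cdphi _ _] := tphi.
have iw (g : R -> R) : continuous g -> \int[mu]_(x in `]b, l[) g x = \int[mu]_(x in `[b, l]) g x.
  move=> cg; have ig : mu.-integrable `[b, l] (EFin \o g).
    apply: continuous_compact_integrable; first exact: segment_compact.
    exact: continuous_subspaceT.
  rewrite Rintegral_itv_bndo_bndc; last first.
    apply: integrableS ig => //.
    by move=> x /=; rewrite !in_itv/= => /andP[/ltW -> /ltW ->].
  rewrite Rintegral_itv_obnd_cbnd//.
  apply: integrableS ig => //.
  by move=> x /=; rewrite !in_itv/= => /andP[/ltW -> ->].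
have caff : continuous (fun x : R => x - a).
  by move=> x; apply: continuousB; [exact: cvg_id|exact: cvg_cst].
rewrite !iw//; last first.
  by move=> x; apply: cvgM; [exact: caff|exact: cdphi].
have caff' : continuous (cst 1 : R -> R) by move=> x; exact: cvg_cst.
have h1 : derivable_oo_LRcontinuous (fun x : R => x - a) b l.
  split.
  + by move=> x _; apply: derivableB; [exact: derivable_id|exact: derivable_cst].
  + by apply: cvg_at_right_filter; exact: caff.
  + by apply: cvg_at_left_filter; exact: caff.
have h2 : {in `]b, l[, (fun x : R => x - a)^`()%classic =1 cst 1}.
  move=> x _; rewrite derive1E deriveB; [|exact: derivable_id|exact: derivable_cst].
  by rewrite derive_id derive_cst subr0.
have h3 : derivable_oo_LRcontinuous phi b l.
  split; first by move=> x _; exact: dphi.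
  + by apply: cvg_at_right_filter; exact: cphi.
  + by apply: cvg_at_left_filter; exact: cphi.
have := @Rintegration_by_parts R (fun x => x - a) phi (cst 1) (derive1 phi) b l bl
  (continuous_subspaceT caff') h1 h2 (continuous_subspaceT cdphi) h3 (fun x _ => erefl).
rewrite hb (test_out tphi (x := l)); last by rewrite in_itv/= ltxx andbF.
rewrite mulr0 subrr sub0r => ->; congr (- _); apply: eq_Rintegral => x _.
by rewrite mul1r.
Qed.

(** Integration by parts on the part of (0, l) to the right of a; the boundary
    terms vanish at l because of the test function, and at the left end because of
    one or the other factor. *)
Lemma weak_deriv_pos l a : 0 < l ->
  weak_deriv l (fun x => Num.max 0 (x - a)) (fun x => (a < x)%R%:R).
Proof.
move=> l0 phi tphi; set b := Num.max a 0.
have ab : a <= b by rewrite /b le_max lexx.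
have b0 : 0 <= b by rewrite /b le_max lexx orbT.
have ba x : b < x -> a < x by move=> /(le_lt_trans ab).
have nba x : 0 < x -> ~~ (b < x) -> x <= a.
  by rewrite -leNgt /b le_max => x0 /orP[//|x0']; lra.
have res (g1 g2 : R -> R) : (forall x, a < x -> g1 x = g2 x) -> (forall x, x <= a -> g1 x = 0) ->
    \int[mu]_(x in `]0, l[) g1 x = \int[mu]_(x in `]b, l[) g2 x.
  move=> h1 h2; rewrite Rintegral_mkcond [RHS]Rintegral_mkcond; congr (Rintegral _ _ _).
  apply/funext => x; rewrite !patchE !mem_setE !in_itv/=.
  have [bx|bx] /= := boolP (b < x).
    by rewrite (le_lt_trans b0 bx)/=; case: ifP => // _; apply: h1; exact: ba.
  by case: ifP => // /andP[x0 _]; apply: h2; exact: nba.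
rewrite (res _ (fun x => (x - a) * derive1 phi x)); last 2 first.
- by move=> x ax; rewrite max_r// subr_ge0 ltW.
- by move=> x xa; rewrite max_l ?mul0r// subr_le0.
rewrite (res _ phi); last 2 first.
- by move=> x ax; rewrite ax mul1r.
- by move=> x xa; rewrite ltNge xa mul0r.
have [bl|lb] := ltP b l; last first.
  by rewrite set_itv_ge ?Rintegral_set0 ?oppr0// bnd_simp -leNgt.
apply: integral_by_parts_test => //.
have [a0|a0] := leP a 0.
  by rewrite /b max_r// (test_out tphi) ?mulr0// in_itv/= ltxx.
by rewrite /b max_l ?(ltW a0)// subrr mul0r.
Qed.

Lemma eq_weak_deriv l f f' g g' : (forall x, x \in `]0, l[ -> f x = f' x) ->
  (forall x, x \in `]0, l[ -> g x = g' x) -> weak_deriv l f g -> weak_deriv l f' g'.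
Proof.
move=> ff gg h phi tphi.
have -> : \int[mu]_(x in `]0, l[) (f' x * derive1 phi x) =
    \int[mu]_(x in `]0, l[) (f x * derive1 phi x).
  by apply: eq_Rintegral => x /set_mem /= xl; rewrite ff.
rewrite h//; congr (- _); apply: eq_Rintegral => x /set_mem /= xl.
by rewrite gg.
Qed.

Lemma weak_deriv_lin l (s : R) f1 g1 f2 g2 :
  mu.-integrable `]0, l[ (EFin \o f1) -> mu.-integrable `]0, l[ (EFin \o f2) ->
  mu.-integrable `]0, l[ (EFin \o g1) -> mu.-integrable `]0, l[ (EFin \o g2) ->
  weak_deriv l f1 g1 -> weak_deriv l f2 g2 ->
  weak_deriv l (fun x => f1 x + s * f2 x) (fun x => g1 x + s * g2 x).
Proof.
move=> if1 if2 ig1 ig2 h1 h2 phi tphi; have [_ cphi' _ _] := tphi.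
have cphi := test_continuous tphi.
have lin (p q psi : R -> R) : continuous psi -> mu.-integrable `]0, l[ (EFin \o p) ->
    mu.-integrable `]0, l[ (EFin \o q) ->
    \int[mu]_(x in `]0, l[) ((p x + s * q x) * psi x) =
    \int[mu]_(x in `]0, l[) (p x * psi x) + s * \int[mu]_(x in `]0, l[) (q x * psi x).
  move=> cpsi ip iq.
  have ipp := integrable_mul ip cpsi; have iqp := integrable_mul iq cpsi.
  rewrite -RintegralZl// -RintegralD//.
    by apply: eq_Rintegral => x _; rewrite mulrDl mulrA.
  exact: (integrableZl _ _ iqp).
rewrite !lin// (h1 _ tphi) (h2 _ tphi); ring.
Qed.

Lemma continuous_pos a : continuous (fun x : R => Num.max 0 (x - a)).
Proof.
apply: (@continuous_lip _ _ 1) => x y; rewrite mul1r.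
by rewrite /Num.max; case: ltP => ?; case: ltP => ?;
  case: (leP 0 (x - y)) => h; rewrite ?(ger0_norm h) ?(ltr0_norm h) ler_norml; lra.
Qed.

Lemma continuous_pos_shift a e : continuous (fun x : R => Num.max 0 (x - a + e)).
Proof.
have -> : (fun x => Num.max 0 (x - a + e)) = (fun x => Num.max 0 (x - (a - e))).
  by apply/funext => y; congr Num.max; ring.
exact: continuous_pos.
Qed.

Lemma measurable_step a : measurable_fun [set: R] (fun x : R => (a < x)%R%:R : R).
Proof.
have -> : (fun x : R => (a < x)%R%:R : R) = \1_(`]a, +oo[%classic).
  by apply/funext => x; rewrite indicE mem_setE in_itv/= andbT.
exact: measurable_indic.
Qed.

Lemma measurable_step_le a : measurable_fun [set: R] (fun x : R => (a <= x)%R%:R : R).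
Proof.
have -> : (fun x : R => (a <= x)%R%:R : R) = \1_(`[a, +oo[%classic).
  by apply/funext => x; rewrite indicE mem_setE in_itv/= andbT.
exact: measurable_indic.
Qed.

Lemma norm_bool_le1 (b : bool) : `|b%:R : R| <= 1.
Proof. by case: b; rewrite ?normr1 ?normr0. Qed.

Lemma bounded_integrable l f M : measurable_fun [set: R] f -> (forall x, `|f x| <= M) ->
  mu.-integrable `]0, l[ (EFin \o f).
Proof.
move=> mf hM; apply: measurable_bounded_integrable => //.
- by rewrite /= lebesgue_measure_itv/=; case: ifP => // _; rewrite -EFinB ltry.
- exact: measurable_funTS.
- by exists M; split; rewrite ?num_real// => N MN x _ /=; apply: le_trans (hM x) (ltW MN).
Qed.

(** The two steps differ at a single point. The large one is needed to get the
    indicator of an open core as a difference of steps. *)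
Lemma weak_deriv_step_ae l a f : weak_deriv l f (fun x => (a < x)%R%:R) ->
  weak_deriv l f (fun x => (a <= x)%R%:R).
Proof.
move=> h phi tphi; rewrite h//; congr (- fine _).
have cphi := test_continuous tphi.
have mphi := continuous_measurable_fun cphi.
have m2 := measurable_step_le a.
apply: ae_eq_integral => //.
- apply/measurable_EFinP; apply: measurable_funTS; apply: measurable_funM => //.
  exact: measurable_step.
- by apply/measurable_EFinP; apply: measurable_funTS; exact: measurable_funM.
- exists [set a]; split => //; first exact: lebesgue_measure_set1.
  move=> x /= /not_implyP[_ ne]; apply/eqP/negPn/negP => xa; apply: ne.
  by rewrite le_eqVlt eq_sym (negbTE xa).
Qed.

End WeakDerivatives.

Section ProfileStrain.
Context {R : realType} (lam Lam delta : R).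
Hypotheses (lam_gt0 : 0 < lam) (le_lam_Lam : lam <= Lam) (delta_gt0 : 0 < delta).
Local Notation mu := (@lebesgue_measure R).
Implicit Types (X : seq R) (x k l : R).

Lemma weak_deriv_ramp l c : 0 < l ->
  weak_deriv l (fun x => ramp delta (x - c)) (\1_(core delta c)).
Proof.
move=> l0.
have := @weak_deriv_lin R l (- 1) _ _ _ _ _ _ _ _ (@weak_deriv_pos R l (c - delta / 2) l0)
  (weak_deriv_step_ae (@weak_deriv_pos R l (c + delta / 2) l0)).
have cp a := @integrable_continuous R l _ (continuous_pos (a := a)).
move=> /(_ (cp _) (cp _)); move=> H.
apply: eq_weak_deriv (H _ _).
- move=> x _ /=; rewrite /ramp mulN1r; congr (Num.max 0 _ - Num.max 0 _); ring.
- move=> x _ /=; rewrite indicE /core mem_setE in_itv/= mulN1r.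
  case: (ltP (c - delta / 2)) => h1; case: (leP (c + delta / 2)) => h2 /=; rewrite ?subrr ?subr0//.
  by move: delta_gt0 => ?; lra.
- by apply: (@bounded_integrable _ _ _ 1) => [|x]; [exact: measurable_step|exact: norm_bool_le1].
- by apply: (@bounded_integrable _ _ _ 1) => [|x]; [exact: measurable_step_le|exact: norm_bool_le1].
Qed.

Lemma measurable_core c : measurable (core delta c).
Proof. exact: measurable_itv. Qed.

Lemma measurable_strain_sum X : measurable_fun [set: R] (fun x => \sum_(c <- X) \1_(core delta c) x : R).
Proof. by apply: measurable_sum => d; apply: measurable_indic; exact: measurable_core. Qed.

Lemma strain_sum_le X x : `|\sum_(c <- X) \1_(core delta c) x : R| <= (size X)%:R.
Proof.
elim: X => [|d X' IH']; first by rewrite big_nil normr0.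
rewrite big_cons /= -natr1 [leRHS]addrC; apply: le_trans (ler_normD _ _) _.
apply: lerD => //.
by rewrite indicE; exact: norm_bool_le1.
Qed.

Lemma weak_deriv_rampsum l X : 0 < l -> weak_deriv l (rampsum delta X)
  (fun x => \sum_(c <- X) \1_(core delta c) x).
Proof.
move=> l0; elim: X => [|c X IH].
  move=> phi _; rewrite /rampsum.
  have -> : \int[mu]_(x in `]0, l[) ((\sum_(c <- [::]) ramp delta (x - c)) * derive1 phi x) =
      \int[mu]_(x in `]0, l[) (cst 0 x : R).
    by apply: eq_Rintegral => x _ /=; rewrite big_nil mul0r.
  have -> : \int[mu]_(x in `]0, l[) ((\sum_(c <- [::]) \1_(core delta c) x) * phi x) =
      \int[mu]_(x in `]0, l[) (cst 0 x : R).
    by apply: eq_Rintegral => x _ /=; rewrite big_nil mul0r.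
  by rewrite /Rintegral integral0 oppr0.
have icr X' : mu.-integrable `]0, l[ (EFin \o (rampsum delta X')).
  elim: X' => [|d X' IH'].
    apply: (@bounded_integrable _ _ _ 0).
      by rewrite (_ : rampsum _ _ = cst 0)//; apply/funext => x; rewrite /rampsum big_nil.
    by move=> x; rewrite /rampsum big_nil normr0.
  rewrite (_ : EFin \o _ = ((EFin \o (fun x => ramp delta (x - d))) \+ (EFin \o rampsum delta X'))%E).
    apply: integrableD => //; apply: integrable_continuous => //.
    by move=> x; apply: cvgB; exact: continuous_pos_shift.
  by apply/funext => x /=; rewrite /rampsum big_cons.
have ind X' := bounded_integrable l (measurable_strain_sum X') (strain_sum_le X').
have w1 : weak_deriv l (rampsum delta [:: c]) (fun x => \sum_(c <- [:: c]) \1_(core delta c) x).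
  apply: eq_weak_deriv (weak_deriv_ramp c l0).
  + by move=> x _; rewrite /rampsum big_seq1.
  + by move=> x _; rewrite big_seq1.
have := @weak_deriv_lin R l 1 _ _ _ _ (icr X) (icr [:: c]) (ind X) (ind [:: c]) IH w1.
apply: eq_weak_deriv.
- by move=> x _; rewrite /rampsum [in RHS]big_cons big_seq1 mul1r addrC.
- by move=> x _; rewrite [in RHS]big_cons big_seq1 mul1r addrC.
Qed.

Lemma weak_deriv_affine l : 0 < l -> forall a k, weak_deriv l (fun x => a * x + k) (cst a).
Proof.
move=> l0 a k.
have i0 (b : R) : mu.-integrable `]0, l[ (EFin \o (fun x => Num.max 0 (x - b))).
  by apply: integrable_continuous => //; exact: continuous_pos.
have ic (f : R -> R) : continuous f -> mu.-integrable `]0, l[ (EFin \o f) by exact: integrable_continuous.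
have is_ (b : R) : mu.-integrable `]0, l[ (EFin \o (fun x => (b < x)%R%:R : R)).
  apply: (@bounded_integrable _ _ _ 1); first exact: measurable_step.
  by move=> x; exact: norm_bool_le1.
have cc (c : R) : continuous (cst c : R -> R) by move=> x; exact: cvg_cst.
have wid : weak_deriv l id (cst 1).
  apply: eq_weak_deriv (@weak_deriv_pos R l 0 l0).
    by move=> x; rewrite in_itv/= => /andP[x0 _]; rewrite subr0 max_r// ltW.
  by move=> x; rewrite in_itv/= => /andP[-> _].
have iid : mu.-integrable `]0, l[ (EFin \o @id R) by apply: ic => x; exact: cvg_id.
(* On (0, l), 1 is the positive part of x + 1 minus that of x. *)
have w1 : weak_deriv l (cst 1) (cst 0).
  apply: eq_weak_deriv (weak_deriv_lin (- 1) (i0 (- 1)) iid (is_ (- 1)) (ic _ (cc 1)) (@weak_deriv_pos R l (- 1) l0) wid).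
    move=> x; rewrite in_itv/= => /andP[x0 _]; rewrite max_r ?opprK; lra.
  by move=> x; rewrite in_itv/= => /andP[x0 _]; rewrite (_ : -1 < x) ?mulr1 ?subrr//; lra.
have w0 : weak_deriv l (cst 0) (cst 0).
  apply: eq_weak_deriv (weak_deriv_lin (- 1) (ic _ (cc 1)) (ic _ (cc 1)) (ic _ (cc 0)) (ic _ (cc 0)) w1 w1).
    by move=> x _ /=; rewrite mulr1 subrr.
  by move=> x _ /=; rewrite mulr0 addr0.
have wk : weak_deriv l (cst k) (cst 0).
  apply: eq_weak_deriv (weak_deriv_lin (k) (ic _ (cc 0)) (ic _ (cc 1)) (ic _ (cc 0)) (ic _ (cc 0)) w0 w1).
    by move=> x _ /=; rewrite mulr1 add0r.
  by move=> x _ /=; rewrite mulr0 addr0.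
apply: eq_weak_deriv (weak_deriv_lin (a) (ic _ (cc k)) iid (ic _ (cc 0)) (ic _ (cc 1)) wk wid).
  by move=> x _ /=; rewrite addrC.
by move=> x _ /=; rewrite mulr1 add0r.
Qed.

Lemma continuous_rampsum X : spaced delta X -> continuous (rampsum delta X).
Proof.
move=> sX; apply: (@continuous_lip _ _ 1) => x y; rewrite mul1r.
wlog xy : x y / x <= y.
  by move=> h; have [/h //|/ltW/h] := leP x y; rewrite distrC [`|y - x|]distrC.
have /andP[h1 h2] := rampsum_incr (ltW delta_gt0) sX xy.
by rewrite distrC [`|x - y|]distrC !ger0_norm// subr_ge0.
Qed.

Lemma weak_deriv_profile l X k : 0 < l -> spaced delta X ->
  weak_deriv l (fun x => profile lam Lam delta X x + k) (strain lam Lam delta l X).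
Proof.
move=> l0 sX.
have iaff : mu.-integrable `]0, l[ (EFin \o (fun x : R => lam * x + k)).
  apply: integrable_continuous => // x; apply: continuousD; last exact: cvg_cst.
  by apply: continuousM; [exact: cvg_cst|exact: cvg_id].
have icst : mu.-integrable `]0, l[ (EFin \o (cst lam : R -> R)).
  by apply: integrable_continuous => // x; exact: cvg_cst.
have ir : mu.-integrable `]0, l[ (EFin \o rampsum delta X).
  by apply: integrable_continuous => //; exact: continuous_rampsum.
have is_ : mu.-integrable `]0, l[ (EFin \o (fun x => \sum_(c <- X) \1_(core delta c) x)).
  apply: (@bounded_integrable _ _ _ (size X)%:R); first exact: measurable_strain_sum.
  exact: strain_sum_le.
have := @weak_deriv_lin R l (- (Lam + lam)) _ _ _ _ iaff ir icst is_
  (weak_deriv_affine l0 lam k) (weak_deriv_rampsum X l0).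
apply: eq_weak_deriv.
  by move=> x _; rewrite /profile; ring.
by move=> x xl; rewrite /strain indicE mem_setE xl mul1r mulNr.
Qed.

Lemma profile_displacement l X k : 0 < l -> AD delta l X ->
  displacement lam Lam delta l (fun x => profile lam Lam delta X x + k).
Proof.
move=> l0 AX; have [sX _] := (AD_spaced lam_gt0 le_lam_Lam delta_gt0 l X).1 AX.
have wd := weak_deriv_profile k l0 sX.
exists X => //; split => //; split; last first.
  exists (strain lam Lam delta l X) => //; split.
    apply: measurable_funTS; apply: measurable_funB => //.
    apply: measurable_funM => //; apply: measurable_funM; first exact: measurable_indic.
    exact: measurable_strain_sum.
  exists (lam + (Lam + lam) * (size X)%:R); apply: aeW => x _; rewrite /strain.
  apply: le_trans (ler_normB _ _) _; rewrite (gtr0_norm lam_gt0) lerD2l normrM ger0_norm.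
    apply: ler_wpM2l; first by move: lam_gt0 le_lam_Lam => ? ?; lra.
    rewrite normrM -[leRHS]mul1r; apply: ler_pM => //; last exact: strain_sum_le.
    by rewrite indicE; exact: norm_bool_le1.
  by move: lam_gt0 le_lam_Lam => ? ?; lra.
split.
  apply: measurable_funTS; apply: measurable_funD => //.
  exact: measurable_profile.
exists (`|profile lam Lam delta X 0 + k| + Lam * l); apply: aeW => x; rewrite in_itv/= => /andP[x0 xl].
have -> : profile lam Lam delta X x + k = (profile lam Lam delta X 0 + k) +
   (profile lam Lam delta X x - profile lam Lam delta X 0) by ring.
apply: le_trans (ler_normD _ _) _; rewrite lerD2l.
apply: le_trans (profile_lip lam_gt0 le_lam_Lam delta_gt0 _ _ sX) _.
rewrite subr0 gtr0_norm//; apply: ler_wpM2l; last exact: ltW.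
by move: lam_gt0 le_lam_Lam => ? ?; lra.
Qed.

End ProfileStrain.

(** * Functions with zero weak derivative *)

Section DuBoisReymond.
Context {R : realType}.
Local Notation mu := (@lebesgue_measure R).
Implicit Types (l a b h k x : R) (f g u phi r : R -> R).

(** A quadratic error bound is easily checked for squares of positive parts, by
    cases, and it identifies the derivative. *)
Lemma is_derive_quad f x d C : (forall s, `|f (x + s) - f x - d * s| <= C * s ^+ 2) ->
  is_derive x 1 f d.
Proof.
move=> hf.
have C0 : 0 <= C by have := le_trans (normr_ge0 _) (hf 1); rewrite expr1n mulr1.
suff cf : (fun s => s^-1 *: ((f \o shift x) (s *: 1) - f x)) s @[s --> 0^'] --> d.
  by apply: DeriveDef; [apply/cvg_ex; exists d|exact: cvg_lim].
apply/cvgrPdist_le => e e0.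
have eC : 0 < e / (C + 1) by apply: divr_gt0; [exact: e0|lra].
near=> s.
have s0 : s != 0 by near: s; exact: nbhs_dnbhs_neq.
have se : `|s| <= e / (C + 1) by near: s; exact: dnbhs0_le.
rewrite /= /shift/= -![_ *: _]/(_ * _) mulr1 addrC.
have -> : s^-1 * (f (s + x) - f x) = s^-1 * (f (x + s) - f x) by rewrite (addrC s x).
have -> : - (s^-1 * (f (x + s) - f x)) + d = - (s^-1 * (f (x + s) - f x - d * s)) by field.
rewrite normrN normrM normfV mulrC ler_pdivrMr ?normr_gt0//.
apply: le_trans (hf s) _.
rewrite -(real_normK (num_real s)) expr2 mulrA ler_wpM2r//.
move: se; rewrite ler_pdivlMr; last lra.
have := normr_ge0 s; nra.
Unshelve. all: by end_near. Qed.

(** A continuous mollifier with an elementary primitive. *)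
Definition tent h x : R := Num.max 0 (x + h) - 2 * Num.max 0 x + Num.max 0 (x - h).
Definition tent_primitive h x : R :=
  Num.max 0 (x + h) ^+ 2 - 2 * Num.max 0 x ^+ 2 + Num.max 0 (x - h) ^+ 2.

Lemma pos_sqr_quad x (s : R) :
  - s ^+ 2 <= Num.max 0 (x + s) ^+ 2 - Num.max 0 x ^+ 2 - 2 * Num.max 0 x * s <= s ^+ 2.
Proof. by rewrite /Num.max; case: ltP => h1; case: ltP => h2; apply/andP; split; nra. Qed.

Lemma tent_bounds h x : 0 < h -> 0 <= tent h x <= h.
Proof.
by move=> h0; rewrite /tent /Num.max; case: ltP => ?; case: ltP => ?; case: ltP => ?; lra.
Qed.

Lemma tent_out h x : 0 < h -> h <= `|x| -> tent h x = 0.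
Proof.
move=> h0; case: (leP 0 x) => x0; rewrite ?(ger0_norm x0) ?(ltr0_norm x0) => ?;
by rewrite /tent /Num.max; case: ltP => ?; case: ltP => ?; case: ltP => ?; lra.
Qed.

Lemma tent_core h x : 0 < h -> `|x| <= h / 2 -> h / 2 <= tent h x.
Proof.
move=> h0; rewrite ler_norml => ?.
by rewrite /tent /Num.max; case: ltP => ?; case: ltP => ?; case: ltP => ?; lra.
Qed.

Lemma continuous_tent h a : continuous (fun x => tent h (x - a)).
Proof.
have h0 : continuous (fun x : R => Num.max 0 (x - a)) by exact: continuous_pos.
rewrite /tent => x; apply: cvgD; last exact: continuous_pos_shift.
apply: cvgB; first exact: continuous_pos_shift.
by apply: cvgM; [exact: cvg_cst|exact: h0].
Qed.

(** The primitives of the two tents reach the same final height, so that their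
    difference has compact support. *)
Lemma tent_test l h a b : 0 < h -> h < a -> h < b -> a + h < l -> b + h < l ->
  exists2 phi, test_function l phi &
    derive1 phi = (fun x => 2 * (tent h (x - a) - tent h (x - b))).
Proof.
move=> h0 ha hb al bl.
pose phi x := tent_primitive h (x - a) - tent_primitive h (x - b).
pose psi x := 2 * (tent h (x - a) - tent h (x - b)).
have dphi x : is_derive x 1 phi (psi x).
  apply: (@is_derive_quad _ _ _ 8) => s.
  have q y := @pos_sqr_quad y s.
  have /andP[] := q (x - a + h); have /andP[] := q (x - a); have /andP[] := q (x - a - h).
  have /andP[] := q (x - b + h); have /andP[] := q (x - b); have /andP[] := q (x - b - h).
  rewrite /phi /psi /tent_primitive /tent.
  have e1 y : x + s - y = x - y + s by ring.
  have e2 y z : x - y + s + z = x - y + z + s by ring.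
  rewrite !e1 !e2.
  move: (Num.max 0 (x - a + h + s) ^+ 2) (Num.max 0 (x - a + s) ^+ 2) (Num.max 0 (x - a - h + s) ^+ 2).
  move: (Num.max 0 (x - b + h + s) ^+ 2) (Num.max 0 (x - b + s) ^+ 2) (Num.max 0 (x - b - h + s) ^+ 2).
  move: (Num.max 0 (x - a + h)) (Num.max 0 (x - a)) (Num.max 0 (x - a - h)).
  move: (Num.max 0 (x - b + h)) (Num.max 0 (x - b)) (Num.max 0 (x - b - h)).
  by move=> *; rewrite ler_norml; apply/andP; split; lra.
have ephi : derive1 phi = psi by apply/funext => x; rewrite derive1E; apply: derive_val.
have Kout y : y <= - h -> tent_primitive h y = 0.
  move=> yh; rewrite /tent_primitive !max_l; last lra; last lra; last lra.
  by rewrite expr0n/= mulr0 subr0 addr0.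
have Kin y : h <= y -> tent_primitive h y = 2 * h ^+ 2.
  by move=> yh; rewrite /tent_primitive !max_r; [ring|lra..].
pose m := Num.min a b; pose M := Num.max a b.
have [ma mb aM bM] : [/\ m <= a, m <= b, a <= M & b <= M].
  by rewrite /m /M !ge_min !le_max !lexx !orbT.
have sub : [set x | phi x != 0] `<=` `[m - h, M + h].
  move=> x /= px; rewrite in_itv/=; apply/negPn/negP; rewrite negb_and -!ltNge => hx.
  move/negP: px; apply; apply/eqP; rewrite /phi; case/orP: hx => hx.
    by rewrite !Kout ?subrr//; lra.
  by rewrite !Kin ?subrr//; lra.
have csub : closure [set x | phi x != 0] `<=` `[m - h, M + h].
  have cl : closed (`[m - h, M + h]%classic : set R) by exact: interval_closed.
  by rewrite [X in _ `<=` X]((closure_id _).1 cl); exact: closure_subset.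
have mh : h < m by rewrite /m lt_min ha hb.
have Ml : M + h < l by rewrite -ltrBrDr /M gt_max; apply/andP; split; lra.
exists phi => //; split.
- by move=> x; have := dphi x; case.
- rewrite ephi /psi => x; apply: cvgM; first exact: cvg_cst.
  by apply: cvgB; exact: continuous_tent.
- apply: subclosed_compact csub; [exact: closed_closure|exact: segment_compact].
- by move=> x /csub /=; rewrite !in_itv/= => ?; lra.
Qed.

Lemma Rintegral_lin l k f g : mu.-integrable `]0, l[ (EFin \o f) ->
  mu.-integrable `]0, l[ (EFin \o g) ->
  \int[mu]_(x in `]0, l[) (k * (f x - g x)) =
  k * (\int[mu]_(x in `]0, l[) f x - \int[mu]_(x in `]0, l[) g x).
Proof.
move=> jf jg; have jfg : mu.-integrable `]0, l[ (EFin \o (fun x => f x - g x)).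
  rewrite (_ : EFin \o _ = ((EFin \o f) \- (EFin \o g))%E); last by apply/funext.
  exact: integrableB.
by rewrite RintegralZl// RintegralB.
Qed.

Lemma Rintegral_tent_le l h a k r : 0 < h -> h < a -> a + h < l ->
  mu.-integrable `]0, l[ (EFin \o r) ->
  (`|\int[mu]_(x in `]0, l[) ((r x - k) * tent h (x - a))|%:E <=
   h%:E * \int[mu]_(x in ball a h) `|(r x - k)%:E|)%E.
Proof.
move=> h0 ha al ir.
have ik : mu.-integrable `]0, l[ (EFin \o (fun x => r x - k)).
  rewrite (_ : EFin \o _ = ((EFin \o r) \- (EFin \o cst k))%E); last by apply/funext.
  apply: integrableB => //; apply: integrable_continuous => // x; exact: cvg_cst.
have it := integrable_mul ik (continuous_tent (h := h) (a := a)).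
rewrite EFin_normr_Rintegral//.
have ballD : ball a h `<=` `]0, l[.
  by rewrite ball_itv => x /=; rewrite !in_itv/= => ?; lra.
have mrk : measurable_fun (`]0, l[%classic : set R) (fun x => r x - k).
  by apply/measurable_EFinP; have /integrableP[] := ik.
have mb : measurable (ball a h : set R) by exact: measurable_ball.
apply: le_trans (le_abse_integral mu _ _) _ => //; first by have /integrableP[] := it.
have mg : measurable_fun (ball a h : set R) (fun x => `|(r x - k)%:E|)%E.
  apply: (measurableT_comp (@abse_measurable R setT)); apply/measurable_EFinP.
  exact: measurable_funS mrk.
rewrite -ge0_integralZl//; last by rewrite lee_fin ltW.
have -> : (\int[mu]_(x in `]0%R, l[) `|((r x - k) * tent h (x - a))%:E| =
    \int[mu]_(x in ball a h) `|((r x - k) * tent h (x - a))%:E|)%E.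
  rewrite integral_mkcond [RHS]integral_mkcond; apply: eq_integral => x _; rewrite !patchE.
  case: ifPn => [|/negP] /= xl; case: ifPn => [|/negP] //= xb; last 1 first.
  - by exfalso; apply: xl; rewrite inE; apply: ballD; rewrite inE in xb.
  - rewrite tent_out ?mulr0 ?normr0//; rewrite leNgt; apply/negP => xa; apply: xb.
    by rewrite inE /ball/= distrC.
apply: ge0_le_integral => //.
- apply: (measurableT_comp (@abse_measurable R setT)); apply: measurable_funS (_ : measurable_fun `]0, l[%classic _) => //.
  by have /integrableP[] := it.
- exact: measurable_funeM.
- move=> x _ /=; rewrite -EFinM lee_fin normrM mulrC ler_wpM2r//.
  have /andP[t0 t1] := tent_bounds (x - a) h0.
  by rewrite ger0_norm.
Qed.

Lemma Rintegral_tent_ge l h a : 0 < h -> h < a -> a + h < l ->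
  h ^+ 2 / 2 <= \int[mu]_(x in `]0, l[) tent h (x - a).
Proof.
move=> h0 ha al.
have it : mu.-integrable `]0, l[ (EFin \o (fun x => tent h (x - a))).
  by apply: integrable_continuous => //; exact: continuous_tent.
rewrite -lee_fin /Rintegral fineK; last exact: integrable_fin_num.
have mt : measurable_fun [set: R] (fun x => (tent h (x - a))%:E).
  by apply/measurable_EFinP; apply: continuous_measurable_fun; exact: continuous_tent.
have t0 x : 0 <= tent h (x - a) by have /andP[] := tent_bounds (x - a) h0.
apply: (@le_trans _ _ (\int[mu]_(x in ball a (h / 2)) (tent h (x - a))%:E)%E); last first.
  apply: ge0_subset_integral => //; first exact: measurable_ball.
  - exact: measurable_funTS.
  - by move=> x _; rewrite lee_fin.
  - by rewrite ball_itv => x /=; rewrite !in_itv/= => ?; lra.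
apply: (@le_trans _ _ (\int[mu]_(x in ball a (h / 2)) (h / 2)%:E)%E).
  rewrite integral_cst/=; last exact: measurable_ball.
  rewrite lebesgue_measure_ball; last lra.
  by rewrite -EFinM lee_fin; lra.
apply: ge0_le_integral => //; first exact: measurable_ball.
- by move=> x _; rewrite lee_fin; lra.
- exact: measurable_funTS.
- by move=> x; rewrite /ball/= => xa; rewrite lee_fin tent_core// distrC ltW.
Qed.

Lemma lebesgue_pt_small r a e : lebesgue_pt r a -> 0 < e ->
  \forall h \near 0^'+, (\int[mu]_(x in ball a h) `|(r x - r a)%:E| <= (e * h)%:E)%E.
Proof.
move=> ra e0.
have e2 : 0 < e / 2 by lra.
have small : \forall h \near 0^'+, (davg r a h < (e / 2)%:E)%E.
  apply: (ra [set y | (y < (e / 2)%:E)%E]); apply: open_nbhs_nbhs.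
  by split; [exact: open_ereal_lt_ereal|rewrite /= lte_fin].
near=> h.
have h0 : 0 < h by near: h; exact: nbhs_right_gt.
have : (davg r a h < (e / 2)%:E)%E by near: h.
rewrite /davg /iavg lebesgue_measure_ball ?(ltW h0)//= .
rewrite inver ifF; last by rewrite mulrn_eq0/= gt_eqF.
move=> /ltW; rewrite lee_pdivrMl; last by rewrite mulrn_wgt0.
by move/le_trans; apply; rewrite -EFinM lee_fin mulr2n; lra.
Unshelve. all: by end_near. Qed.

(** By hypothesis the tents at a and at b give r the same weighted averages, and at
    Lebesgue points these averages tend to r a and r b. *)
Lemma weak_const_lebesgue_pt l r a b : mu.-integrable `]0, l[ (EFin \o r) ->
  (forall phi, test_function l phi -> \int[mu]_(x in `]0, l[) (r x * derive1 phi x) = 0) ->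
  a \in `]0, l[ -> b \in `]0, l[ ->
  lebesgue_pt (r \_ `]0, l[) a -> lebesgue_pt (r \_ `]0, l[) b -> r a = r b.
Proof.
move=> ir hr aD bD la lb.
have l0 : 0 < l by move: aD; rewrite in_itv/= => ?; lra.
set D := `]0, l[%classic in la lb *.
have rD x : x \in `]0, l[ -> (r \_ D) x = r x by move=> xD; rewrite patchE mem_setE xD.
apply/eqP/negPn/negP => ne.
have d0 : 0 < `|r b - r a| by rewrite normr_gt0 subr_eq0 eq_sym.
set d := `|r b - r a| in d0 *.
(* The errors at a and b amount to d h^2 / 4 at most, while the tent has mass at
   least h^2 / 2. *)
have d8 : 0 < d / 8 by lra.
pose m := Num.min (Num.min a b) (Num.min (l - a) (l - b)).
have m0 : 0 < m by move: aD bD; rewrite /m !lt_min !in_itv/= => ? ?; apply/andP; split; apply/andP; split; lra.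
near (0 : R)^'+ => h.
have h0 : 0 < h by near: h; exact: nbhs_right_gt.
have hm : h < m by near: h; exact: nbhs_right_lt.
have sa : (\int[mu]_(x in ball a h) `|((r \_ D) x - (r \_ D) a)%:E| <= (d / 8 * h)%:E)%E.
  by near: h; exact: lebesgue_pt_small.
have sb : (\int[mu]_(x in ball b h) `|((r \_ D) x - (r \_ D) b)%:E| <= (d / 8 * h)%:E)%E.
  by near: h; exact: lebesgue_pt_small.
have [ha hb al bl] : [/\ h < a, h < b, a + h < l & b + h < l].
  by move: hm; rewrite /m !lt_min => /andP[/andP[? ?] /andP[? ?]]; split; lra.
have ballE c : h < c -> c + h < l -> c \in `]0, l[ ->
    (\int[mu]_(x in ball c h) `|((r \_ D) x - (r \_ D) c)%:E| =
     \int[mu]_(x in ball c h) `|(r x - r c)%:E|)%E.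
  move=> hc cl cD; apply: eq_integral => x; rewrite inE ball_itv/= in_itv/= => xb.
  by rewrite !rD// in_itv/=; lra.
rewrite !ballE// in sa sb.
have [phi tphi dphi] := tent_test h0 ha hb al bl.
have it c : mu.-integrable `]0, l[ (EFin \o (fun x => tent h (x - c))).
  by apply: integrable_continuous => //; exact: continuous_tent.
have irt c := integrable_mul ir (continuous_tent (h := h) (a := c)).
have e1 : \int[mu]_(x in `]0, l[) (r x * tent h (x - a)) = \int[mu]_(x in `]0, l[) (r x * tent h (x - b)).
  have := hr _ tphi; rewrite dphi.
  have -> : \int[mu]_(x in `]0, l[) (r x * (2 * (tent h (x - a) - tent h (x - b)))) =
     2 * (\int[mu]_(x in `]0, l[) (r x * tent h (x - a)) - \int[mu]_(x in `]0, l[) (r x * tent h (x - b))).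
    rewrite -Rintegral_lin; [|exact: (irt a)|exact: (irt b)].
    by apply: eq_Rintegral => x _; ring.
  by move=> ?; lra.
have e2 : \int[mu]_(x in `]0, l[) tent h (x - a) = \int[mu]_(x in `]0, l[) tent h (x - b).
  have := @weak_deriv_affine R l l0 0 1 _ tphi; rewrite dphi.
  have -> : \int[mu]_(x in `]0, l[) ((0 * x + 1) * (2 * (tent h (x - a) - tent h (x - b)))) =
     2 * (\int[mu]_(x in `]0, l[) (tent h (x - a)) - \int[mu]_(x in `]0, l[) (tent h (x - b))).
    rewrite -Rintegral_lin//.
    by apply: eq_Rintegral => x _; ring.
  have -> : \int[mu]_(x in `]0, l[) (cst 0 x * phi x) = 0.
    have -> : \int[mu]_(x in `]0, l[) (cst 0 x * phi x) = \int[mu]_(x in `]0, l[) (cst 0 x : R).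
      by apply: eq_Rintegral => x _ /=; rewrite mul0r.
    by rewrite /Rintegral integral0.
  by move=> ?; lra.
have split_ c k : \int[mu]_(x in `]0, l[) ((r x - k) * tent h (x - c)) =
   \int[mu]_(x in `]0, l[) (r x * tent h (x - c)) - k * \int[mu]_(x in `]0, l[) tent h (x - c).
  rewrite -RintegralZl// -RintegralB//; [|exact: (irt c)|exact: (integrableZl _ _ (it c))].
  by apply: eq_Rintegral => x _; ring.
have ba := Rintegral_tent_le (r a) h0 ha al ir.
have bb := Rintegral_tent_le (r b) h0 hb bl ir.
have {}ba : `|\int[mu]_(x in `]0, l[) ((r x - r a) * tent h (x - a))| <= h * (d / 8 * h).
  by rewrite -lee_fin EFinM; apply: le_trans ba _; apply: lee_wpmul2l => //; rewrite lee_fin ltW.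
have {}bb : `|\int[mu]_(x in `]0, l[) ((r x - r b) * tent h (x - b))| <= h * (d / 8 * h).
  by rewrite -lee_fin EFinM; apply: le_trans bb _; apply: lee_wpmul2l => //; rewrite lee_fin ltW.
have ge := Rintegral_tent_ge h0 hb bl.
rewrite !split_ e1 e2 in ba bb.
move: ba bb ge.
set I := \int[mu]_(x in `]0, l[) tent h (x - b).
set J := \int[mu]_(x in `]0, l[) (r x * tent h (x - b)).
move=> ba bb ge.
have : `|r b - r a| * I <= h * (d / 8 * h) + h * (d / 8 * h).
  have I0 : 0 <= I by apply: le_trans ge; rewrite divr_ge0// sqr_ge0.
  rewrite -{1}(ger0_norm I0) -normrM.
  have -> : (r b - r a) * I = (J - r a * I) - (J - r b * I) by ring.
  by apply: le_trans (ler_normB _ _) _; exact: lerD.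
rewrite -/d => H.
have : d * (h ^+ 2 / 2) <= d * I by rewrite ler_pM2l.
have : 0 < d * h ^+ 2 by rewrite mulr_gt0// exprn_gt0.
move: H; nra.
Unshelve. all: by end_near. Qed.

(** Almost every point is a Lebesgue point. *)
Lemma du_bois_reymond l r : 0 < l -> mu.-integrable `]0, l[ (EFin \o r) ->
  (forall phi, test_function l phi -> \int[mu]_(x in `]0, l[) (r x * derive1 phi x) = 0) ->
  exists k, {ae mu, forall x, x \in `]0, l[ -> r x = k}.
Proof.
move=> l0 ir hr.
have lr := integrable_locally_restrict (measurable_itv `]0, l[) ir.
have [N [mN N0 sN]] := lebesgue_differentiation lr.
have [b [bD bN]] : exists b, (b \in `]0, l[) /\ ~ N b.
  apply: contrapT => /forallNP h.
  have DN : `]0, l[%classic `<=` N.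
    by move=> x xD; apply: contrapT => xN; exact: (h x).
  have : (mu `]0%R, l[%classic <= mu N)%E by apply: le_measure => //; rewrite inE.
  rewrite N0 lebesgue_measure_itv/= lte_fin l0 sube0 lee_fin; lra.
have lp x : ~ N x -> lebesgue_pt (r \_ `]0, l[) x.
  by move=> xN; apply: contrapT => h; apply: xN; apply: sN.
exists (r b); exists N; split => // x /= /not_implyP[xD ne].
apply: contrapT => xN; apply: ne.
by apply: (weak_const_lebesgue_pt ir hr) => //; exact: lp.
Qed.

End DuBoisReymond.

(** * Displacements and the block inequality *)

Section Displacements.
Context {R : realType} (lam Lam delta : R).
Hypotheses (lam_gt0 : 0 < lam) (le_lam_Lam : lam <= Lam) (delta_gt0 : 0 < delta).
Local Notation mu := (@lebesgue_measure R).
Implicit Types (X : seq R) (x k l L : R) (u v w : R -> R).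
Local Notation profile := (profile lam Lam delta).
Local Notation displacement := (displacement lam Lam delta).

Lemma ae_imply (P Q : R -> Prop) : (forall x, P x -> Q x) ->
  {ae mu, forall x, P x} -> {ae mu, forall x, Q x}.
Proof.
by move=> PQ [N [mN N0 sN]]; exists N; split => // x /= nQ; apply: sN => /= Px; exact: nQ (PQ _ Px).
Qed.

Lemma Linfty_integrable l u : Linfty l u -> mu.-integrable `]0, l[ (EFin \o u).
Proof.
move=> [mf [M hM]]; apply/integrableP; split; first exact/measurable_EFinP.
apply: (@le_lt_trans _ _ (\int[mu]_(x in `]0%R, l[) `|M|%:E)%E).
  apply: ae_ge0_le_integral => //.
  - by apply: (measurableT_comp (@abse_measurable R setT)); apply/measurable_EFinP.
  - apply: ae_imply hM => x hx xl /=; rewrite lee_fin.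
    by apply: le_trans (hx _) (ler_norm _).
rewrite integral_cst//= lebesgue_measure_itv/=; case: ifP => _; last by rewrite mule0.
by rewrite -EFinB -EFinM ltry.
Qed.

(** The profile of the same configuration has the same weak derivative. *)
Lemma displacement_profile l u : 0 < l -> displacement l u ->
  exists2 X, AD delta l X &
    exists k, {ae mu, forall x, x \in `]0, l[ -> u x = profile X x + k}.
Proof.
move=> l0 [X AX [[Lu _] wu]]; exists X => //.
have [sX _] := (AD_spaced lam_gt0 le_lam_Lam delta_gt0 l X).1 AX.
have wp := weak_deriv_profile lam Lam delta_gt0 0 l0 sX.
have iu := Linfty_integrable Lu.
have cp : continuous (profile X).
  by apply: (@continuous_lip _ _ Lam) => x y; exact: profile_lip.
have ip : mu.-integrable `]0, l[ (EFin \o profile X) by exact: integrable_continuous.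
have ir : mu.-integrable `]0, l[ (EFin \o (fun x => u x - profile X x)).
  rewrite (_ : EFin \o _ = ((EFin \o u) \- (EFin \o profile X))%E); last by apply/funext.
  exact: integrableB.
have [|k hk] := du_bois_reymond l0 ir; last first.
  exists k; apply: ae_imply hk => x hx xl; rewrite -(hx xl); ring.
move=> phi tphi; have [_ cphi _ _] := tphi.
have := wu _ tphi; rewrite -(wp _ tphi) => e.
have -> : \int[mu]_(x in `]0, l[) ((u x - profile X x) * derive1 phi x) =
   \int[mu]_(x in `]0, l[) (1 * (u x * derive1 phi x - profile X x * derive1 phi x)).
  by apply: eq_Rintegral => x _; ring.
have iup := integrable_mul iu cphi; have ipp := integrable_mul ip cphi.
rewrite Rintegral_lin//.
rewrite e mul1r; apply/eqP; rewrite subr_eq0; apply/eqP.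
by apply: eq_Rintegral => x _; rewrite addr0.
Qed.

(** Fubini turns a null set of points into a null set of pairs. *)
Lemma gagliardo_ae l u v : measurable_fun (`]0, l[%classic : set R) u ->
  measurable_fun (`]0, l[%classic : set R) v ->
  {ae mu, forall x, x \in `]0, l[ -> u x = v x} -> gagliardo l u = gagliardo l v.
Proof.
move=> mf mv uv.
have ms (f : R -> R) y : measurable_fun (`]0, l[%classic : set R) f ->
    measurable_fun (`]0, l[%classic : set R) (fun x => (`|f x - f y| ^+ 2 / `|x - y| ^+ 2)%:E).
  move=> mf'; apply/measurable_EFinP; apply: measurable_funM.
    apply: measurable_funX; apply: (measurableT_comp (@normr_measurable R setT)).
    exact: measurable_funB.
  apply: (measurableT_comp measurable_invr); apply: measurable_funX.
  by apply: (measurableT_comp (@normr_measurable R setT)); exact: measurable_funB.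
have mo (f : R -> R) : measurable_fun (`]0, l[%classic : set R) f ->
    measurable_fun (`]0, l[%classic : set R)
      (fun y => \int[mu]_(x in `]0%R, l[) (`|f x - f y| ^+ 2 / `|x - y| ^+ 2)%:E)%E.
  move=> mf'.
  have mfd : measurable_fun (`]0, l[%classic `*` `]0, l[%classic : set (R * R))
      (fun z => (dq f z ^+ 2)%:E).
    by apply: measurable_sqrE; exact: measurable_dq.
  have := measurable_iterated (measurable_itv _) (measurable_itv _) mfd
    (fun z => ltac:(by rewrite lee_fin sqr_ge0)).
  apply: eq_measurable_fun => y _; apply: eq_integral => x _.
  by rewrite /dq expr_div_n !real_normK ?num_real.
have nn (f : R -> R) x y : (0 <= (`|f x - f y| ^+ 2 / `|x - y| ^+ 2)%:E)%E.
  by rewrite lee_fin divr_ge0.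
apply: ge0_ae_eq_integral => //.
- exact: mo.
- exact: mo.
- by move=> y _; exact: integral_ge0.
- by move=> y _; exact: integral_ge0.
have [N [mN N0 sN]] := uv; exists N; split => // y /= ny; apply: (sN y) => /= uvy.
apply: ny => yl; have {}uvy := uvy yl.
apply: ge0_ae_eq_integral => //.
- exact: ms.
- exact: ms.
exists N; split => // x /= nx; apply: (sN x) => /= uvx; apply: nx => xl.
by rewrite uvx// uvy.
Qed.

Lemma gagliardo_displacement l u : 0 < l -> displacement l u ->
  exists2 X, AD delta l X & gagliardo l u = energy_on (box l) (profile X).
Proof.
move=> l0 du; have [X AX [k hk]] := displacement_profile l0 du.
have [sX _] := (AD_spaced lam_gt0 le_lam_Lam delta_gt0 l X).1 AX.
exists X => //; have mp := measurable_profile lam_gt0 le_lam_Lam delta_gt0 sX.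
have mpk : measurable_fun [set: R] (fun x => profile X x + k) by exact: measurable_funD.
have [_ _ [[[mf _] _] _]] := du.
rewrite (gagliardo_ae mf _ hk); last exact: measurable_funTS.
rewrite gagliardoE; last exact: measurable_funTS.
by rewrite energy_on_addc.
Qed.

Local Notation c_ := (c_ lam Lam delta).

Lemma c_le l X : 0 < l -> AD delta l X ->
  (l%:E * c_ l <= energy_on (box l) (profile X))%E.
Proof.
move=> l0 AX.
have [sX _] := (AD_spaced lam_gt0 le_lam_Lam delta_gt0 l X).1 AX.
have mp := measurable_profile lam_gt0 le_lam_Lam delta_gt0 sX.
rewrite -lee_pdivlMl//; apply: ereal_inf_lbound; exists (fun x => profile X x + 0).
  exact: profile_displacement.
have mpk : measurable_fun [set: R] (fun x => profile X x + 0) by exact: measurable_funD.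
rewrite gagliardoE; last exact: measurable_funTS.
by rewrite energy_on_addc.
Qed.

Lemma c_ge0 l : 0 < l -> (0 <= c_ l)%E.
Proof.
move=> l0; apply: le_ereal_inf_tmp => _ [u _ <-].
apply: mule_ge0; first by rewrite lee_fin invr_ge0 ltW.
by apply: integral_ge0 => y _; apply: integral_ge0 => x _; rewrite lee_fin divr_ge0.
Qed.

(** On each block the profile is, up to a constant, that of a window, which is an
    admissible configuration of the block. *)
Lemma energy_blocks_c L l (n : nat) X : 0 < L -> n%:R * L <= l -> spaced delta X ->
  ((n%:R * L)%:E * c_ L + energy_on (box l `&` far L) (profile X) <=
   energy_on (box l) (profile X))%E.
Proof.
move=> L0 nL sX; have mp := measurable_profile lam_gt0 le_lam_Lam delta_gt0 sX.
apply: le_trans (energy_blocks L0 nL mp); apply: leeD2r.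
have -> : ((n%:R * L)%:E * c_ L = \sum_(j < n) (L%:E * c_ L))%E.
  rewrite EFinM -muleA; elim: n {nL} => [|n IH]; first by rewrite big_ord0 mul0e.
  rewrite big_ord_recr/= -IH -natr1 EFinD ge0_muleDl//; by rewrite mul1e.
apply: lee_sum => j _.
have AW := window_AD lam_gt0 le_lam_Lam delta_gt0 (j%:R * L) L sX.
have [k hk] := profile_window lam Lam delta_gt0 (j%:R * L) L X.
apply: le_trans (c_le L0 AW) _.
have [sW _] := (AD_spaced lam_gt0 le_lam_Lam delta_gt0 L _).1 AW.
rewrite -(energy_on_addc _ _ k).
rewrite le_eqVlt; apply/orP; left; apply/eqP.
apply: eq_integral => -[x y]; rewrite inE /box/= !in_itv/= => -[/andP[x0 xL] /andP[y0 yL]].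
by rewrite /dq/= !hk// ?(ltW x0) ?(ltW y0) ?(ltW xL) ?(ltW yL).
Qed.

Lemma c_superadditive L l (n : nat) : 0 < L -> 0 < l -> n%:R * L <= l ->
  ((n%:R * L / l)%:E * c_ L <= c_ l)%E.
Proof.
move=> L0 l0 nL; apply: le_ereal_inf_tmp => _ [u du <-].
have [X AX ->] := gagliardo_displacement l0 du.
have [sX _] := (AD_spaced lam_gt0 le_lam_Lam delta_gt0 l X).1 AX.
rewrite lee_pdivlMl// muleA -EFinM mulrC divfK ?gt_eqF//.
apply: le_trans (energy_blocks_c L0 nL sX).
by apply: leeDl; exact: energy_on_ge0.
Qed.

End Displacements.

(** * Energy of sparse oscillations *)

Section SparseEnergy.
Context {R : realType}.
Local Notation mu := (@lebesgue_measure R).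
Implicit Types (x y l d e A K : R) (u : R -> R).

Lemma integral_inv_sq (a b y : R) : a < b -> (b < y) || (y < a) ->
  (\int[mu]_(x in `[a, b]) ((x - y) ^- 2)%:E = ((a - y)^-1 - (b - y)^-1)%:E)%E.
Proof.
move=> ab yab.
have ne x : a <= x <= b -> x - y != 0.
  by move=> xab; rewrite subr_eq0; apply/eqP => xy; move: yab; rewrite -xy; lra.
have dF x : a <= x <= b -> is_derive x 1 (fun x => - (x - y)^-1) ((x - y) ^- 2).
  move=> xab; have xy := ne x xab.
  have d1 : is_derive x 1 (fun z : R => z - y) 1.
    by apply: is_derive_eq; rewrite subr0.
  have h : is_derive x 1 (fun x => - (x - y)^-1) (- (- (x - y) ^- 2 *: 1)) :=
    is_deriveN (is_deriveV (f := fun z : R => z - y) xy d1).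
  by apply: is_derive_eq h _; rewrite scaleNr opprK /GRing.scale/= mulr1.
have cF x : a <= x <= b -> {for x, continuous (fun x => - (x - y)^-1)}.
  move=> xab; apply: differentiable_continuous; apply/derivable1_diffP.
  by have := dF x xab; case.
rewrite (@continuous_FTC2 R (fun x => (x - y) ^- 2) (fun x => - (x - y)^-1))//.
- by rewrite -EFinB; congr (_ %:E); ring.
- apply/subspace_continuousP => x /=; rewrite in_itv/= => xab.
  apply: cvg_within_filter.
  apply: cvgV; first by rewrite expf_neq0// ne.
  have cx : {for x, continuous (fun z : R => z - y)}.
    by apply: cvgB; [exact: cvg_id|exact: cvg_cst].
  have -> : (fun z : R => (z - y) ^+ 2) = (fun z => (z - y) * (z - y)).
    by apply/funext => z; rewrite expr2.
  by rewrite expr2; apply: cvgM; exact: cx.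
- split.
  + by move=> x; rewrite in_itv/= => /andP[/ltW h1 /ltW h2]; have := dF x ltac:(by rewrite h1 h2); case.
  + by apply: cvg_at_right_filter; apply: cF; rewrite lexx ltW.
  + by apply: cvg_at_left_filter; apply: cF; rewrite lexx ltW.
- move=> x; rewrite in_itv/= => /andP[/ltW h1 /ltW h2].
  by rewrite derive1E; have := dF x ltac:(by rewrite h1 h2) => h; apply: derive_val.
Qed.

Lemma measurable_inv_sq (y : R) : measurable_fun [set: R] (fun x : R => ((x - y) ^- 2)%:E).
Proof.
apply/measurable_EFinP; apply: (measurableT_comp measurable_invr).
by apply: measurable_funX; exact: measurable_funB.
Qed.

(** The near part contributes e^2 over a length 2 d; the far part is at most (2 A)^2
    times the integral of the inverse square of the distance beyond d, on either
    side. *)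
Lemma energy_density_le l y d e A u : measurable_fun [set: R] u -> 0 < d -> 0 < l ->
  0 < y < l ->
  (forall x, 0 < x < l -> `|x - y| <= d -> `|u x - u y| <= e * `|x - y|) ->
  (forall x, 0 < x < l -> `|u x - u y| <= 2 * A) ->
  (\int[mu]_(x in `]0%R, l[) (dq u (x, y) ^+ 2)%:E <= (2 * d * e ^+ 2 + 8 * A ^+ 2 / d)%:E)%E.
Proof.
move=> mf d0 l0 /andP[y0 yl] near_ far_.
have mdq : measurable_fun [set: R] (fun x => (dq u (x, y) ^+ 2)%:E).
  by have := measurable_fun_pair1 y (measurable_dq2 mf).
have nn x : (0 <= (dq u (x, y) ^+ 2)%:E)%E by rewrite lee_fin sqr_ge0.
pose I1 : set R := `[y - d, y + d]%classic.
pose I2 : set R := `[y - d - l, y - d]%classic.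
pose I3 : set R := `[y + d, y + d + l]%classic.
pose g1 x : \bar R := (e ^+ 2)%:E.
pose g2 x : \bar R := (((2 * A) ^+ 2)%:E * ((x - y) ^- 2)%:E)%E.
have g20 x : (0 <= g2 x)%E by rewrite /g2 -EFinM lee_fin mulr_ge0 ?sqr_ge0// invr_ge0 sqr_ge0.
have mg2 : measurable_fun [set: R] g2 by apply: measurable_funeM; exact: measurable_inv_sq.
have mI1 : measurable I1 by exact: measurable_itv.
have mI2 : measurable I2 by exact: measurable_itv.
have mI3 : measurable I3 by exact: measurable_itv.
have m1 : measurable_fun [set: R] (g1 \_ I1)%E by apply/(measurable_restrictT g1) => //; exact: measurable_cst.
have m2 : measurable_fun [set: R] (g2 \_ I2)%E by apply/(measurable_restrictT g2) => //; exact: measurable_funTS.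
have m3 : measurable_fun [set: R] (g2 \_ I3)%E by apply/(measurable_restrictT g2) => //; exact: measurable_funTS.
have p1 x : (0 <= (g1 \_ I1) x)%E by apply: erestrict_ge0 => z _; rewrite lee_fin sqr_ge0.
have p2 x : (0 <= (g2 \_ I2) x)%E by apply: erestrict_ge0 => z _; exact: g20.
have p3 x : (0 <= (g2 \_ I3) x)%E by apply: erestrict_ge0 => z _; exact: g20.
have far_le (a b : R) : a < b -> (b < y) || (y < a) -> (a - y)^-1 - (b - y)^-1 <= d^-1 ->
    (\int[mu]_x (g2 \_ `[a, b]%classic) x <= ((2 * A) ^+ 2 / d)%:E)%E.
  move=> ab yab h; rewrite -integral_mkcond ge0_integralZl//.
  - by rewrite integral_inv_sq// -EFinM lee_fin ler_wpM2l// sqr_ge0.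
  - by apply: measurable_funTS; exact: measurable_inv_sq.
  - by move=> x _; rewrite lee_fin invr_ge0 sqr_ge0.
  - by rewrite lee_fin sqr_ge0.
apply: (@le_trans _ _ (\int[mu]_x ((g1 \_ I1) x + ((g2 \_ I2) x + (g2 \_ I3) x)))%E).
  rewrite integral_mkcond; apply: ge0_le_integral => //.
  - by move=> x _; apply: erestrict_ge0.
  - by apply/(measurable_restrictT (fun x => (dq u (x, y) ^+ 2)%:E)) => //; exact: measurable_funTS.
  - by apply: emeasurable_funD => //; exact: emeasurable_funD.
  move=> x _; rewrite patchE; case: ifPn => [|_]; last first.
    by apply: adde_ge0 => //; apply: adde_ge0.
  rewrite inE/= in_itv/= => /andP[x0 xl].
  have [xd|dx] := leP `|x - y| d.
    apply: le_trans (leeDl _ _); last exact: adde_ge0.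
    rewrite patchE mem_set; last first.
      by rewrite /I1/= in_itv/=; move: xd; rewrite ler_norml => ?; lra.
    rewrite /g1 lee_fin; apply: sqr_le_norm; rewrite /dq/= normrM normfV.
    have [->|xy] := eqVneq x y; first by rewrite !subrr normr0 mul0r.
    rewrite ler_pdivrMr ?normr_gt0 ?subr_eq0//; apply: le_trans (near_ _ _ xd) _.
      by rewrite x0 xl.
    by rewrite ler_wpM2r// ler_norm.
  have key : ((dq u (x, y) ^+ 2)%:E <= g2 x)%E.
    rewrite /g2 -EFinM lee_fin /dq/= exprMn exprVn ler_wpM2r ?invr_ge0 ?sqr_ge0//.
    apply: sqr_le_norm; apply: le_trans (ler_norm _); apply: far_; by rewrite x0 xl.
  apply: le_trans (leeDr _ _) => //.
  have [xy|yx] := leP x y.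
    apply: le_trans (leeDl _ _) => //; rewrite patchE mem_set//.
    rewrite /I2/= in_itv/=; move: dx; rewrite ler0_norm ?subr_le0// => ?; lra.
  apply: le_trans (leeDr _ _) => //; rewrite patchE mem_set//.
  rewrite /I3/= in_itv/=; move: dx; rewrite gtr0_norm ?subr_gt0// => ?; lra.
rewrite ge0_integralD//; [|by move=> x _; exact: adde_ge0|exact: emeasurable_funD].
rewrite ge0_integralD//.
have i1 : (\int[mu]_x (g1 \_ I1) x <= (2 * d * e ^+ 2)%:E)%E.
  rewrite -integral_mkcond /g1 integral_cst//= /I1 lebesgue_measure_itv/= lte_fin ifT; last lra.
  by rewrite -EFinB -EFinM lee_fin; lra.
have i2 : (\int[mu]_x (g2 \_ I2) x <= ((2 * A) ^+ 2 / d)%:E)%E.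
  apply: far_le; [lra|by apply/orP; left; lra|].
  have -> : y - d - l - y = - (d + l) by ring.
  have -> : y - d - y = - d by ring.
  rewrite !invrN opprK; have : 0 <= (d + l)^-1 by rewrite invr_ge0; lra.
  lra.
have i3 : (\int[mu]_x (g2 \_ I3) x <= ((2 * A) ^+ 2 / d)%:E)%E.
  apply: far_le; [lra|by apply/orP; right; lra|].
  have -> : y + d - y = d by ring.
  have -> : y + d + l - y = d + l by ring.
  have : 0 <= (d + l)^-1 by rewrite invr_ge0; lra.
  lra.
apply: le_trans (leeD i1 (leeD i2 i3)) _.
by rewrite -!EFinD lee_fin exprMn; lra.
Qed.

(** At the points outside B the density is computed at scale d; at those of B it is
    computed at scale 1 and only bounded, so the measure of B counts. *)
Lemma sparse_energy l d e A K (B : set R) u : measurable_fun [set: R] u -> measurable B ->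
  0 < d -> 0 < l ->
  (forall x y, 0 < x < l -> 0 < y < l -> `|u x - u y| <= K * `|x - y|) ->
  (forall x y, 0 < x < l -> 0 < y < l -> `|u x - u y| <= 2 * A) ->
  (forall x y, 0 < x < l -> 0 < y < l -> ~ B y -> `|x - y| <= d ->
     `|u x - u y| <= e * `|x - y|) ->
  (energy_on (box l) u <= ((2 * d * e ^+ 2 + 8 * A ^+ 2 / d) * l)%:E +
     (2 * K ^+ 2 + 8 * A ^+ 2)%:E * mu (B `&` `]0%R, l[))%E.
Proof.
move=> mf mB d0 l0 hK hA he.
have G0 : 0 <= 2 * d * e ^+ 2 + 8 * A ^+ 2 / d.
  apply: addr_ge0; first by rewrite mulr_ge0 ?sqr_ge0// mulr_ge0// ltW.
  by rewrite divr_ge0 ?(ltW d0)// mulr_ge0 ?sqr_ge0.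
have C0 : 0 <= 2 * K ^+ 2 + 8 * A ^+ 2 by rewrite addr_ge0// mulr_ge0 ?sqr_ge0.
have mdq := measurable_dq2 mf.
have f0 (z : R * R) : (0 <= (dq u z ^+ 2)%:E)%E by rewrite lee_fin sqr_ge0.
have mI : measurable (`]0, l[%classic : set R) by exact: measurable_itv.
rewrite /energy_on /box iterated_integral//; last exact: measurable_funTS.
pose G := 2 * d * e ^+ 2 + 8 * A ^+ 2 / d; pose C := 2 * K ^+ 2 + 8 * A ^+ 2.
apply: (@le_trans _ _ (\int[mu]_(y in `]0%R, l[) (G%:E + C%:E * (\1_B y)%:E))%E).
  apply: ge0_le_integral => //.
  - by move=> y _; exact: integral_ge0.
  - by apply: (measurable_iterated mI mI (f := fun z => (dq u z ^+ 2)%:E)) => //; exact: measurable_funTS.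
  - apply: emeasurable_funD; first exact: measurable_cst.
    by apply: measurable_funeM; apply/measurable_EFinP; apply: measurable_funTS; exact: measurable_indic.
  move=> y /=; rewrite in_itv/= => yl.
  have [By|nBy] := pselect (B y); last first.
    rewrite indicE memNset// mule0 adde0.
    apply: energy_density_le => // x xl; first by exact: he.
    exact: hA.
  rewrite indicE mem_set// mule1.
  apply: (@le_trans _ _ C%:E); last by rewrite leeDr// lee_fin.
  have := @energy_density_le l y 1 K A u mf ltr01 l0 yl (fun x xl _ => hK x y xl yl) (fun x xl => hA x y xl yl).
  by rewrite mulr1 divr1.
rewrite ge0_integralD//.
- rewrite integral_cst//= lebesgue_measure_itv/= lte_fin l0 sube0 -EFinM; apply: leeD2l.
  rewrite ge0_integralZl//.
  + by rewrite integral_indic.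
  + by apply/measurable_EFinP; apply: measurable_funTS; exact: measurable_indic.
- by move=> x _; apply: mule_ge0; rewrite lee_fin.
- by apply: measurable_funeM; apply/measurable_EFinP; apply: measurable_funTS; exact: measurable_indic.
Qed.

End SparseEnergy.

(** * The limit of the cell energies *)

Section CellConstant.
Context {R : realType} (lam Lam delta : R).
Hypotheses (lam_gt0 : 0 < lam) (le_lam_Lam : lam <= Lam) (delta_gt0 : 0 < delta).
Local Notation profile := (profile lam Lam delta).
Local Notation c_ := (c_ lam Lam delta).
Implicit Types (l L x : R).

Let D : R := (Lam + lam) * delta.

(** One dislocation in the middle of each interval of length D / lam cancels the mean
    slope exactly. *)
Lemma bounded_profile (n : nat) : exists2 X, spaced delta X &
  forall x, 0 <= x <= n%:R * (D / lam) -> `|profile X x| <= D.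
Proof.
move: lam_gt0 le_lam_Lam delta_gt0 => a1 a2 a3.
pose p := D / lam.
have p0 : 2 * delta <= p by rewrite /p /D ler_pdivlMr//; nra.
have lp : lam * p = D by rewrite /p mulrC divfK ?gt_eqF.
pose f (i : nat) : R := (i%:R + 2^-1) * p.
pose X m := [seq f i | i <- iota 0 m].
have H (m : nat) x : 0 <= x <= m%:R * p -> `|profile (X m) x| <= D.
  elim: m x => [|m IH] x.
    rewrite mul0r => ?; have -> : x = 0 by lra.
    by rewrite /profile /rampsum big_nil !mulr0 subr0 normr0 /D; nra.
  move=> /andP[x0]; rewrite -natr1 mulrDl mul1r => xm.
  have XS : X m.+1 = X m ++ [:: f m] by rewrite /X -addn1 iotaD map_cat.
  have [xm'|xm'] := leP x (m%:R * p).
    have := IH x; rewrite x0 xm' => /(_ isT); rewrite /profile XS rampsum_cat.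
    rewrite (@rampsum_le _ _ [:: f m]) ?addr0//; first lra.
    by move=> c; rewrite inE => /eqP ->; rewrite /f; lra.
  rewrite /profile XS rampsum_cat (@rampsum_ge _ _ (X m)); last 2 first.
  - lra.
  - move=> c /mapP[i]; rewrite mem_iota => /andP[_ im] ->.
    have : (i%:R + 1 : R) <= m%:R by rewrite natr1 ler_nat.
    rewrite /f => h; have : (i%:R + 1) * p <= m%:R * p by rewrite ler_wpM2r//; lra.
    lra.
  rewrite size_map size_iota /rampsum big_seq1.
  have r01 : 0 <= ramp delta (x - f m) <= delta.
    rewrite /ramp /Num.max; case: ltP => ?; case: ltP => ?; lra.
  set r := ramp _ _ in r01 *.
  have -> : lam * x - (Lam + lam) * (delta * m%:R + r) = lam * (x - m%:R * p) - (Lam + lam) * r.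
    have -> : lam * (x - m%:R * p) = lam * x - m%:R * (lam * p) by ring.
    by rewrite lp /D; ring.
  have h1 : lam * (x - m%:R * p) <= D by rewrite -lp ler_wpM2l//; lra.
  have h2 : 0 <= lam * (x - m%:R * p) by rewrite mulr_ge0//; lra.
  have h3 : (Lam + lam) * r <= D by rewrite /D ler_wpM2l//; lra.
  have h4 : 0 <= (Lam + lam) * r by rewrite mulr_ge0//; lra.
  by rewrite ler_norml; lra.
exists (X n); last exact: H.
rewrite /spaced sorted_map; apply: sub_sorted (iota_ltn_sorted 0 n) => i j /= ij.
have : (i%:R + 1 : R) <= j%:R by rewrite natr1 ler_nat.
rewrite /f => h; have : (i%:R + 1) * p <= j%:R * p by rewrite ler_wpM2r//; lra.
lra.
Qed.

Lemma c_le_profile l X : 0 < l -> spaced delta X ->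
  (l%:E * c_ l <= energy_on (box l) (profile X))%E.
Proof.
move=> l0 sX; have := @energy_blocks_c R lam Lam delta lam_gt0 le_lam_Lam delta_gt0 l l 1 X l0.
rewrite mul1r => /(_ (lexx _) sX); apply: le_trans; apply: leeDl; exact: energy_on_ge0.
Qed.

(** The energy density of a bounded Lipschitz profile is bounded, whatever the
    length. *)
Lemma c_bounded l : 0 < l -> (c_ l <= (2 * Lam ^+ 2 + 8 * D ^+ 2)%:E)%E.
Proof.
move=> l0; have Dp : 0 < D / lam.
  by rewrite divr_gt0// /D; move: lam_gt0 le_lam_Lam delta_gt0 => a1 a2 a3; nra.
have [n ln] : exists n : nat, l <= n%:R * (D / lam).
  exists (Num.truncn (l / (D / lam))).+1; rewrite -ler_pdivrMr//.
  by apply: ltW; exact: truncnS_gt.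
have [X sX hX] := bounded_profile n.
have mp := measurable_profile lam_gt0 le_lam_Lam delta_gt0 sX.
have hb x : 0 < x < l -> `|profile X x| <= D.
  by move=> /andP[x0 xl]; apply: hX; rewrite (ltW x0)/=; apply: le_trans ln; exact: ltW.
have := @sparse_energy R l 1 Lam D Lam set0 (profile X) mp measurable0 ltr01 l0.
rewrite set0I measure0 mule0 adde0 mulr1 divr1 => H.
rewrite -(@lee_pmul2l _ l%:E) ?lte_fin//; apply: le_trans (c_le_profile l0 sX) _.
rewrite -EFinM [X in (_ <= X%:E)%E]mulrC; apply: H.
- by move=> x y _ _; exact: profile_lip.
- by move=> x y xl yl; apply: le_trans (ler_normB _ _) _; have := hb x xl; have := hb y yl; lra.
- by move=> x y _ _ _ _; exact: profile_lip.
Qed.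

(** Superadditivity of l c_l makes c_l converge to its supremum. *)
Lemma c_infty_spec : exists cs : R, [/\ 0 <= cs,
  forall l, 0 < l -> (c_ l <= cs%:E)%E,
  forall e, 0 < e -> exists2 L0, 0 < L0 & forall l, L0 <= l -> ((cs - e)%:E <= c_ l)%E &
  c_infty lam Lam delta = cs%:E].
Proof.
pose S := ereal_sup [set c_ l | l in [set l | 0 < l]].
have S_ub l : 0 < l -> (c_ l <= S)%E by move=> l0; apply: ereal_sup_ubound; exists l.
have S_fin : S \is a fin_num.
  rewrite ge0_fin_numE; last by apply: le_trans (S_ub 1 ltr01); exact: c_ge0.
  apply: le_lt_trans (ltry (2 * Lam ^+ 2 + 8 * D ^+ 2)).
  by apply: ge_ereal_sup => _ [l l0 <-]; exact: c_bounded.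
have ES : S = (fine S)%:E by rewrite fineK.
have S0 : 0 <= fine S by rewrite fine_ge0//; apply: le_trans (S_ub 1 ltr01); exact: c_ge0.
have lowb e : 0 < e -> exists2 L0, 0 < L0 & forall l, L0 <= l -> ((fine S - e)%:E <= c_ l)%E.
  move=> e0; have : (S - (e / 2)%:E < S)%E.
    by rewrite ES -EFinB lte_fin; lra.
  move=> /ereal_sup_gt[_ [L /= L0 <-]] hL.
  have eL : 0 < 2 * (fine S + 1) * L / e by rewrite divr_gt0// !mulr_gt0//; lra.
  (* Beyond this length the incomplete last block costs at most e / 2. *)
  exists (L + 2 * (fine S + 1) * L / e); first lra.
  move=> l hl; have l0 : 0 < l by lra.
  pose n := Num.truncn (l / L).
  have nL : n%:R * L <= l.
    by rewrite -ler_pdivlMr// truncn_le// divr_ge0// ltW.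
  have nL' : l - L <= n%:R * L.
    have : l / L < n.+1%:R by exact: truncnS_gt.
    by rewrite ltr_pdivrMr// -natr1 mulrDl mul1r => ?; lra.
  have cL : c_ L = (fine (c_ L))%:E.
    rewrite fineK// ge0_fin_numE; last exact: c_ge0.
    by apply: le_lt_trans (S_ub _ L0) _; rewrite ES ltry.
  apply: le_trans (@c_superadditive R lam Lam delta lam_gt0 le_lam_Lam delta_gt0 L l n L0 l0 nL).
  move: hL; rewrite cL ES -EFinB lte_fin -EFinM lee_fin => hL.
  have cLS : fine (c_ L) <= fine S by rewrite -lee_fin -cL -ES; exact: S_ub.
  have c0 : 0 <= fine (c_ L) by rewrite fine_ge0//; exact: c_ge0.
  apply: (@le_trans _ _ ((1 - L / l) * fine (c_ L))).
    have : L / l * fine (c_ L) <= e / 2.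
      rewrite mulrAC ler_pdivrMr//.
      have h1 : L * fine (c_ L) <= L * (fine S + 1) by rewrite ler_wpM2l//; lra.
      have h2 : e / 2 * (2 * (fine S + 1) * L / e) <= e / 2 * l by rewrite ler_wpM2l//; lra.
      have h3 : e / 2 * (2 * (fine S + 1) * L / e) = L * (fine S + 1) by field; rewrite gt_eqF.
      lra.
    lra.
  apply: ler_wpM2r => //; rewrite ler_pdivlMr//.
  have -> : (1 - L / l) * l = l - L by field; rewrite gt_eqF.
  exact: nL'.
exists (fine S); split => //.
- by move=> l l0; rewrite -ES; exact: S_ub.
rewrite /c_infty; apply: cvg_lim => //.
apply/fine_cvgP; split.
  near=> l; have l0 : 0 < l by near: l; exact: nbhs_pinfty_gt.
  rewrite ge0_fin_numE; last exact: c_ge0.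
  by apply: le_lt_trans (S_ub _ l0) _; rewrite ES ltry.
apply/cvgrPdist_le => e e0; have [L0 L00 hL] := lowb e e0.
near=> l; have l0 : 0 < l by near: l; exact: nbhs_pinfty_gt.
have lL : L0 <= l by near: l; exact: (nbhs_pinfty_ge (num_real L0)).
have cl : c_ l = (fine (c_ l))%:E.
  rewrite fineK// ge0_fin_numE; last exact: c_ge0.
  by apply: le_lt_trans (S_ub _ l0) _; rewrite ES ltry.
have h1 : fine S - e <= fine (c_ l) by rewrite -lee_fin -cl; exact: hL.
have h2 : fine (c_ l) <= fine S by rewrite -lee_fin -cl -ES; exact: S_ub.
rewrite /= ler_norml; move: h1 h2; move: (fine (c_ l)) (fine S) => p q h1 h2.
by apply/andP; split; lra.
Unshelve. all: by end_near. Qed.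

End CellConstant.

(** * The inner products of the fractional Sobolev space *)

Section SquareIntegrable.
Context d (T : measurableType d) (R : realType) (mu : {measure set T -> \bar R}).
Variable D : set T.
Hypothesis mD : measurable D.
Implicit Types (f g : T -> R) (a c : R).

Definition l2 f := measurable_fun D f /\ (\int[mu]_(x in D) (f x ^+ 2)%:E < +oo)%E.

Lemma l2_sqr f : l2 f -> mu.-integrable D (EFin \o (fun x => f x ^+ 2)).
Proof.
move=> [mf lf]; apply/integrableP; split.
  by exact: measurable_sqrE.
by under eq_integral do rewrite /= ger0_norm ?sqr_ge0//.
Qed.

Lemma l2_mul f g : l2 f -> l2 g -> mu.-integrable D (EFin \o (fun x => f x * g x)).
Proof.
move=> lf lg; apply: le_integrable (integrableD mD (l2_sqr lf) (l2_sqr lg)) => //.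
  by apply/measurable_EFinP; apply: measurable_funM; [exact: lf.1|exact: lg.1].
move=> x _; change (`|f x * g x|%:E <= `|f x ^+ 2 + g x ^+ 2|%:E)%E.
rewrite lee_fin [leRHS]ger0_norm ?addr_ge0 ?sqr_ge0//.
rewrite ler_norml; apply/andP; split.
  by have := sqr_ge0 (f x + g x); have := sqr_ge0 (f x); have := sqr_ge0 (g x); nra.
by have := sqr_ge0 (f x - g x); have := sqr_ge0 (f x); have := sqr_ge0 (g x); nra.
Qed.

Lemma l2_lin c f g : l2 f -> l2 g -> l2 (fun x => c * f x + g x) /\
  \int[mu]_(x in D) ((c * f x + g x) ^+ 2) = c ^+ 2 * \int[mu]_(x in D) (f x ^+ 2) +
    2 * c * \int[mu]_(x in D) (f x * g x) + \int[mu]_(x in D) (g x ^+ 2).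
Proof.
move=> lf lg; have iff := l2_sqr lf; have igg := l2_sqr lg; have ifg := l2_mul lf lg.
have i1 : mu.-integrable D (EFin \o (fun x => c ^+ 2 * f x ^+ 2)) by exact: (integrableZl mD _ iff).
have i2 : mu.-integrable D (EFin \o (fun x => 2 * c * (f x * g x))) by exact: (integrableZl mD _ ifg).
have i12 : mu.-integrable D (EFin \o (fun x => c ^+ 2 * f x ^+ 2 + 2 * c * (f x * g x))).
  exact: (integrableD mD i1 i2).
have e x : (c * f x + g x) ^+ 2 = c ^+ 2 * f x ^+ 2 + 2 * c * (f x * g x) + g x ^+ 2 by ring.
split.
  split; first by apply: measurable_funD; [apply: measurable_funM => //; exact: lf.1|exact: lg.1].
  have : mu.-integrable D (EFin \o (fun x => (c * f x + g x) ^+ 2)).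
    rewrite (_ : EFin \o _ = ((EFin \o (fun x => c ^+ 2 * f x ^+ 2 + 2 * c * (f x * g x))%R) \+ (EFin \o (fun x => g x ^+ 2)%R))%E).
      exact: integrableD.
    by apply/funext => x /=; rewrite -EFinD e.
  move=> /integrableP[_]; under eq_integral do rewrite /= ger0_norm ?sqr_ge0//.
  by [].
have -> : \int[mu]_(x in D) ((c * f x + g x) ^+ 2) =
    \int[mu]_(x in D) (c ^+ 2 * f x ^+ 2 + 2 * c * (f x * g x) + g x ^+ 2).
  by apply: eq_Rintegral => x _; exact: e.
by rewrite RintegralD// RintegralD// !RintegralZl.
Qed.

Lemma l2_ip_lin c f g h : l2 f -> l2 g -> l2 h ->
  \int[mu]_(x in D) ((c * f x + g x) * h x) =
  c * \int[mu]_(x in D) (f x * h x) + \int[mu]_(x in D) (g x * h x).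
Proof.
move=> lf lg lh; have i1 := l2_mul lf lh; have i2 := l2_mul lg lh.
have ic : mu.-integrable D (EFin \o (fun x => c * (f x * h x))) by exact: (integrableZl mD _ i1).
by rewrite -RintegralZl// -RintegralD//; apply: eq_Rintegral => x _; ring.
Qed.

Lemma cauchy_schwarz f g : l2 f -> l2 g ->
  (\int[mu]_(x in D) (f x * g x)) ^+ 2 <=
  \int[mu]_(x in D) (f x ^+ 2) * \int[mu]_(x in D) (g x ^+ 2).
Proof.
move=> lf lg.
have pos t : 0 <= t ^+ 2 * \int[mu]_(x in D) (f x ^+ 2) +
    2 * t * \int[mu]_(x in D) (f x * g x) + \int[mu]_(x in D) (g x ^+ 2).
  by rewrite -(l2_lin t lf lg).2; apply: Rintegral_ge0 => x _; exact: sqr_ge0.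
have A0 : 0 <= \int[mu]_(x in D) (f x ^+ 2) by apply: Rintegral_ge0 => x _; exact: sqr_ge0.
move: pos A0.
move: (\int[mu]_(x in D) (f x ^+ 2)) (\int[mu]_(x in D) (f x * g x)) (\int[mu]_(x in D) (g x ^+ 2)).
move=> a i b pos a0.
have [a1|a1] := eqVneq a 0.
  have [->|i0] := eqVneq i 0; first by rewrite a1 mul0r expr0n.
  have := pos (- (b + 1) / (2 * i)); rewrite a1 mulr0 add0r.
  have -> : 2 * (- (b + 1) / (2 * i)) * i + b = -1 by field.
  lra.
have ap : 0 < a by rewrite lt_neqAle eq_sym a1.
have := pos (- i / a).
have -> : (- i / a) ^+ 2 * a + 2 * (- i / a) * i + b = (a * b - i ^+ 2) / a by field.
by rewrite pmulr_lge0 ?invr_gt0// subr_ge0.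
Qed.

End SquareIntegrable.

Section FractionalSobolev.
Context {R : realType}.
Local Notation mu := (@lebesgue_measure R).
Local Notation mu2 := (mu \x mu)%E.
Implicit Types (f g w z : R -> R) (A : set (R * R)) (e : R).
Local Notation I01 := (`]0%R, 1%R[%classic : set R).

Let l2a f := @l2 _ (measurableTypeR R) R mu I01 f.
Let l2b A f := @l2 _ (measurableTypeR R * measurableTypeR R)%type R mu2 A (dq f).

Let mI : measurable I01. Proof. exact: measurable_itv. Qed.

Lemma l2a_mul f g : l2a f -> l2a g -> mu.-integrable I01 (EFin \o (fun x => f x * g x)).
Proof. exact: (@l2_mul _ (measurableTypeR R) R mu I01 mI f g). Qed.

Lemma l2a_lin c f g : l2a f -> l2a g -> l2a (fun x => c * f x + g x).
Proof. by move=> lf lg; have [] := @l2_lin _ (measurableTypeR R) R mu I01 mI c f g lf lg. Qed.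

Lemma l2b_mul A f g : measurable A -> l2b A f -> l2b A g ->
  mu2.-integrable A (EFin \o (fun p => dq f p * dq g p)).
Proof.
by move=> mA; exact: (@l2_mul _ (measurableTypeR R * measurableTypeR R)%type R mu2 A mA (dq f) (dq g)).
Qed.

Definition ipa f g := \int[mu]_(x in I01) (f x * g x).
Definition ipb A f g := \int[mu2]_(z in A) (dq f z * dq g z).
Definition ip f g := ipa f g + ipb (box 1) f g.

Lemma unit_measure : mu I01 = 1%E.
Proof. by rewrite lebesgue_measure_itv/= lte_fin ltr01 oppr0 adde0. Qed.

Lemma sqL2E f : sqL2 f = (\int[mu]_(x in I01) (f x ^+ 2)%:E)%E.
Proof. by apply: eq_integral => x _; rewrite real_normK ?num_real. Qed.

Lemma H12P f : H12 f <-> [/\ measurable_fun I01 f, l2a f & l2b (box 1) f].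
Proof.
have e := sqL2E f.
split=> [[mf lf gf]|[mf [_ lf] [_ gf]]].
  split => //; first by split; rewrite -?e.
  by split; [exact: measurable_dq|rewrite -[X in (X < _)%E]gagliardoE].
by split; rewrite ?e// gagliardoE.
Qed.

Lemma l2b_sub A f : measurable A -> A `<=` box 1 -> H12 f -> l2b A f.
Proof.
move=> mA Ab /H12P[mf _ [md lt]]; split; first by apply: (measurable_funS _ Ab md); exact: measurable_box.
apply: le_lt_trans lt; apply: ge0_subset_integral => //.
- exact: measurable_box.
- by exact: measurable_sqrE.
- by move=> z _; rewrite lee_fin sqr_ge0.
Qed.

Lemma H12_ipa f : H12 f -> (ipa f f)%:E = sqL2 f.
Proof.
move=> hf; rewrite sqL2E /ipa /Rintegral fineK.
  by apply: eq_integral => x _; rewrite expr2.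
have /H12P[_ lf _] := hf; apply: (@integrable_fin_num _ _ _ mu) => //.
exact: l2a_mul.
Qed.

Lemma H12_ipb f : H12 f -> (ipb (box 1) f f)%:E = gagliardo 1 f.
Proof.
move=> hf; have /H12P[mf _ lf] := hf; rewrite gagliardoE// /ipb /Rintegral fineK.
  by apply: eq_integral => x _; rewrite expr2.
apply: (@integrable_fin_num _ _ _ mu2); first exact: measurable_box.
exact: (l2b_mul (measurable_box 1) lf lf).
Qed.

Lemma dq_lin c f g : dq (fun x => c * f x + g x) = (fun p : R * R => c * dq f p + dq g p).
Proof. by apply/funext => p; rewrite /dq; ring. Qed.

Lemma H12_lin c f g : H12 f -> H12 g -> H12 (fun x => c * f x + g x).
Proof.
move=> /H12P[mf laf lbf] /H12P[mg lag lbg]; apply/H12P; split.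
- by apply: measurable_funD => //; exact: measurable_funM.
- exact: l2a_lin.
- rewrite /l2b dq_lin.
  by have [] := @l2_lin _ (measurableTypeR R * measurableTypeR R)%type R mu2 _ (measurable_box 1) c _ _ lbf lbg.
Qed.

Lemma ipa_lin c f g h : H12 f -> H12 g -> H12 h ->
  ipa (fun x => c * f x + g x) h = c * ipa f h + ipa g h.
Proof.
move=> /H12P[_ lf _] /H12P[_ lg _] /H12P[_ lh _].
exact: (@l2_ip_lin _ (measurableTypeR R) R mu I01 mI c f g h lf lg lh).
Qed.

Lemma ipb_lin A c f g h : measurable A -> A `<=` box 1 -> H12 f -> H12 g -> H12 h ->
  ipb A (fun x => c * f x + g x) h = c * ipb A f h + ipb A g h.
Proof.
move=> mA Ab hf hg hh.
rewrite /ipb dq_lin.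
exact: (@l2_ip_lin _ (measurableTypeR R * measurableTypeR R)%type R mu2 A mA c (dq f) (dq g) (dq h)
  (l2b_sub mA Ab hf) (l2b_sub mA Ab hg) (l2b_sub mA Ab hh)).
Qed.

Lemma ipaC f g : ipa f g = ipa g f.
Proof. by apply: eq_Rintegral => x _; rewrite mulrC. Qed.

Lemma ipbC A f g : ipb A f g = ipb A g f.
Proof. by apply: eq_Rintegral => x _; rewrite mulrC. Qed.

Lemma ip_lin c f g h : H12 f -> H12 g -> H12 h ->
  ip (fun x => c * f x + g x) h = c * ip f h + ip g h.
Proof.
move=> hf hg hh; rewrite /ip ipa_lin// ipb_lin//; first ring.
exact: measurable_box.
Qed.

Lemma ipC f g : ip f g = ip g f. Proof. by rewrite /ip ipaC ipbC. Qed.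

Lemma ip_sq_lin c f g : H12 f -> H12 g ->
  ip (fun x => c * f x + g x) (fun x => c * f x + g x) =
  c ^+ 2 * ip f f + 2 * c * ip f g + ip g g.
Proof.
move=> hf hg; have hs := H12_lin c hf hg.
rewrite ip_lin// (ipC f (fun _ => _)) (ipC g (fun _ => _)) !ip_lin// (ipC g f); ring.
Qed.

Lemma ipb_sq_lin A c f g : measurable A -> A `<=` box 1 -> H12 f -> H12 g ->
  ipb A (fun x => c * f x + g x) (fun x => c * f x + g x) =
  c ^+ 2 * ipb A f f + 2 * c * ipb A f g + ipb A g g.
Proof.
move=> mA Ab hf hg; have hs := H12_lin c hf hg.
rewrite (ipb_lin c mA Ab hf hg hs) (ipbC _ f (fun _ => _)) (ipbC _ g (fun _ => _)).
rewrite (ipb_lin c mA Ab hf hg hf) (ipb_lin c mA Ab hf hg hg) (ipbC _ g f); ring.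
Qed.

Lemma ipa_ge0 f : 0 <= ipa f f.
Proof. by apply: Rintegral_ge0 => x _; rewrite -expr2 sqr_ge0. Qed.

Lemma ipb_ge0 A f : 0 <= ipb A f f.
Proof. by apply: Rintegral_ge0 => x _; rewrite -expr2 sqr_ge0. Qed.

Lemma ipa_cs f g : H12 f -> H12 g -> (ipa f g) ^+ 2 <= ipa f f * ipa g g.
Proof.
move=> /H12P[_ lf _] /H12P[_ lg _].
have sqE h : ipa h h = \int[mu]_(x in I01) (h x ^+ 2) by apply: eq_Rintegral => x _; rewrite expr2.
by rewrite !sqE; exact: (@cauchy_schwarz _ (measurableTypeR R) R mu I01 mI f g).
Qed.

Lemma ipb_cs A f g : measurable A -> A `<=` box 1 -> H12 f -> H12 g ->
  (ipb A f g) ^+ 2 <= ipb A f f * ipb A g g.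
Proof.
move=> mA Ab hf hg.
have sqE h : ipb A h h = \int[mu2]_(x in A) (dq h x ^+ 2) by apply: eq_Rintegral => x _; rewrite expr2.
rewrite !sqE.
exact: (@cauchy_schwarz _ (measurableTypeR R * measurableTypeR R)%type R mu2 A mA (dq f) (dq g)
  (l2b_sub mA Ab hf) (l2b_sub mA Ab hg)).
Qed.

Lemma ipb_energy A f : measurable A -> A `<=` box 1 -> H12 f ->
  (ipb A f f)%:E = energy_on A f.
Proof.
move=> mA Ab hf; rewrite /ipb /Rintegral fineK.
  by apply: eq_integral => x _; rewrite expr2.
apply: (@integrable_fin_num _ _ _ mu2) => //.
exact: (l2b_mul mA (l2b_sub mA Ab hf) (l2b_sub mA Ab hf)).
Qed.

Lemma ipb_le A f : measurable A -> A `<=` box 1 -> H12 f -> ipb A f f <= ipb (box 1) f f.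
Proof.
move=> mA Ab hf; have mb := @measurable_box R 1; rewrite -lee_fin !ipb_energy//.
have mz : measurable_fun (box 1) (fun p => (dq f p ^+ 2)%:E).
  by have [mz _ _] := hf; apply: measurable_sqrE; exact: measurable_dq.
by apply: ge0_subset_integral => // p _; rewrite lee_fin sqr_ge0.
Qed.

Lemma H12normE f : H12 f -> H12norm f = Num.sqrt (ipa f f) + Num.sqrt (ipb (box 1) f f).
Proof. by move=> hf; rewrite /H12norm -H12_ipa// -H12_ipb. Qed.

(** A bounded functional is nearly represented by any near-minimiser f of the
    quadratic functional q(f) / 2 - T f: compare the values at f and at f + t g.
    Near-minimisers exist without completeness of the space. *)
Lemma approx_riesz T e : H12_dual T -> 0 < e ->
  exists2 f, H12 f & forall g t, H12 g -> t * (T g - ip f g) <= e + t ^+ 2 * ip g g / 2.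
Proof.
move=> [Tlin [C hC]] e0.
pose J f := ip f f / 2 - T f.
have J_lb f : H12 f -> - (2 * (`|C| + 1) ^+ 2) <= J f.
  move=> hf; have := hC f hf; rewrite H12normE// => hT.
  have h1 : T f <= (`|C| + 1) * (Num.sqrt (ipa f f) + Num.sqrt (ipb (box 1) f f)).
    apply: le_trans (ler_norm _) _; apply: le_trans hT _.
    by apply: ler_wpM2r; [rewrite addr_ge0 ?sqrtr_ge0|have := ler_norm C; lra].
  rewrite /J /ip.
  have := sqr_sqrtr (ipa_ge0 f); have := sqr_sqrtr (ipb_ge0 (box 1) f).
  move: h1; move: (Num.sqrt (ipa f f)) (Num.sqrt (ipb (box 1) f f)) => p q h1 <- <-.
  set K := `|C| + 1 in h1 *.
  have := sqr_ge0 (p - K); have := sqr_ge0 (q - K); have := sqr_ge0 K; nra.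
pose E := [set J f | f in @H12 R].
have H0 : @H12 R (cst 0).
  have s0 : forall x : R, (`|0 : R| ^+ 2)%:E = 0%E by move=> _; rewrite normr0 expr0n.
  split; first exact: measurable_cst.
  - rewrite /sqL2; under eq_integral do rewrite /cst normr0 expr0n/=.
    by rewrite integral0 ltry.
  - rewrite /gagliardo; under eq_integral do under eq_integral do rewrite /cst subrr normr0 expr0n/= mul0r.
    under eq_integral do rewrite integral0.
    by rewrite integral0 ltry.
have hE : has_inf E.
  split; first by exists (J (cst 0)); exists (cst 0).
  by exists (- (2 * (`|C| + 1) ^+ 2)) => _ [f hf <-]; exact: J_lb.
have [_ [f hf <-] Jf] := inf_adherent e0 hE.
exists f => // g t hg.
have Jtg : inf E <= J (fun x => t * g x + f x).
  have EJ : E (J (fun x => t * g x + f x)).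
    exists (fun x => t * g x + f x); last reflexivity.
    exact: H12_lin.
  exact: (inf_lbound hE.2 EJ).
move: Jtg; rewrite {1}/J ip_sq_lin// Tlin// (ipC g f) => Jtg.
move: Jf; rewrite /J => Jf; lra.
Qed.

End FractionalSobolev.

(** * Weak convergence from convergence in L2 *)

Section NearFar.
Context {R : realType}.
Local Notation mu := (@lebesgue_measure R).
Local Notation mu2 := (mu \x mu)%E.
Implicit Types (f g w : R -> R) (A : set (R * R)) (e : R).
Local Notation I01 := (`]0%R, 1%R[%classic : set R).

Lemma measurable_box_far l r : measurable (@box R l `&` far r).
Proof. by apply: measurableI; [exact: measurable_box|exact: measurable_far]. Qed.

Lemma measurable_box_near l r : measurable (@box R l `\` far r).
Proof. by apply: measurableD; [exact: measurable_box|exact: measurable_far]. Qed.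

Lemma le_abs_sqr (x c : R) : 0 <= c -> x ^+ 2 <= c ^+ 2 -> `|x| <= c.
Proof.
by move=> c0 h; rewrite -(@ler_pXn2r _ 2)// ?nnegrE// real_normK ?num_real.
Qed.

(** The integrand vanishes on the diagonal, so the far regions exhaust its support
    and monotone convergence applies. *)
Lemma far_exhausts f e : H12 f -> 0 < e ->
  exists k : nat, ipb (box 1) f f <= ipb (box 1 `&` far (k.+1%:R^-1)) f f + e.
Proof.
move=> hf e0; pose F k := box 1 `&` far (k.+1%:R^-1 : R).
have mF k : measurable (F k) by exact: measurable_box_far.
have Fb k : F k `<=` box 1 by exact: subIsetl.
have mdf : measurable_fun (box 1) (fun z => (dq f z ^+ 2)%:E).
  have [mf _ _] := hf; apply: measurable_sqrE; exact: measurable_dq.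
have ndF : nondecreasing_seq F.
  move=> i j ij; apply/subsetPset => z [bz] /= fz; split => //=; apply: le_trans fz.
  by rewrite lef_pV2 ?posrE ?ltr0Sn// ler_nat ltnS.
have h := @ge0_nondecreasing_set_cvg_integral _ (measurableTypeR R * measurableTypeR R)%type R
  F (fun z => (dq f z ^+ 2)%:E) mu2 ndF mF.
have {}h := h ltac:(by move=> i; apply: measurable_funS mdf => //; exact: measurable_box).
have {}h := h ltac:(by move=> i z _; rewrite lee_fin sqr_ge0).
have E : (\int[mu2]_(z in \bigcup_i F i) (dq f z ^+ 2)%:E = (ipb (box 1) f f)%:E)%E.
  rewrite ipb_energy//; last exact: measurable_box.
  rewrite /energy_on integral_mkcond [RHS]integral_mkcond; apply: eq_integral => z _.
  rewrite !patchE; case: ifPn => [/set_mem[k _ [bz _]]|zF]; first by rewrite mem_set.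
  case: ifPn => // /set_mem bz; rewrite /dq.
  have [->|zz] := eqVneq z.1 z.2; first by rewrite !subrr mul0r expr0n.
  exfalso; move/negP: zF; apply; rewrite inE.
  have z0 : 0 < `|z.1 - z.2| by rewrite normr_gt0 subr_eq0.
  exists (Num.truncn `|z.1 - z.2|^-1) => //; split => //=.
  by rewrite /far/= invf_ple ?posrE ?ltr0Sn// ltW// truncnS_gt.
rewrite E in h.
have : (\forall k \near \oo, ((ipb (box 1) f f - e)%:E < \int[mu2]_(z in F k) (dq f z ^+ 2)%:E)%E).
  apply: (h [set y | ((ipb (box 1) f f - e)%:E < y)%E]); apply: open_nbhs_nbhs.
  by split; [exact: open_ereal_gt_ereal|rewrite /= lte_fin; lra].
move=> [k _ hk]; exists k; have := hk k (leqnn k).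
rewrite -[X in (_ < X)%E](ipb_energy (mF k) (Fb k) hf) lte_fin.
rewrite /F; lra.
Qed.

Lemma ipb_near_far f g r : H12 f -> H12 g ->
  ipb (box 1) f g = ipb (box 1 `&` far r) f g + ipb (box 1 `\` far r) f g.
Proof.
move=> hf hg.
have mb := @measurable_box R 1.
have i := l2b_mul mb (l2b_sub mb (@subset_refl _ _) hf) (l2b_sub mb (@subset_refl _ _) hg).
rewrite /ipb {1}(_ : box 1 = (box 1 `&` far r) `|` (box 1 `\` far r)); last by rewrite setUIDK.
rewrite Rintegral_setU//.
- exact: measurable_box_far.
- exact: measurable_box_near.
- by rewrite setUIDK.
- by apply/disj_setPS => z [[_ h] [_]]; exact.
Qed.

(** From (a - b)^2 <= 2 a^2 + 2 b^2. *)
Lemma spread_le_sqL2 f : measurable_fun [set: R] f ->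
  (spread_on (box 1) f <= 4%:E * sqL2 f)%E.
Proof.
move=> mf.
have nn (z : R * R) : (0 <= ((f z.1 - f z.2) ^+ 2)%:E)%E by rewrite lee_fin sqr_ge0.
have mI : measurable I01 by exact: measurable_itv.
rewrite /spread_on /box iterated_integral//; last exact: measurable_funTS (measurable_diff2 mf).
have sqE := sqL2E f.
have mf2 : measurable_fun [set: R] (fun x => (f x ^+ 2)%:E).
  by exact: measurable_sqrE.
have mf2' : measurable_fun I01 (fun x => (f x ^+ 2)%:E) by exact: measurable_funTS.
have two : (0 <= 2%:E :> \bar R)%E by rewrite lee_fin.
have len1 : mu I01 = 1%E := unit_measure.
have inner y : (\int[mu]_(x in `]0%R, 1%R[) ((f x - f y) ^+ 2)%:E <=
    2%:E * sqL2 f + 2%:E * (f y ^+ 2)%:E)%E.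
  rewrite sqE -ge0_integralZl//; last by move=> x _; rewrite lee_fin sqr_ge0.
  have -> : (2%:E * (f y ^+ 2)%:E = \int[mu]_(x in I01) (2%:E * (f y ^+ 2)%:E))%E.
    by rewrite -EFinM integral_cst//= len1 mule1.
  rewrite -ge0_integralD//; last 3 first.
  - by move=> x _; rewrite mule_ge0// lee_fin sqr_ge0.
  - exact: measurable_funeM.
  - by move=> x _; rewrite mule_ge0// lee_fin sqr_ge0.
  apply: ge0_le_integral => //.
  - by move=> x _; rewrite lee_fin sqr_ge0.
  - apply: measurable_funTS; exact: (measurable_fun_pair1 y (measurable_diff2 mf)).
  - by apply: emeasurable_funD; [exact: measurable_funeM|exact: measurable_cst].
  - move=> x _; rewrite -!EFinM -EFinD lee_fin; have := sqr_ge0 (f x + f y); nra.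
apply: (@le_trans _ _ (\int[mu]_(y in I01) (2%:E * sqL2 f + 2%:E * (f y ^+ 2)%:E))%E).
  apply: ge0_le_integral => //.
  - by move=> y _; apply: integral_ge0 => x _; rewrite lee_fin sqr_ge0.
  - apply: (measurable_iterated mI mI (f := fun z => ((f z.1 - f z.2) ^+ 2)%:E)) => //.
    exact: measurable_funTS (measurable_diff2 mf).
  - by apply: emeasurable_funD; [exact: measurable_cst|exact: measurable_funeM].
  - by move=> y _; exact: inner.
have S0 : (0 <= 2%:E * sqL2 f)%E.
  by rewrite mule_ge0// sqE; apply: integral_ge0 => x _; rewrite lee_fin sqr_ge0.
rewrite ge0_integralD//.
- rewrite integral_cst//= len1 mule1 ge0_integralZl//; last by move=> x _; rewrite lee_fin sqr_ge0.
  rewrite -sqE -ge0_muleDl// -EFinD.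
  by rewrite (_ : (2 + 2 = 4 :> R))//; lra.
- by move=> y _; rewrite mule_ge0// lee_fin sqr_ge0.
- exact: measurable_funeM.
Qed.

Lemma eq_energy_on A f g : A `<=` box 1 -> {in `]0, 1[, f =1 g} ->
  energy_on A f = energy_on A g.
Proof.
move=> Ab fg; apply: eq_integral => -[x y] /set_mem /Ab[/= hx hy].
by rewrite /dq/= !fg.
Qed.

Lemma far_le_spread r f : 0 < r -> measurable_fun [set: R] f ->
  (energy_on (box 1 `&` far r) f <= (r ^- 2)%:E * spread_on (box 1) f)%E.
Proof.
move=> r0 mf; rewrite /spread_on -ge0_integralZl//; last 4 first.
- exact: measurable_box.
- by apply: measurable_funTS; exact: measurable_diff2.
- by move=> z _; rewrite lee_fin sqr_ge0.
- by rewrite lee_fin invr_ge0 sqr_ge0.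
apply: (@le_trans _ _ (\int[mu2]_(z in box 1 `&` far r) ((r ^- 2)%:E * ((f z.1 - f z.2) ^+ 2)%:E))%E).
  apply: ge0_le_integral.
  - exact: measurable_box_far.
  - by move=> z _; rewrite lee_fin sqr_ge0.
  - by apply: measurable_funTS; exact: measurable_dq2.
  - by apply: measurable_funTS; apply: measurable_funeM; exact: measurable_diff2.
  move=> z [_ /= rz]; rewrite -EFinM lee_fin /dq exprMn mulrC ler_wpM2r ?sqr_ge0//.
  have zz : 0 < (z.1 - z.2) ^+ 2.
    by rewrite exprn_even_gt0//= -normr_gt0; exact: lt_le_trans rz.
  rewrite exprVn lef_pV2; [|by rewrite posrE|by rewrite posrE exprn_gt0].
  by apply: sqr_le_norm; rewrite gtr0_norm.
apply: ge0_subset_integral.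
- exact: measurable_box_far.
- exact: measurable_box.
- by apply: measurable_funTS; apply: measurable_funeM; exact: measurable_diff2.
- by move=> z _; rewrite -EFinM lee_fin mulr_ge0 ?sqr_ge0// invr_ge0 sqr_ge0.
- exact: subIsetl.
Qed.

Lemma ipb_far_le r f : 0 < r -> H12 f -> ipb (box 1 `&` far r) f f <= 4 * r ^- 2 * ipa f f.
Proof.
move=> r0 hf; rewrite -lee_fin ipb_energy//; last exact: measurable_box_far.
have [mf _ _] := hf.
pose g := f \_ I01.
have mg : measurable_fun [set: R] g by apply/(measurable_restrictT f).
have fg : {in `]0, 1[, f =1 g} by move=> x xI; rewrite /g patchE mem_set.
rewrite (@eq_energy_on _ f g)//.
apply: le_trans (far_le_spread r0 mg) _.
apply: (@le_trans _ _ ((r ^- 2)%:E * (4%:E * sqL2 g))%E).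
  by apply: lee_wpmul2l; [rewrite lee_fin invr_ge0 sqr_ge0|exact: spread_le_sqL2].
have -> : sqL2 g = sqL2 f by apply: eq_integral => x /set_mem /= xI; rewrite fg.
by rewrite -(H12_ipa hf) -!EFinM lee_fin mulrA [4 * _]mulrC.
Qed.

(** A functional T is almost the inner product with some f. In the inner product with
    z = v - w, the L2 part and the long-range part are controlled by the L2 norm of
    z; the short-range part is small because f has little energy there and z has
    bounded energy. *)
Lemma weak_cvg_criterion {I : Type} (F : set_system I) {FF : Filter F}
    (v : I -> R -> R) w (M : R) : H12 w ->
  (\forall i \near F, H12 (v i) /\ ipb (box 1) (v i) (v i) <= M) ->
  (forall e, 0 < e -> \forall i \near F,
     ipa (fun x => -1 * w x + v i x) (fun x => -1 * w x + v i x) <= e) ->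
  H12_weak_cvg F v w.
Proof.
move=> hw hv hL; split => //; first by apply: filterS hv => i [].
move=> T dT; apply/cvgrPdist_le => e e0.
have [Tlin _] := dT.
pose M1 := 2 * `|M| + 2 * ipb (box 1) w w.
have M10 : 0 <= M1.
  by rewrite /M1 addr_ge0// mulr_ge0//; exact: ipb_ge0.
(* Applied with t = tau and t = - tau, approximate representation bounds the error
   T z - ip f z by e / 2 as soon as ip z z is at most M1 + 1. *)
pose tau := e / (2 * (M1 + 2)).
have tau0 : 0 < tau by rewrite /tau divr_gt0//; lra.
have te : 0 < tau * e / 4 by rewrite divr_gt0// mulr_gt0.
have [f hf fT] := approx_riesz dT te.
have e6 : 0 < e / 6 by lra.
have nb : 0 < (e / 6) ^+ 2 / (M1 + 1) by rewrite divr_gt0 ?exprn_gt0//; lra.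
have [k hk] := far_exhausts hf nb.
set r : R := k.+1%:R^-1 in hk.
have r0 : 0 < r by rewrite /r invr_gt0 ltr0Sn.
have bf0 := ipb_ge0 (box 1) f; have af0 := ipa_ge0 f.
have fb0 := ipb_ge0 (box 1 `&` far r) f.
have e1 : 0 < (e / 6) ^+ 2 / (ipa f f + 1) by rewrite divr_gt0 ?exprn_gt0//; lra.
have e2 : 0 < (e / 6) ^+ 2 / (ipb (box 1) f f * (4 * r ^- 2) + 1).
  rewrite divr_gt0 ?exprn_gt0//; apply: ltr_wpDl => //.
  by rewrite mulr_ge0// mulr_ge0// invr_ge0 sqr_ge0.
near=> i.
have [hvi bM] : H12 (v i) /\ ipb (box 1) (v i) (v i) <= M by near: i.
have az1 : ipa (fun x => -1 * w x + v i x) (fun x => -1 * w x + v i x) <=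
  (e / 6) ^+ 2 / (ipa f f + 1) by near: i; exact: hL.
have az2 : ipa (fun x => -1 * w x + v i x) (fun x => -1 * w x + v i x) <=
  (e / 6) ^+ 2 / (ipb (box 1) f f * (4 * r ^- 2) + 1) by near: i; exact: hL.
have az3 : ipa (fun x => -1 * w x + v i x) (fun x => -1 * w x + v i x) <= 1.
  by near: i; exact: hL.
pose z x := -1 * w x + v i x.
rewrite -/z in az1 az2 az3.
have hz : H12 z by exact: H12_lin.
have az0 := ipa_ge0 z; have bz0 := ipb_ge0 (box 1) z.
have bz : ipb (box 1) z z <= M1.
  have mb := @measurable_box R 1.
  have E : ipb (box 1) z z = ipb (box 1) w w - 2 * ipb (box 1) w (v i) + ipb (box 1) (v i) (v i).
    by rewrite /z (ipb_sq_lin _ mb (@subset_refl _ _) hw hvi); ring.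
  have P : 0 <= ipb (box 1) w w + 2 * ipb (box 1) w (v i) + ipb (box 1) (v i) (v i).
    have := ipb_ge0 (box 1) (fun x => 1 * w x + v i x).
    by rewrite (ipb_sq_lin _ mb (@subset_refl _ _) hw hvi) expr1n mul1r mulr1.
  by rewrite E /M1; have := ler_norm M; lra.
have qz : ip z z <= M1 + 1 by rewrite /ip; lra.
have Tz : T z = - T w + T (v i) by rewrite Tlin// mulN1r.
have -> : T w - T (v i) = - T z by rewrite Tz; ring.
rewrite normrN.
have h1 : `|T z - ip f z| <= e / 2.
  have ha := fT z tau hz; have hb := fT z (- tau) hz.
  have hc : tau ^+ 2 * ip z z / 2 <= tau * e / 4.
    have : tau * ip z z <= e / 2.
      have : tau * ip z z <= tau * (M1 + 2) by rewrite ler_wpM2l ?(ltW tau0)//; lra.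
      have -> : tau * (M1 + 2) = e / 2 by rewrite /tau; field; lra.
      by [].
    move=> h; have : tau * (tau * ip z z) <= tau * (e / 2) by rewrite ler_wpM2l ?(ltW tau0).
    by rewrite expr2; lra.
  have {}ha : tau * (T z - ip f z) <= tau * (e / 2) by lra.
  have {}hb : tau * - (T z - ip f z) <= tau * (e / 2) by rewrite sqrrN in hb; lra.
  rewrite !ler_pM2l// in ha hb; rewrite ler_norml; lra.
have sm (p q s : R) : 0 <= p -> 0 <= q -> p <= (e / 6) ^+ 2 / (q + 1) -> s ^+ 2 <= q * p -> `|s| <= e / 6.
  move=> p0 q0 hp hs; apply: le_abs_sqr; first lra.
  apply: le_trans hs _; apply: (@le_trans _ _ ((q + 1) * p)); first nra.
  by move: hp; rewrite ler_pdivlMr; [rewrite mulrC|lra].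
have mfar := measurable_box_far 1 r; have mnear := measurable_box_near 1 r.
have i1 : `|ipa f z| <= e / 6 by apply: (sm _ _ _ _ _ az1) => //; exact: ipa_cs.
have i2 : `|ipb (box 1 `&` far r) f z| <= e / 6.
  apply: (sm (ipa z z) (ipb (box 1) f f * (4 * r ^- 2))) => //.
    by rewrite mulr_ge0// mulr_ge0// invr_ge0 sqr_ge0.
  apply: le_trans (ipb_cs mfar (@subIsetl _ _ _) hf hz) _; rewrite -mulrA.
  apply: ler_pM => //; first exact: ipb_ge0; last exact: ipb_far_le.
  by rewrite (ipb_near_far r hf hf) lerDl; exact: ipb_ge0.
have i3 : `|ipb (box 1 `\` far r) f z| <= e / 6.
  have nf : ipb (box 1 `\` far r) f f <= (e / 6) ^+ 2 / (M1 + 1).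
    by have := ipb_near_far r hf hf; lra.
  apply: (sm _ _ _ (ipb_ge0 (box 1 `\` far r) f) M10 nf).
  apply: le_trans (ipb_cs mnear (@subDsetl _ _ _) hf hz) _; rewrite mulrC.
  apply: ler_wpM2r; first exact: ipb_ge0.
  apply: le_trans bz; rewrite (ipb_near_far r hz hz) lerDr; exact: ipb_ge0.
have -> : T z = (T z - ip f z) + (ipa f z + (ipb (box 1 `&` far r) f z + ipb (box 1 `\` far r) f z)).
  by rewrite /ip (ipb_near_far r hf hz); ring.
apply: le_trans (ler_normD _ _) _.
have := ler_normD (ipa f z) (ipb (box 1 `&` far r) f z + ipb (box 1 `\` far r) f z).
have := ler_normD (ipb (box 1 `&` far r) f z) (ipb (box 1 `\` far r) f z).
move: h1 i1 i2 i3.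
move: (ipa f z) (ipb (box 1 `&` far r) f z) (ipb (box 1 `\` far r) f z) (T z - ip f z) => p1 p2 p3 p4.
move=> *; lra.
Unshelve. all: by end_near. Qed.

End NearFar.

(** * The lower bound *)

Section Limits.
Context {R : realType}.
Local Open Scope ereal_scope.

Lemma le_limf_einf {T : choiceType} {I : filteredType T} (F : set (set I)) (u : I -> \bar R) (x : R) :
  (forall a : R, (a < x)%R -> F [set i | a%:E <= u i]) -> x%:E <= limf_einf u F.
Proof.
move=> h; rewrite limf_einfE; apply/lee_subgt0Pr => e e0.
have hx : (x - e < x)%R by lra.
apply: (@le_trans _ _ (ereal_inf (u @` [set i | (x - e)%:E <= u i]))).
  by apply: le_ereal_inf_tmp => _ [i /= hi <-]; rewrite -EFinB.
apply: ereal_sup_ubound; exists [set i | (x - e)%:E <= u i] => //.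
exact: h.
Qed.

Lemma limf_esup_le {T : choiceType} {I : filteredType T} (F : set (set I)) (u : I -> \bar R) (x : R) :
  (forall e : R, (0 < e)%R -> F [set i | u i <= (x + e)%:E]) -> limf_esup u F <= x%:E.
Proof.
move=> h; rewrite limf_esupE; apply/lee_addgt0Pr => e e0.
apply: (@le_trans _ _ (ereal_sup (u @` [set i | u i <= (x + e)%:E]))).
  apply: ereal_inf_lbound; exists [set i | u i <= (x + e)%:E] => //.
  exact: h.
by apply: ge_ereal_sup => _ [i /= hi <-]; rewrite -EFinD.
Qed.

End Limits.

Section LowerBound.
Context {R : realType} (lam Lam delta : R).
Hypotheses (lam_gt0 : 0 < lam) (le_lam_Lam : lam <= Lam) (delta_gt0 : 0 < delta).
Local Notation mu := (@lebesgue_measure R).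
Local Notation profile := (profile lam Lam delta).
Local Notation rescaled := (rescaled lam Lam delta).
Local Notation c_ := (c_ lam Lam delta).
Local Notation I01 := (`]0%R, 1%R[%classic : set R).
Implicit Types (l x k : R) (v w p : R -> R) (X : seq R) (A : set (R * R)).

Definition scaled_profile l X k x : R := rescale l (profile X) x + k.

Lemma measurable_scaled_profile l X k : spaced delta X ->
  measurable_fun [set: R] (scaled_profile l X k).
Proof.
move=> sX; apply: measurable_funD => //; apply: measurable_rescale.
by have := measurable_profile lam_gt0 le_lam_Lam delta_gt0 sX; exact.
Qed.

Lemma rescaled_scaled_profile l v : 0 < l -> rescaled l v ->
  measurable_fun I01 v /\ exists2 X, spaced delta X &
    exists k, {ae mu, forall x, x \in `]0, 1[ -> v x = scaled_profile l X k x}.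
Proof.
move=> l0 [u du hv]; have [X AX [k hk]] := displacement_profile lam_gt0 le_lam_Lam delta_gt0 l0 du.
have [sX _] := (AD_spaced lam_gt0 le_lam_Lam delta_gt0 l X).1 AX.
have dil x : x \in `]0, 1[ -> l * x \in `]0, l[.
  rewrite !in_itv/= => /andP[x0 x1]; rewrite mulr_gt0//=.
  by rewrite -[ltRHS]mulr1 ltr_pM2l.
have ml : measurable_fun [set: R] (fun x : R => l * x) by exact: measurable_funM.
split.
  apply: (@eq_measurable_fun _ _ _ _ I01 (fun x => u (l * x) / Num.sqrt l)).
    by move=> x /set_mem xI; rewrite hv.
  apply: measurable_funM => //.
  have [_ _ [[[mf _] _] _]] := du.
  apply: (measurable_comp (F := `]0, l[%classic) (g := fun x => l * x) _ _ mf) => //.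
    by move=> _ [x xI <-]; exact: dil.
  exact: measurable_funTS.
exists X => //; exists (k / Num.sqrt l); have [N [mN N0 sN]] := hk.
have mlN : measurable ((fun x : R => l * x) @^-1` N).
  by rewrite -[X in measurable X]setTI; exact: ml.
exists ((fun x => l * x) @^-1` N); split => //.
  apply/eqP; rewrite eq_le measure_ge0 andbT.
  have l0' : 0 < l^-1 by rewrite invr_gt0.
  have := @preimage_measure_le R l^-1 (fun x => l * x) l0' ml _ N mN.
  rewrite N0 mule0; apply => x y.
  by rewrite -mulrBr normrM gtr0_norm// mulKf// gt_eqF.
move=> x /= nx; apply: (sN (l * x)) => /= h; apply: nx => xI.
by rewrite hv// h ?dil// /scaled_profile /rescale mulrDl.
Qed.

Lemma energy_on_scaled_profile A l X k : 0 < l -> measurable A -> spaced delta X ->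
  energy_on A (scaled_profile l X k) = ((l^-1)%:E * energy_on A (fun x => profile X (l * x)))%E.
Proof.
move=> l0 mA sX; rewrite energy_on_addc energy_rescaleE//.
by have := measurable_profile lam_gt0 le_lam_Lam delta_gt0 sX; exact.
Qed.

Lemma box_dilate l : 0 < l -> [set z : R * R | box l (l * z.1, l * z.2)] = box 1.
Proof.
move=> l0.
have E x : (l * x \in `]0, l[) = (x \in `]0, 1[).
  by rewrite !in_itv/= pmulr_rgt0// -{2}[l]mulr1 ltr_pM2l.
by apply/seteqP; split => -[x y]; rewrite /box/= !E.
Qed.

Lemma box_far_dilate l (r : R) : 0 < l ->
  [set z : R * R | (box l `&` far (r * l)) (l * z.1, l * z.2)] = box 1 `&` far r.
Proof.
move=> l0; rewrite -(box_dilate l0); apply/seteqP; split => -[x y] [/= bz]; rewrite /far/= => hz;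
  split => //=.
  by move: hz; rewrite -mulrBr normrM (gtr0_norm l0) mulrC ler_pM2l.
by rewrite -mulrBr normrM (gtr0_norm l0) mulrC ler_pM2l.
Qed.

Lemma gagliardo_dilate l X : 0 < l -> spaced delta X ->
  energy_on (box 1) (fun x => profile X (l * x)) = energy_on (box l) (profile X).
Proof.
move=> l0 sX; have mp := measurable_profile lam_gt0 le_lam_Lam delta_gt0 sX.
have mpl : measurable_fun [set: R] (fun x => profile X (l * x)).
  by apply: (measurableT_comp mp); exact: measurable_funM.
apply/eqP; rewrite eq_le; apply/andP; split.
  by have := energy_on_dilate l0 (@measurable_box R l) mp; rewrite box_dilate.
have l0' : 0 < l^-1 by rewrite invr_gt0.
have := energy_on_dilate l0' (@measurable_box R 1) mpl.
rewrite (_ : (fun x => profile X (l * (l^-1 * x))) = profile X); last first.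
  by apply/funext => x; rewrite mulVKf// gt_eqF.
rewrite -(box_dilate l0).
rewrite (_ : [set z | [set z0 | box l (l * z0.1, l * z0.2)] (l^-1 * z.1, l^-1 * z.2)] = box l)//.
by apply/seteqP; split => -[x y]; rewrite /= !mulVKf ?gt_eqF.
Qed.

(** The n + 1 blocks have length 1 / (n + 1) in the rescaled picture, and distances at
    least that length are never internal to a block. *)
Lemma scaled_blocks l X k (n : nat) : 0 < l -> spaced delta X ->
  (c_ (l / n.+1%:R) + energy_on (box 1 `&` far (n.+1%:R^-1)) (scaled_profile l X k) <=
   energy_on (box 1) (scaled_profile l X k))%E.
Proof.
move=> l0 sX; have mp := measurable_profile lam_gt0 le_lam_Lam delta_gt0 sX.
have mf := measurable_box_far 1 (n.+1%:R^-1 : R).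
rewrite !energy_on_scaled_profile//; last exact: measurable_box.
rewrite gagliardo_dilate//.
have n0 : 0 < n.+1%:R :> R by rewrite ltr0Sn.
have L0 : 0 < l / n.+1%:R by rewrite divr_gt0.
have nL : n.+1%:R * (l / n.+1%:R) = l by rewrite mulrC divfK ?gt_eqF.
have := @energy_blocks_c R lam Lam delta lam_gt0 le_lam_Lam delta_gt0 (l / n.+1%:R) l n.+1 X L0.
rewrite nL => /(_ (lexx _) sX) h.
have c0 := @c_ge0 R lam Lam delta _ L0.
have far_sub : (energy_on (box 1 `&` far (n.+1%:R^-1)) (fun x => profile X (l * x)) <=
    energy_on (box l `&` far (l / n.+1%:R)) (profile X))%E.
  have := energy_on_dilate l0 (measurable_box_far l (l / n.+1%:R)) mp.
  by rewrite [l / _]mulrC box_far_dilate.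
have E : c_ (l / n.+1%:R) = ((l^-1)%:E * (l%:E * c_ (l / n.+1%:R)))%E.
  by rewrite muleA -EFinM mulVf ?gt_eqF// mul1e.
rewrite E -ge0_muleDr//.
- apply: lee_wpmul2l; first by rewrite lee_fin invr_ge0 ltW.
  by apply: le_trans h; apply: leeD2l.
- by apply: mule_ge0 => //; rewrite lee_fin ltW.
- exact: energy_on_ge0.
Qed.

Lemma H12_ae v p : H12 v -> measurable_fun I01 p ->
  {ae mu, forall x, x \in `]0, 1[ -> v x = p x} -> H12 p.
Proof.
move=> [mv sv gv] mp vp; split; [exact: mp| |by rewrite -(gagliardo_ae mv mp vp)].
rewrite (_ : sqL2 p = sqL2 v)//; apply: ge0_ae_eq_integral => //.
- by apply: measurable_sqrE; apply: (measurableT_comp (@normr_measurable R setT)).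
- by apply: measurable_sqrE; apply: (measurableT_comp (@normr_measurable R setT)).
have [N [mN N0 sN]] := vp; exists N; split => // x /= nx; apply: (sN x) => /= h; apply: nx => xI.
by rewrite h.
Qed.

(** The difference v - p has zero energy, and the Cauchy-Schwarz inequality does the
    rest. *)
Lemma ipb_ae A v p w : measurable A -> A `<=` box 1 -> H12 v -> H12 p -> H12 w ->
  {ae mu, forall x, x \in `]0, 1[ -> v x = p x} -> ipb A v w = ipb A p w.
Proof.
move=> mA Ab hv hp hw vp.
have hz := H12_lin (-1) hv hp.
have z0 : ipb (box 1) (fun x => -1 * v x + p x) (fun x => -1 * v x + p x) = 0.
  apply: EFin_inj; rewrite H12_ipb//.
  rewrite (@gagliardo_ae _ 1 _ (cst 0)).
  - by rewrite /gagliardo; under eq_integral do under eq_integral do rewrite /cst subrr normr0 expr0n/= mul0r;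
    under eq_integral do rewrite integral0; rewrite integral0.
  - by have [] := hz.
  - exact: measurable_cst.
  - by apply: ae_imply vp => x h xI; rewrite h//=; ring.
have : (ipb A (fun x => -1 * v x + p x) w) ^+ 2 <= 0 ^+ 2.
  apply: le_trans (ipb_cs mA Ab hz hw) _.
  suff -> : ipb A (fun x => -1 * v x + p x) (fun x => -1 * v x + p x) = 0 by rewrite mul0r expr0n.
  by apply/eqP; rewrite eq_le ipb_ge0 andbT -z0; exact: ipb_le.
move=> /(le_abs_sqr (lexx 0)); rewrite normr_le0 ipb_lin// => /eqP; lra.
Qed.

(** The linearisation at w of the energy on A: weak convergence is tested against it. *)
Lemma ipb_dual A w : measurable A -> A `<=` box 1 -> H12 w -> H12_dual (fun f => ipb A f w).
Proof.
move=> mA Ab hw; split; first by move=> a f g hf hg; exact: ipb_lin.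
exists (Num.sqrt (ipb A w w)) => f hf; rewrite H12normE//.
apply: (@le_trans _ _ (Num.sqrt (ipb A w w) * Num.sqrt (ipb (box 1) f f))).
  apply: le_abs_sqr; first by rewrite mulr_ge0 ?sqrtr_ge0.
  rewrite exprMn !sqr_sqrtr ?ipb_ge0//; apply: le_trans (ipb_cs mA Ab hf hw) _.
  by rewrite mulrC; apply: ler_wpM2l; [exact: ipb_ge0|exact: ipb_le].
by apply: ler_wpM2l; rewrite ?sqrtr_ge0// lerDr sqrtr_ge0.
Qed.

(** The energy on the far region A satisfies q(p) >= 2 b(p, w) - q(w), and b(p, w) tends
    to q(w) by weak convergence. The filter is arbitrary, so as to cover both the
    continuous parameter and sequences. *)
Lemma liminf_bound {I : Type} (F : set_system I) {FF : Filter F} (l_ : I -> R)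
    (v : I -> R -> R) w (cs a : R) :
  (forall e, 0 < e -> exists2 L0, 0 < L0 & forall l, L0 <= l -> ((cs - e)%:E <= c_ l)%E) ->
  (\forall i \near F, rescaled (l_ i) (v i)) -> l_ @ F --> +oo ->
  H12_weak_cvg F v w -> a < ipb (box 1) w w + cs ->
  \forall i \near F, (a%:E <= gagliardo 1 (v i))%E.
Proof.
move=> hc hres hl [hv hw hT] ha.
pose e := (ipb (box 1) w w + cs - a) / 4.
have e0 : 0 < e by rewrite /e; lra.
have [n hn] := far_exhausts hw e0.
set A := box 1 `&` far (n.+1%:R^-1) in hn.
have mA : measurable A by exact: measurable_box_far.
have Ab : A `<=` box 1 by exact: subIsetl.
have [L0 L00 hL0] := hc e e0.
have n0 : 0 < n.+1%:R :> R by rewrite ltr0Sn.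
have hB : \forall i \near F, `|ipb A w w - ipb A (v i) w| <= e.
  by have /cvgrPdist_le := hT _ (ipb_dual mA Ab hw); apply.
have hlL : \forall i \near F, L0 * n.+1%:R <= l_ i.
  by move/cvgryPge : hl; apply.
near=> i.
have ri : rescaled (l_ i) (v i) by near: i.
have li : L0 * n.+1%:R <= l_ i by near: i.
have hvi : H12 (v i) by near: i.
have hBi : `|ipb A w w - ipb A (v i) w| <= e by near: i.
have l0 : 0 < l_ i by apply: lt_le_trans li; rewrite mulr_gt0.
have [mv [X sX [k vp]]] := rescaled_scaled_profile l0 ri.
have mp := measurable_scaled_profile (l_ i) k sX.
set p := scaled_profile (l_ i) X k in vp mp.
have mpI : measurable_fun I01 p by exact: measurable_funTS.
have hp := H12_ae hvi mpI vp.
rewrite (gagliardo_ae mv mpI vp) gagliardoE//.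
apply: le_trans (scaled_blocks k n l0 sX); rewrite -/A -/p -ipb_energy//.
have cl : ((cs - e)%:E <= c_ (l_ i / n.+1%:R))%E by apply: hL0; rewrite ler_pdivlMr.
apply: le_trans (leeD2r _ cl); rewrite -EFinD lee_fin.
rewrite (ipb_ae mA Ab hvi hp hw vp) in hBi.
have := ipb_ge0 A (fun x => -1 * w x + p x).
rewrite (ipb_sq_lin _ mA Ab hw hp) (ipbC A w p).
move: hBi hn; rewrite /e ler_norml.
move: (ipb A p w) (ipb A p p) (ipb A w w) (ipb (box 1) w w) => b1 b2 b3 b4 /andP[h1 h2] h3 h4; lra.
Unshelve. all: by end_near. Qed.

End LowerBound.

(** * Approximation by Lipschitz functions *)

Section PlaneMeasure.
Context {R : realType}.
Local Notation mu := (@lebesgue_measure R).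

(** A named copy of the product measure, which carries the sigma-finiteness needed to
    exchange the average over windows with the double integral. *)
Definition plane_measure : set (measurableTypeR R * measurableTypeR R) -> \bar R := (mu \x mu)%E.

HB.instance Definition _ := Measure.on plane_measure.

Lemma plane_sigma_finite : sigma_finite setT plane_measure.
Proof.
pose J (n : nat) : set (measurableTypeR R) := `]- n%:R, n%:R[%classic.
have mJ n : measurable (J n) by exact: measurable_itv.
exists (fun n => J n `*` J n).
  apply/esym/seteqP; split => // -[x y] _.
  have Jn (z : R) (n : nat) : ((Num.truncn `|z|).+1 <= n)%N -> J n z.
    move=> zn; rewrite /J/= in_itv/= -ltr_norml.
    apply: lt_le_trans (truncnS_gt _) _; by rewrite ler_nat.
  exists (maxn (Num.truncn `|x|).+1 (Num.truncn `|y|).+1) => //.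
  by split; apply: Jn; rewrite ?leq_maxl ?leq_maxr.
move=> n; split; first exact: measurableX.
rewrite /plane_measure product_measure1E//.
by rewrite lte_mul_pinfty// ?ge0_fin_numE//= lebesgue_measure_itv/=; case: ifP; rewrite ?ltry.
Qed.

HB.instance Definition _ := Measure_isSigmaFinite.Build _ _ _ plane_measure plane_sigma_finite.

End PlaneMeasure.

Section Mollification.
Context {R : realType}.
Local Notation mu := (@lebesgue_measure R).
Local Notation mu2 := (mu \x mu)%E.
Local Notation I01 := (`]0%R, 1%R[%classic : set R).
Implicit Types (w f : R -> R) (h M K x y s a b : R).

Lemma integral_sqr_le f (c : R) : measurable_fun I01 f ->
  (forall x, 0 < x -> x < 1 -> f x ^+ 2 <= c) -> (\int[mu]_(x in I01) (f x ^+ 2)%:E <= c%:E)%E.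
Proof.
move=> mf fc; have mI : measurable I01 by exact: measurable_itv.
apply: (@le_trans _ _ (\int[mu]_(x in I01) c%:E)%E).
  have c0 : 0 <= c by apply: le_trans (sqr_ge0 _) (fc 2^-1 _ _); lra.
  apply: ge0_le_integral => //.
  - by move=> x _; rewrite lee_fin sqr_ge0.
  - exact: measurable_sqrE.
  - by move=> x; rewrite /= in_itv/= lee_fin => /andP[]; exact: fc.
by rewrite integral_cst// [X in (_ * X)%E](_ : _ = 1%E) ?mule1//; exact: unit_measure.
Qed.

Lemma sqr_dist_triangle f (g k : R -> R) a b :
  measurable_fun I01 f -> measurable_fun I01 g -> measurable_fun I01 k ->
  (\int[mu]_(x in I01) ((f x - g x) ^+ 2)%:E <= a%:E)%E ->
  (\int[mu]_(x in I01) ((g x - k x) ^+ 2)%:E <= b%:E)%E ->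
  (\int[mu]_(x in I01) ((f x - k x) ^+ 2)%:E <= (2 * (a + b))%:E)%E.
Proof.
move=> mf mg mk fg gh; have mI : measurable I01 by exact: measurable_itv.
have m1 : measurable_fun I01 (fun x => ((f x - g x) ^+ 2)%:E).
  by apply: measurable_sqrE; exact: measurable_funB.
have m2 : measurable_fun I01 (fun x => ((g x - k x) ^+ 2)%:E).
  by apply: measurable_sqrE; exact: measurable_funB.
apply: (@le_trans _ _ (\int[mu]_(x in I01) (2%:E * ((f x - g x) ^+ 2)%:E +
    2%:E * ((g x - k x) ^+ 2)%:E))%E).
  apply: ge0_le_integral => //.
  - by move=> x _; rewrite lee_fin sqr_ge0.
  - by apply: measurable_sqrE; exact: measurable_funB.
  - by apply: emeasurable_funD; exact: measurable_funeM.
  move=> x _; rewrite -!EFinM -EFinD lee_fin.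
  have := @young_sq R (f x - g x) (g x - k x) 1 ltr01.
  rewrite invr1 addrA subrK; lra.
rewrite ge0_integralD//; last 4 first.
- by move=> x _; rewrite -EFinM lee_fin mulr_ge0// sqr_ge0.
- exact: measurable_funeM.
- by move=> x _; rewrite -EFinM lee_fin mulr_ge0// sqr_ge0.
- exact: measurable_funeM.
rewrite !ge0_integralZl//; try by move=> x _; rewrite lee_fin sqr_ge0.
rewrite mulrDr [leRHS](_ : _ = 2%:E * a%:E + 2%:E * b%:E)%E//.
by apply: leeD; exact: lee_wpmul2l.
Qed.

Lemma bounded_l2 f M : measurable_fun [set: R] f -> (forall x, `|f x| <= M) ->
  @l2 _ (measurableTypeR R) R mu I01 f.
Proof.
move=> mf fM; split; first exact: measurable_funTS.
have M0 : 0 <= M by exact: le_trans (fM 0).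
have mf2 : measurable_fun [set: R] (fun x => f x ^+ 2) by exact: measurable_funX.
have f2M x : `|f x ^+ 2| <= M ^+ 2 by rewrite normrX; exact: lerXn2r.
have /integrableP[_] := bounded_integrable 1 mf2 f2M.
rewrite (_ : \int[mu]_(x in I01) (f x ^+ 2)%:E =
  \int[mu]_(x in I01) `|(EFin \o (fun x0 => (f x0 ^+ 2)%R)) x|)%E//.
by apply: eq_integral => x _; rewrite /= ger0_norm ?sqr_ge0.
Qed.

Lemma l2_integral f : @l2 _ (measurableTypeR R) R mu I01 f ->
  (\int[mu]_(s in I01) (f s ^+ 2))%:E = (\int[mu]_(s in I01) (f s ^+ 2)%:E)%E.
Proof.
move=> [_ lf]; rewrite /Rintegral fineK// ge0_fin_numE//.
by apply: integral_ge0 => x _; rewrite lee_fin sqr_ge0.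
Qed.

(** The Cauchy-Schwarz inequality against the constant 1. *)
Lemma jensen_sq f M : measurable_fun [set: R] f -> (forall x, `|f x| <= M) ->
  (((\int[mu]_(s in I01) f s) ^+ 2)%:E <= \int[mu]_(s in I01) (f s ^+ 2)%:E)%E.
Proof.
move=> mf fM; have lf := bounded_l2 mf fM.
have l1 : @l2 _ (measurableTypeR R) R mu I01 (cst 1).
  by apply: (@bounded_l2 _ 1) => // x; rewrite normr1.
rewrite -l2_integral// lee_fin.
have := @cauchy_schwarz _ (measurableTypeR R) R mu I01 (measurable_itv _) _ _ lf l1.
have -> : \int[mu]_(x in I01) (f x * cst 1 x) = \int[mu]_(x in I01) f x.
  by apply: eq_Rintegral => x _; rewrite /= mulr1.
have -> : \int[mu]_(x in I01) (cst 1 x ^+ 2) = 1.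
  have -> : \int[mu]_(x in I01) (cst 1 x ^+ 2) = \int[mu]_(x in I01) (cst 1 x : R).
    by apply: eq_Rintegral => x _; rewrite /= expr1n.
  by rewrite Rintegral_cst// (_ : fine _ = 1) ?mulr1// (congr1 fine unit_measure).
by rewrite mulr1.
Qed.

(** The window of length h slides with x and stays inside the unit interval. For each
    s, the point of the window with parameter s is an affine function of x that maps
    the unit interval into itself. *)
Definition mollify h w x : R := \int[mu]_(s in I01) w ((1 - h) * x + h * s).

Section Fixed.
Variables (h M : R) (w : R -> R).
Hypotheses (h0 : 0 < h) (h1 : h < 1) (mw : measurable_fun [set: R] w) (wM : forall x, `|w x| <= M).

Let M0 : 0 <= M. Proof. exact: le_trans (wM 0). Qed.
Let K0 : 0 < h^-1. Proof. by rewrite invr_gt0. Qed.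

Let mA x : measurable_fun [set: R] (fun s => (1 - h) * x + h * s).
Proof. by apply: measurable_funD => //; exact: measurable_funM. Qed.

Let mwA x : measurable_fun [set: R] (fun s => w ((1 - h) * x + h * s)).
Proof. exact: (measurableT_comp mw). Qed.

Let KA x s t : `|s - t| <= h^-1 * `|((1 - h) * x + h * s) - ((1 - h) * x + h * t)|.
Proof.
have -> : (1 - h) * x + h * s - ((1 - h) * x + h * t) = h * (s - t) by ring.
by rewrite normrM (gtr0_norm h0) mulrA mulVf ?mul1r// gt_eqF.
Qed.

(* Adding M makes the integrand nonnegative, so that the average over a shifted window
   is at most the one over a larger window. *)
Let f a s := w (a + h * s) + M.
Let f0 a s : 0 <= f a s.
Proof. by have := wM (a + h * s); rewrite /f ler_norml => /andP[? _]; lra. Qed.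
Let fM a s : f a s <= 2 * M.
Proof. by have := wM (a + h * s); rewrite /f ler_norml => /andP[_ ?]; lra. Qed.
Let mf a : measurable_fun [set: R] (f a).
Proof.
apply: measurable_funD => //; apply: (measurableT_comp mw).
by apply: measurable_funD => //; exact: measurable_funM.
Qed.
Let mfE a : measurable_fun [set: R] (EFin \o f a). Proof. exact/measurable_EFinP. Qed.

Let average_shift a b :
  (\int[mu]_(s in I01) (f b s)%:E <= \int[mu]_(s in I01) (f a s)%:E + (4 * M * (`|b - a| / h))%:E)%E.
Proof.
pose t := (b - a) / h; pose E : set R := `]- `|t|, 1 + `|t|[%classic.
have ft s : f b s = f a (s + t).
  by rewrite /f; congr (w _ + _); rewrite /t mulrDr [h * (_ / _)]mulrC divfK ?gt_eqF//; ring.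
have mt : measurable_fun [set: R] (fun s : R => s + t) by exact: measurable_funD.
have mfbt : measurable_fun [set: R] (fun s => (f a (s + t))%:E).
  exact: (measurableT_comp (mfE a) mt).
have mE : measurable E by exact: measurable_itv.
have Kt (x y : R) : `|x - y| <= 1 * `|(x + t) - (y + t)|.
  by rewrite mul1r opprD addrACA subrr addr0.
have H := @integral_comp_le R 1 (fun s => s + t) ltr01 mt Kt E _ mE (mfE a) (fun x => f0 a x).
have IE : I01 `<=` E.
  move=> s; rewrite /E/= !in_itv/= => /andP[s0 s1]; have := normr_ge0 t.
  by move=> ?; apply/andP; split; lra.
have tE s : I01 s -> E (s + t).
  rewrite /E/= !in_itv/= => /andP[s0 s1]; have := ler_norm t; have := ler_norm (- t); rewrite normrN.
  by move=> ? ?; apply/andP; split; lra.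
apply: (@le_trans _ _ (\int[mu]_(s in E) (f a s)%:E)%E).
  under eq_integral do rewrite ft.
  rewrite mul1e in H; apply: le_trans H; apply: ge0_subset_integral => //.
  - by rewrite -[_ @^-1` _]setTI; exact: mt.
  - exact: measurable_funTS.
  - by move=> s _; rewrite lee_fin.
rewrite -(setDUK IE) ge0_integral_setU//; last 4 first.
- by apply: measurableD => //; exact: measurable_itv.
- by apply: measurable_funTS; exact: mfE.
- by move=> s _; rewrite lee_fin.
- by apply/disj_setPS => x [] ? [].
apply: leeD2l.
have mD : measurable (E `\` I01) by apply: measurableD => //; exact: measurable_itv.
apply: (@le_trans _ _ (\int[mu]_(s in E `\` I01) (2 * M)%:E)%E).
  apply: ge0_le_integral => //.
  - by move=> s _; rewrite lee_fin.
  - by apply: measurable_funTS; exact: mfE.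
  - by move=> s _; rewrite lee_fin.
have t0 := normr_ge0 t.
have EE : mu E = (1 + 2 * `|t|)%:E.
  rewrite lebesgue_measure_itv/= lte_fin ifT; last by lra.
  by rewrite -EFinB; congr (_ %:E); ring.
have muD : mu (E `\` I01) = (2 * `|t|)%:E.
  rewrite measureD//=; last by rewrite EE ltry.
  by rewrite setIidr// unit_measure EE -EFinB; congr (_ %:E); ring.
rewrite integral_cst// [X in (_ * X)%E](_ : _ = (2 * `|t|)%:E); last exact: muD.
rewrite -EFinM lee_fin /t normrM (gtr0_norm K0).
by have -> : 2 * M * (2 * (`|b - a| / h)) = 4 * M * (`|b - a| / h) by ring.
Qed.

Let mollifyE x : (mollify h w x + M)%:E = (\int[mu]_(s in I01) (f ((1 - h) * x) s)%:E)%E.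
Proof.
have -> : mollify h w x + M = \int[mu]_(s in I01) f ((1 - h) * x) s.
  rewrite RintegralD//; last 2 first.
  - by apply: (@bounded_integrable R 1 _ M).
  - by apply: (@bounded_integrable R 1 _ M) => // s; rewrite ger0_norm.
  rewrite Rintegral_cst//; congr (_ + _).
  by rewrite (_ : fine _ = 1) ?mulr1// (congr1 fine unit_measure).
rewrite /Rintegral fineK//.
apply: integrable_fin_num => //; apply: (@bounded_integrable R 1 _ (2 * M)) => // s.
by rewrite ger0_norm.
Qed.

Lemma mollify_lip x y : `|mollify h w x - mollify h w y| <= 4 * M / h * `|x - y|.
Proof.
have H a b : mollify h w b <= mollify h w a + 4 * M / h * `|b - a|.
  have := average_shift ((1 - h) * a) ((1 - h) * b).
  rewrite -!mollifyE -EFinD lee_fin -mulrBr normrM (gtr0_norm (_ : 0 < 1 - h)); last by rewrite subr_gt0.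
  have : 4 * M * ((1 - h) * `|b - a| / h) <= 4 * M / h * `|b - a|.
    have -> : 4 * M * ((1 - h) * `|b - a| / h) = (1 - h) * (4 * M / h * `|b - a|) by ring.
    rewrite ler_piMl ?gerBl ?(ltW h0)//.
    by rewrite !mulr_ge0 ?invr_ge0 ?(ltW h0).
  lra.
have := H x y; have := H y x; rewrite [`|y - x|]distrC => ? ?.
by rewrite ler_norml; apply/andP; split; lra.
Qed.

Lemma measurable_mollify : measurable_fun [set: R] (mollify h w).
Proof.
by apply: continuous_measurable_fun; apply: continuous_lip => x y; exact: mollify_lip.
Qed.

(** By convexity the square of the error at x is at most the average of (w y - w x)^2
    over the points y of the window, all at distance at most h from x. *)
Lemma mollify_dist :
  (\int[mu]_(x in I01) ((mollify h w x - w x) ^+ 2)%:E <= h%:E * energy_on (box 1) w)%E.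
Proof.
have -> : energy_on (box 1) w = (\int[mu]_(x in I01) \int[mu]_(y in I01) (dq w (y, x) ^+ 2)%:E)%E.
  rewrite /energy_on /box.
  rewrite iterated_integral//.
    by apply: measurable_funTS; exact: measurable_dq2.
  by move=> z; rewrite lee_fin sqr_ge0.
have mE : measurable_fun [set: R] (fun x => \int[mu]_(y in I01) (dq w (y, x) ^+ 2)%:E)%E.
  apply: (measurable_iterated _ _ (f := fun z => (dq w z ^+ 2)%:E)) => //.
    by apply: measurable_funTS; exact: measurable_dq2.
  by move=> z; rewrite lee_fin sqr_ge0.
rewrite -ge0_integralZl//; last 3 first.
- exact: measurable_funTS.
- by move=> x _; apply: integral_ge0 => y _; rewrite lee_fin sqr_ge0.
- by rewrite lee_fin ltW.
apply: ge0_le_integral => //.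
- by move=> x _; rewrite lee_fin sqr_ge0.
- apply: measurable_funTS; apply: measurable_sqrE.
  by apply: measurable_funB => //; exact: measurable_mollify.
- by apply: measurable_funTS; exact: measurable_funeM.
move=> x xI.
have mwx : measurable_fun [set: R] (fun s => w ((1 - h) * x + h * s) - w x) by exact: measurable_funB.
have bwx s : `|w ((1 - h) * x + h * s) - w x| <= M + M.
  by apply: le_trans (ler_normB _ _) _; apply: lerD.
have -> : mollify h w x - w x = \int[mu]_(s in I01) (w ((1 - h) * x + h * s) - w x).
  rewrite RintegralB//; last 2 first.
  - by apply: (@bounded_integrable R 1 _ M).
  - by apply: (@bounded_integrable R 1 _ M).
  rewrite Rintegral_cst//; congr (_ - _).
  by rewrite (_ : fine _ = 1) ?mulr1// (congr1 fine unit_measure).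
apply: le_trans (jensen_sq mwx bwx) _.
have mdq : measurable_fun [set: R] (fun y => (h ^+ 2 * dq w (y, x) ^+ 2)%:E).
  apply/measurable_EFinP; apply: measurable_funM => //; apply: measurable_funX.
  by apply: (measurable_fun_pair1 x); exact: measurable_dqT.
have dq0 y : (0 <= (h ^+ 2 * dq w (y, x) ^+ 2)%:E)%E by rewrite lee_fin mulr_ge0 ?sqr_ge0.
have H := @integral_comp_le R h^-1 (fun s => (1 - h) * x + h * s) K0 (mA x) (KA x) I01 _
  (measurable_itv _) mdq dq0.
have -> : (h%:E * \int[mu]_(y in I01) (dq w (y, x) ^+ 2)%:E =
    (h^-1)%:E * \int[mu]_(y in I01) (h ^+ 2 * dq w (y, x) ^+ 2)%:E)%E.
  under [in RHS]eq_integral do rewrite EFinM.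
  rewrite ge0_integralZl//; last 3 first.
  - apply: measurable_funTS; apply: measurable_sqrE.
    by apply: (measurable_fun_pair1 x); exact: measurable_dqT.
  - by move=> y _; rewrite lee_fin sqr_ge0.
  - by rewrite lee_fin sqr_ge0.
  by rewrite muleA -EFinM expr2 mulrA mulVf ?mul1r// gt_eqF.
have Asub s : I01 s -> I01 ((1 - h) * x + h * s).
  move: xI; rewrite /= !in_itv/= => /andP[x0 x1] /andP[s0 s1]; move: h0 h1 => ? ?; apply/andP; split; nra.
apply: le_trans H.
apply: (@le_trans _ _ (\int[mu]_(s in I01) (h ^+ 2 * dq w ((1 - h) * x + h * s, x) ^+ 2)%:E)%E).
  apply: ge0_le_integral => //.
  - by move=> s _; rewrite lee_fin sqr_ge0.
  - by apply: measurable_funTS; exact: measurable_sqrE.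
  - apply: measurable_funTS; exact: (measurableT_comp mdq (mA x)).
  move=> s sI; rewrite lee_fin /dq/= expr_div_n.
  have [->|nx] := eqVneq ((1 - h) * x + h * s) x; first by rewrite !subrr expr0n/= mul0r mulr0.
  have d0 : 0 < ((1 - h) * x + h * s - x) ^+ 2 by rewrite exprn_even_gt0//= subr_eq0.
  rewrite mulrA ler_pdivlMr// mulrC; apply: ler_wpM2r; first exact: sqr_ge0.
  apply: sqr_le_norm; rewrite (gtr0_norm h0).
  have -> : (1 - h) * x + h * s - x = h * (s - x) by ring.
  rewrite normrM (gtr0_norm h0) ler_piMr ?(ltW h0)//.
  move: xI sI; rewrite /= !in_itv/= => /andP[x0 x1] /andP[s0 s1]; rewrite ler_norml; apply/andP; split; lra.
apply: ge0_subset_integral => //.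
- by rewrite -[_ @^-1` _]setTI; exact: mA.
- apply: measurable_funTS; exact: (measurableT_comp mdq (mA x)).
Qed.

(** By convexity the energy of the average is at most the average over s of the energies
    of w composed with affine maps of the unit interval into itself. *)
Lemma mollify_energy : (energy_on (box 1) (mollify h w) <= energy_on (box 1) w)%E.
Proof.
pose A s x := (1 - h) * x + h * s.
pose F (p : R * (R * R)) := (dq (fun x => w (A p.1 x)) p.2 ^+ 2)%:E.
have mF : measurable_fun [set: R * (R * R)] F.
  apply: measurable_sqrE.
  have mp (g : R * R -> R) : measurable_fun [set: R * R] g ->
      measurable_fun [set: R * (R * R)] (fun p => g p.2).
    by move=> mg; exact: (measurableT_comp mg measurable_snd).
  have mwg (g : R * R -> R) : measurable_fun [set: R * R] g ->
      measurable_fun [set: R * (R * R)] (fun p => w (A p.1 (g p.2))).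
    move=> mg; apply: (measurableT_comp mw); apply: measurable_funD; apply: measurable_funM => //.
    exact: mp.
  apply: measurable_funM.
    by apply: measurable_funB; apply: mwg.
  apply: (measurableT_comp measurable_invr); apply: measurable_funB; exact: mp.
have F0 p : (0 <= F p)%E by rewrite lee_fin sqr_ge0.
have mb := @measurable_box R 1.
apply: (@le_trans _ _ (\int[mu2]_(z in box 1) \int[mu]_(s in I01) F (s, z))%E).
  apply: ge0_le_integral => //.
  - by move=> z _; rewrite lee_fin sqr_ge0.
  - by apply: measurable_funTS; apply: measurable_dq2; exact: measurable_mollify.
  - apply: (@measurable_inner_integral _ _ (measurableTypeR R) (measurableTypeR R * measurableTypeR R)%type R mu I01 (box 1) F) => //.
    exact: measurable_funTS.
  move=> [x y] _.
  have mg : measurable_fun [set: R] (fun s => dq (fun x => w (A s x)) (x, y)).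
    by apply: measurable_funM; [apply: measurable_funB; exact: mwA|exact: measurable_cst].
  have bg s : `|dq (fun x => w (A s x)) (x, y)| <= (M + M) * `|(x - y)^-1|.
    rewrite /dq normrM; apply: ler_wpM2r => //.
    by apply: le_trans (ler_normB _ _) _; apply: lerD.
  have <- : \int[mu]_(s in I01) dq (fun x => w (A s x)) (x, y) = dq (mollify h w) (x, y).
    rewrite RintegralZr//; last first.
      apply: (@bounded_integrable R 1 _ (M + M)); first by apply: measurable_funB; exact: mwA.
      by move=> s; apply: le_trans (ler_normB _ _) _; apply: lerD.
    rewrite /dq/=; congr (_ / _).
    rewrite (RintegralB _ (bounded_integrable 1 (mwA x) (fun s => wM _))
      (bounded_integrable 1 (mwA y) (fun s => wM _)))//.
  exact: jensen_sq mg bg.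
have -> : (\int[mu2]_(z in box 1) \int[mu]_(s in I01) F (s, z) =
    \int[mu]_(s in I01) \int[mu2]_(z in box 1) F (s, z))%E.
  have H := @integral_swap _ _ (measurableTypeR R) (measurableTypeR R * measurableTypeR R)%type R mu
    (@plane_measure R) I01 (box 1) F.
  have mI : measurable I01 by exact: measurable_itv.
  by apply: H => //; exact: measurable_funTS.
apply: (@le_trans _ _ (\int[mu]_(s in I01) energy_on (box 1) w)%E); last first.
  by rewrite integral_cst// [X in (_ * X)%E](_ : _ = 1%E) ?mule1//; exact: unit_measure.
apply: ge0_le_integral => //.
- by move=> s _; apply: integral_ge0.
- apply: (@measurable_inner_integral _ _ (measurableTypeR R * measurableTypeR R)%type (measurableTypeR R) R
    (@plane_measure R) (box 1) I01 (fun p => F (p.2, p.1))) => //.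
  by apply: measurable_funTS; apply: (measurableT_comp mF); exact: measurable_swap.
move=> s sI.
have h1' : 0 < 1 - h by rewrite subr_gt0.
apply: le_trans (energy_on_affine (h * s) h1' mw mb).
apply: ge0_subset_integral => //.
- exact: (measurable_pair_preim (measurable_affine (1 - h) (h * s)) mb).
- by apply: measurable_funTS; exact: (measurable_dq2 (measurableT_comp mw (measurable_affine (1 - h) (h * s)))).
have Ax x : x \in `]0, 1[ -> (1 - h) * x + h * s \in `]0, 1[.
  move: sI; rewrite /= !in_itv/= => /andP[x0 x1] /andP[s0 s1]; move: h0 h1 => ? ?; apply/andP; split; nra.
by move=> [x y] [/= /Ax ? /Ax ?].
Qed.

End Fixed.

Definition truncate M w x : R := Num.max (- M) (Num.min M ((w \_ I01) x)).

Lemma truncate_contract M (a b : R) :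
  `|Num.max (- M) (Num.min M a) - Num.max (- M) (Num.min M b)| <= `|a - b|.
Proof.
have h1 := ler_norm (a - b); have := ler_norm (b - a); rewrite distrC => h2.
rewrite ler_norml /Num.min /Num.max; case: (ltP M a) => ?; case: (ltP M b) => ?;
  case: ltP => ?; case: ltP => ?; apply/andP; split; lra.
Qed.

Lemma measurable_truncate M w : measurable_fun I01 w -> measurable_fun [set: R] (truncate M w).
Proof.
move=> mw; apply: measurable_maxr => //; apply: measurable_minr => //.
by apply/(measurable_restrictT w) => //; exact: measurable_itv.
Qed.

Lemma truncate_le M w x : 0 <= M -> `|truncate M w x| <= M.
Proof.
move=> M0; rewrite /truncate /Num.max /Num.min ler_norml.
by case: (ltP M _) => ?; case: ltP => ?; apply/andP; split; lra.
Qed.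

Lemma truncate_id M w x : x \in `]0, 1[ -> `|w x| <= M -> truncate M w x = w x.
Proof.
move=> xI; rewrite /truncate patchE mem_set// ler_norml => /andP[h1 h2].
by rewrite /Num.max /Num.min; case: (ltP M _) => ?; case: ltP => ?; lra.
Qed.

Lemma truncate_energy M w : measurable_fun I01 w ->
  (energy_on (box 1) (truncate M w) <= energy_on (box 1) w)%E.
Proof.
move=> mw; have mb := @measurable_box R 1.
rewrite -(@eq_energy_on R (box 1) (w \_ I01) w)//; last first.
  by move=> x xI; rewrite patchE mem_set.
have mw0 : measurable_fun [set: R] (w \_ I01).
  by apply/(measurable_restrictT w) => //; exact: measurable_itv.
apply: ge0_le_integral => //.
- by move=> z _; rewrite lee_fin sqr_ge0.
- by apply: measurable_funTS; apply: measurable_dq2; exact: measurable_truncate.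
- by apply: measurable_funTS; exact: measurable_dq2.
move=> z _; rewrite lee_fin; apply: sqr_le_norm; rewrite /dq !normrM.
by apply: ler_wpM2r => //; exact: truncate_contract.
Qed.

Lemma truncate_cvg w e : H12 w -> 0 < e -> exists n : nat,
  (\int[mu]_(x in I01) ((truncate n%:R w x - w x) ^+ 2)%:E <= e%:E)%E.
Proof.
move=> hw e0; have [mw lw gw] := hw.
have mI : measurable I01 by exact: measurable_itv.
have mT n : measurable_fun I01 (fun x => ((truncate n%:R w x - w x) ^+ 2)%:E).
  apply: measurable_sqrE; apply: measurable_funB => //.
  by apply: measurable_funTS; exact: measurable_truncate.
have trunc_err n x : x \in `]0, 1[ -> `|truncate n%:R w x - w x| <= `|w x|.
  move=> xI; rewrite /truncate patchE mem_set//.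
  have := ler0n R n; move: (n%:R) (w x) => m y m0.
  have h1 := ler_norm y; have := ler_norm (- y); rewrite normrN => h2.
  rewrite ler_norml /Num.min /Num.max.
  by case: (ltP m y) => ?; case: ltP => ?; apply/andP; split; lra.
have [_ H _] := @dominated_convergence _ (measurableTypeR R) R mu I01 mI
  (fun n x => ((truncate n%:R w x - w x) ^+ 2)%:E) (cst 0%E) (fun x => (w x ^+ 2)%:E) mT
  (@measurable_cst _ _ _ _ _ _)
  ltac:(apply: aeW => x xI; apply: cvg_near_cst; exists (Num.truncn `|w x|).+1 => // n /= hn;
    rewrite truncate_id ?subrr ?expr0n//; apply: le_trans (ltW (truncnS_gt _)) _; by rewrite ler_nat)
  ltac:(by have /H12P[_ la _] := hw; exact: (@l2_sqr _ (measurableTypeR R) R mu I01 w la))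
  ltac:(apply: aeW => x n xI; rewrite /= lee_fin ger0_norm ?sqr_ge0//; apply: sqr_le_norm; exact: trunc_err).
have : \forall n \near \oo, (\int[mu]_(x in I01) `|((truncate n%:R w x - w x) ^+ 2)%:E - cst 0 x| < e%:E)%E.
  apply: (H [set y | (y < e%:E)%E]); apply: open_nbhs_nbhs.
  by split; [exact: open_ereal_lt_ereal|rewrite /= lte_fin].
move=> [n _ hn]; exists n; apply: le_trans (ltW (hn n (leqnn n))).
rewrite le_eqVlt; apply/orP; left; apply/eqP; apply: eq_integral => x _.
by rewrite /= oppr0 addr0 ger0_norm ?sqr_ge0.
Qed.

(** Rescaled displacements are only compared with Lipschitz profiles: these
    approximate every function of H^{1/2}(0,1) without increasing its energy,
    truncation and averaging being contractions for the Gagliardo energy. *)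
Lemma lipschitz_approx w e : H12 w -> 0 < e -> exists v K,
  [/\ forall x y, `|v x - v y| <= K * `|x - y|,
      (energy_on (box 1) v <= energy_on (box 1) w)%E &
      (\int[mu]_(x in I01) ((v x - w x) ^+ 2)%:E <= e%:E)%E].
Proof.
move=> hw e0; have [mw lw gw] := hw; have mb := @measurable_box R 1.
have e4 : 0 < e / 4 by rewrite divr_gt0.
have [n hn] := truncate_cvg hw e4.
pose T := truncate n%:R w.
have mT : measurable_fun [set: R] T by exact: measurable_truncate.
have TM x : `|T x| <= n%:R by apply: truncate_le.
have ET := truncate_energy n%:R mw.
pose E := ipb (box 1) w w.
have E0 : 0 <= E by exact: ipb_ge0.
have EE : energy_on (box 1) w = E%:E by rewrite ipb_energy.
pose h := Num.min 2^-1 (e / 4 / (E + 1)).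
have eE : 0 < e / 4 / (E + 1) by rewrite divr_gt0// ltr_wpDl.
have h0 : 0 < h by rewrite lt_min invr_gt0 ltr0n/= eE.
have h1 : h < 1 by rewrite gt_min invf_lt1// ltr1n.
have hE : h * E <= e / 4.
  have : h * (E + 1) <= e / 4.
    by rewrite -ler_pdivlMr ?ltr_wpDl// ge_min lexx orbT.
  have := h0; lra.
exists (mollify h T), (4 * n%:R / h); split.
- by move=> x y; exact: (mollify_lip h0 h1 mT TM).
- exact: le_trans (mollify_energy h0 h1 mT TM) ET.
have mm := measurable_mollify h0 h1 mT TM.
have D1 := mollify_dist h0 h1 mT TM.
rewrite (_ : e = 2 * (e / 4 + e / 4)); last by field.
apply: (sqr_dist_triangle (g := T)); [exact: measurable_funTS|exact: measurable_funTS|exact: mw| |exact: hn].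
apply: le_trans D1 _; apply: (@le_trans _ _ (h%:E * E%:E)%E); last by rewrite -EFinM lee_fin.
by rewrite -EE; apply: lee_wpmul2l => //; rewrite lee_fin ltW.
Qed.

End Mollification.

(** * Inserting dislocations between cells *)

Section Stretching.
Context {R : realType} (lam Lam delta : R).
Hypotheses (lam_gt0 : 0 < lam) (le_lam_Lam : lam <= Lam) (delta_gt0 : 0 < delta).
Local Notation D := ((Lam + lam) * delta).
Local Notation profile := (profile lam Lam delta).
Implicit Types (x y c : R) (X Y : seq R) (j N : nat).

Lemma spaced_cat (w : R) X Y : 0 <= w -> spaced w X -> spaced w Y ->
  (forall a b, a \in X -> b \in Y -> a + w <= b) -> spaced w (X ++ Y).
Proof.
move=> w0; rewrite /spaced !(sorted_pairwise (spaced_trans w0)) pairwise_cat => -> -> h.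
by rewrite !andbT; apply/allrelP => a b; exact: h.
Qed.

Section Cells.
Variables (B s : R) (M : nat -> nat) (Y : seq R).
Hypotheses (s0 : 0 < s) (sY : spaced delta Y) (M0 : M 0%N = 0%N).
Hypothesis MB : forall j, (M j <= M j.+1)%N /\ (M j.+1 - M j)%:R * delta + delta <= B.
Local Notation P := (s + B).

(** The j-th cell of Y is moved to the right by the j gaps inserted before it. *)
Definition cell j := [seq c + j%:R * B | c <- Y & (j%:R * s <= c) && (c < j.+1%:R * s)].
(** The j-th gap follows the j-th cell; its dislocations are packed at distance delta.
    M j is the number of dislocations in the first j gaps. *)
Definition filling j := [seq j%:R * P + s + i.+1%:R * delta | i <- iota 0 (M j.+1 - M j)].
Fixpoint stretch N := if N is j.+1 then stretch j ++ (cell j ++ filling j) else [::].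

Let B_ge : delta <= B.
Proof. by have [_] := MB 0; apply: le_trans; rewrite lerDr mulr_ge0// ltW. Qed.

Lemma cell_bounds j c : c \in cell j -> j%:R * P <= c < j%:R * P + s.
Proof.
move=> /mapP[d + ->]; rewrite mem_filter -natr1 => /andP[/andP[h1 h2] _].
by apply/andP; split; lra.
Qed.

Lemma filling_bounds j c : c \in filling j -> j%:R * P + s + delta <= c <= j.+1%:R * P - delta.
Proof.
move=> /mapP[i + ->]; rewrite mem_iota add0n => /= im; have [_ h] := MB j.
have : i.+1%:R * delta <= (M j.+1 - M j)%:R * delta by rewrite ler_pM2r// ler_nat.
have : delta <= i.+1%:R * delta by rewrite ler_peMl ?(ltW delta_gt0)// ler1n.
rewrite -(natr1 j); move=> ? ?; apply/andP; split; lra.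
Qed.

Lemma stretch_bounds N c : c \in stretch N -> 0 <= c <= N%:R * P - delta.
Proof.
have P0 : 0 < P by move: s0 B_ge delta_gt0; lra.
elim: N => // N IH; rewrite /= !mem_cat => /or3P[/IH|/cell_bounds|/filling_bounds].
- by rewrite -(natr1 N) => /andP[-> h]; apply: (le_trans h); move: P0; lra.
- have : 0 <= N%:R * P by rewrite mulr_ge0// ltW.
  by rewrite -(natr1 N) => ? /andP[? ?]; move: B_ge => ?; apply/andP; split; lra.
- have : 0 <= N%:R * P by rewrite mulr_ge0// ltW.
  by move=> ? /andP[? ->]; rewrite andbT; move: s0 delta_gt0 => ? ?; lra.
Qed.

Lemma spaced_stretch N : spaced delta (stretch N).
Proof.
have d0 := ltW delta_gt0.
elim: N => // N IH; apply: spaced_cat => //.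
  apply: spaced_cat => //.
  - by apply: spaced_map; [move=> a b ?; lra|exact: spaced_filter].
  - apply/(sortedP 0) => i; rewrite size_map size_iota => iM.
    rewrite !(nth_map 0%N) ?size_iota//; last exact: ltnW.
    by rewrite !nth_iota//; [rewrite -(natr1 (_ + i.+1)) addnS; lra|exact: ltnW].
  - by move=> a b /cell_bounds/andP[_ h1] /filling_bounds/andP[h2 _]; lra.
move=> a b /stretch_bounds/andP[_ h1]; rewrite mem_cat => /orP[/cell_bounds|/filling_bounds] /andP[h2 _].
  by lra.
by move: s0 delta_gt0 => ? ?; lra.
Qed.

Local Notation below t := (count (fun c => (c < t)%R) Y).

Lemma size_stretch N : (size (stretch N) + below 0 = below (N%:R * s) + M N)%N.
Proof.
elim: N => [|N IH]; first by rewrite /= mul0r M0 addn0.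
rewrite /= !size_cat !size_map size_iota size_filter.
have -> : below (N.+1%:R * s) = (below (N%:R * s) +
    count (fun c => ((N%:R * s <= c) && (c < N.+1%:R * s))%R) Y)%N.
  rewrite -count_predUI [X in (_ + X)%N](_ : _ = 0%N) ?addn0.
    apply: eq_count => c /=; have : N%:R * s < N.+1%:R * s by rewrite ltr_pM2r// ltr_nat.
    by case: (ltP c (N%:R * s)) => //= h1 h2; rewrite (lt_trans h1 h2).
  by apply/eqP; rewrite -leqn0 leqNgt -has_count; apply/hasPn => c _ /=; case: ltP.
have [h _] := MB N; move: IH h.
move=> {}IH /subnKC <-; rewrite addKn; move: (M N.+1 - M N)%N => g.
transitivity (size (stretch N) + below 0 +
  (count (fun c => ((N%:R * s <= c) && (c < N.+1%:R * s))%R) Y + g))%N; first by ring.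
by rewrite IH; ring.
Qed.

(** Every dislocation to the left of the cell, from Y or from a filling, takes D away,
    and each gap adds lam B. The last term accounts for the dislocations of Y at
    negative positions, which belong to no cell. *)
Lemma profile_stretch N j x : (j < N)%N ->
  j%:R * P + delta / 2 <= x <= j%:R * P + s - delta / 2 ->
  profile (stretch N) x = profile Y (x - j%:R * B) + lam * (j%:R * B) - D * (M j)%:R + D * (below 0)%:R.
Proof.
move=> jN /andP[x1 x2]; have d0 := ltW delta_gt0.
have P0 : 0 < P by move: s0 B_ge delta_gt0; lra.
have H : rampsum delta (stretch N) x = delta * (size (stretch j))%:R + rampsum delta (cell j) x.
  elim: N jN => // N IH; rewrite ltnS leq_eqVlt => /orP[/eqP <-|jN] /=.
    rewrite !rampsum_cat [rampsum _ (filling j) _]rampsum_le//; last first.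
      by move=> c /filling_bounds/andP[h _]; move: s0 delta_gt0 => ? ?; lra.
    rewrite addr0; congr (_ + _); apply: rampsum_ge => // c /stretch_bounds/andP[_ h].
    by move: delta_gt0 => ?; lra.
  rewrite rampsum_cat IH// [rampsum _ (cell N ++ _) _]rampsum_le// ?addr0// => c.
  have jP : j.+1%:R * P <= N%:R * P by rewrite ler_pM2r// ler_nat.
  rewrite -(natr1 j) in jP; move: s0 delta_gt0 B_ge => ? ? ?.
  by rewrite mem_cat => /orP[/cell_bounds|/filling_bounds] /andP[h _]; lra.
have Hc : rampsum delta (cell j) x =
    rampsum delta [seq c <- Y | (j%:R * s <= c) && (c < j.+1%:R * s)] (x - j%:R * B).
  by rewrite /rampsum big_map; apply: eq_bigr => c _; congr ramp; ring.
have HY : rampsum delta Y (x - j%:R * B) =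
    rampsum delta [seq c <- Y | (j%:R * s <= c) && (c < j.+1%:R * s)] (x - j%:R * B) +
    delta * (below (j%:R * s))%:R.
  rewrite (@rampsum_localize _ _ Y (fun c => (j%:R * s <= c) && (c < j.+1%:R * s))
    (j%:R * s + delta / 2) (j.+1%:R * s - delta / 2))//.
  - congr (_ + _ * _%:R); apply: eq_count => c /=; rewrite addrK.
    have : j%:R * s < j.+1%:R * s by rewrite ltr_pM2r// ltr_nat.
    by case: (ltgtP c (j%:R * s)) => //= -> ->.
  - move=> c cY; rewrite addrK subrK; case: (leP (j%:R * s) c) => /= h; last by rewrite ltW.
    by case: (ltP c (j.+1%:R * s)) => //=; rewrite orbT.
  - by rewrite -(natr1 j); apply/andP; split; lra.
have := size_stretch j; move=> /(congr1 (fun n => n%:R : R)); rewrite !natrD.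
rewrite !profileE H Hc HY.
move=> E; have {}E : (size (stretch j))%:R = (below (j%:R * s))%:R + (M j)%:R - (below 0)%:R :> R.
  by rewrite -E addrK.
rewrite E; ring.
Qed.

End Cells.
End Stretching.

Section Contraction.
Context {R : realType} (B q s : R).
Hypotheses (B0 : 0 < B) (q0 : 0 < q) (qs : q <= s).
Implicit Types (x y : R) (j N : nat).
Local Notation P := (s + B).

(** Each gap, together with the last q of the cell before it, is contracted to length q
    with the constant slope q / (q + B); elsewhere the slope is 1. A contraction onto a
    point would not have a Lipschitz inverse. *)
Definition knots N := [seq j%:R * P + (s - q) + (q + B) / 2 | j <- iota 0 N].
Definition contraction N x : R := x - B / (q + B) * rampsum (q + B) (knots N) x.

Let qB0 : 0 < q + B. Proof. by move: B0 q0; lra. Qed.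
Let P0 : 0 < P. Proof. by move: B0 q0 qs; lra. Qed.
Let r0 : 0 < B / (q + B). Proof. exact: divr_gt0. Qed.

Lemma spaced_knots N : spaced (q + B) (knots N).
Proof.
apply/(sortedP 0) => i; rewrite size_map size_iota => iM.
rewrite !(nth_map 0%N) ?size_iota//; last exact: ltnW.
by rewrite !nth_iota//; [rewrite !add0n -(natr1 i); move: qs; lra|exact: ltnW].
Qed.

Lemma contraction_incr N x y : x <= y ->
  q / (q + B) * (y - x) <= contraction N y - contraction N x <= y - x.
Proof.
move=> xy; have /andP[h1 h2] := rampsum_incr (ltW qB0) (spaced_knots N) xy.
rewrite /contraction.
have -> : y - B / (q + B) * rampsum (q + B) (knots N) y -
    (x - B / (q + B) * rampsum (q + B) (knots N) x) =
    (y - x) - B / (q + B) * (rampsum (q + B) (knots N) y - rampsum (q + B) (knots N) x) by ring.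
have e : q / (q + B) = 1 - B / (q + B) by field; rewrite gt_eqF.
rewrite e; apply/andP; split; last by rewrite gerBl mulr_ge0// ltW.
by rewrite mulrBl mul1r lerD2l lerN2; apply: ler_wpM2l => //; exact: ltW.
Qed.

Lemma contraction_lip N x y : `|contraction N x - contraction N y| <= `|x - y|.
Proof.
wlog xy : x y / x <= y.
  by move=> h; have [/h //|/ltW/h] := leP x y; rewrite distrC [`|y - x|]distrC.
have /andP[h1 h2] := contraction_incr N xy.
rewrite distrC [`|x - y|]distrC ger0_norm; last first.
  by apply: le_trans h1; rewrite mulr_ge0 ?subr_ge0// divr_ge0 ?ltW.
by rewrite ger0_norm ?subr_ge0.
Qed.

Lemma contraction_expand N x y : `|x - y| <= (1 + B / q) * `|contraction N x - contraction N y|.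
Proof.
wlog xy : x y / x <= y.
  by move=> h; have [/h //|/ltW/h] := leP x y; rewrite distrC [`|contraction N y - _|]distrC.
have /andP[h1 h2] := contraction_incr N xy.
rewrite distrC [`|contraction N x - _|]distrC ger0_norm ?subr_ge0//.
rewrite ger0_norm; last first.
  by apply: le_trans h1; rewrite mulr_ge0 ?subr_ge0// divr_ge0 ?ltW.
have K0 : 0 < 1 + B / q by rewrite addr_gt0// divr_gt0.
have -> : y - x = (1 + B / q) * (q / (q + B) * (y - x)).
  by field; rewrite !gt_eqF.
by apply: ler_wpM2l => //; exact: ltW.
Qed.

Lemma measurable_contraction N : measurable_fun [set: R] (contraction N).
Proof.
apply: continuous_measurable_fun; apply: (@continuous_lip _ _ 1) => x y.
by rewrite mul1r; exact: contraction_lip.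
Qed.

Lemma contraction_flat N j x : (j <= N)%N -> j%:R * P <= x <= j%:R * P + (s - q) ->
  contraction N x = x - j%:R * B.
Proof.
move=> jN /andP[x1 x2]; rewrite /contraction; congr (_ - _).
have -> : rampsum (q + B) (knots N) x = (q + B) * j%:R.
  rewrite /knots -(subnKC jN) iotaD map_cat rampsum_cat rampsum_ge ?(ltW qB0)//; last first.
    move=> _ /mapP[i + ->]; rewrite mem_iota add0n /= => ij.
    have : i.+1%:R * P <= j%:R * P by rewrite ler_pM2r// ler_nat.
    by rewrite -(natr1 i); lra.
  rewrite rampsum_le ?(ltW qB0)// ?addr0 ?size_map ?size_iota// => _ /mapP[i + ->].
  rewrite mem_iota add0n => /andP[ij _].
  have : j%:R * P <= i%:R * P by rewrite ler_pM2r// ler_nat.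
  lra.
by field; rewrite gt_eqF.
Qed.

Lemma contraction_shift N j x : (j < N)%N -> j%:R * P <= x <= j.+1%:R * P ->
  j%:R * B <= x - contraction N x <= j.+1%:R * B.
Proof.
move=> jN /andP[x1 x2].
have sq : 0 <= s - q by rewrite subr_ge0.
have := contraction_flat (ltnW jN) (x := j%:R * P).
rewrite lexx lerDl sq => /(_ isT) h1.
have := contraction_flat jN (x := j.+1%:R * P).
rewrite lexx lerDl sq => /(_ isT) h2.
have /andP[_ k1] := contraction_incr N x1; have /andP[_ k2] := contraction_incr N x2.
apply/andP; split; lra.
Qed.

Lemma contraction_range N x : (0 < N)%N -> 0 < x < N%:R * P -> 0 < contraction N x < N%:R * s.
Proof.
move=> N0 /andP[x0 x1].
have sq : 0 <= s - q by rewrite subr_ge0.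
have := contraction_flat (leq0n N) (x := 0); rewrite !mul0r lexx add0r sq subr0 => /(_ isT) h1.
have := contraction_flat (leqnn N) (x := N%:R * P); rewrite lexx lerDl sq => /(_ isT) h2.
have /andP[k1 _] := contraction_incr N (ltW x0); have /andP[k2 _] := contraction_incr N (ltW x1).
have c0 : 0 < q / (q + B) by exact: divr_gt0.
have m1 : 0 < q / (q + B) * (x - 0) by rewrite mulr_gt0// subr_gt0.
have m2 : 0 < q / (q + B) * (N%:R * P - x) by rewrite mulr_gt0// subr_gt0.
by apply/andP; split; lra.
Qed.

End Contraction.

(** * Following a slow profile *)

Section Modulation.
Context {R : realType} (lam Lam delta : R).
Hypotheses (lam_gt0 : 0 < lam) (le_lam_Lam : lam <= Lam) (delta_gt0 : 0 < delta).
Local Notation mu := (@lebesgue_measure R).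
Local Notation D := ((Lam + lam) * delta).
Local Notation B := (6 * delta + D / lam).
Local Notation profile := (profile lam Lam delta).
Implicit Types (x y c : R) (X Y : seq R) (j N : nat).

Let D0 : 0 < D. Proof. by rewrite mulr_gt0//; move: lam_gt0 le_lam_Lam; lra. Qed.
Let DB : D <= lam * B.
Proof.
have -> : lam * B = 6 * (lam * delta) + D by field; rewrite gt_eqF.
by rewrite lerDr mulr_ge0// mulr_ge0// ltW.
Qed.
Let DeltaB : 6 * delta <= B. Proof. by rewrite lerDl divr_ge0// ltW. Qed.
Let B0 : 0 < B. Proof. by apply: lt_le_trans DeltaB; rewrite mulr_gt0. Qed.

Section Error.
Variables (s q eps : R) (Y : seq R) (V : R -> R) (N : nat).
Local Notation P := (s + B).
Hypotheses (q0 : 0 < q) (qs : q + delta <= s) (dq : delta <= q) (sY : spaced delta Y).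
Hypothesis Vlip : forall x y, `|V x - V y| <= eps * `|x - y|.
Hypotheses (epsP : eps * P <= D) (epsL : eps <= Lam).

Let eps0 : 0 <= eps.
Proof. by have := Vlip 1 0; rewrite subr0 normr1 mulr1; apply: le_trans. Qed.
Let s0 : 0 < s. Proof. by move: q0 qs delta_gt0; lra. Qed.
Let qs' : q <= s. Proof. by move: qs delta_gt0; lra. Qed.
Let P0 : 0 < P. Proof. by rewrite addr_gt0. Qed.

(** The number of dislocations, not yet an integer, that the first j gaps must contain
    for the profile to gain V (j P) - V 0 there: a gap climbs by lam B, a dislocation
    takes D away. *)
Definition height j : R := (lam * (j%:R * B) - (V (j%:R * P) - V 0)) / D.
Definition dislocations j : nat := Num.truncn (height j).

Let Vstep j : `|V (j.+1%:R * P) - V (j%:R * P)| <= D.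
Proof.
apply: le_trans (Vlip _ _) _; rewrite -mulrBl -natr1 addrAC subrr add0r mul1r.
by rewrite gtr0_norm.
Qed.

Lemma height_step j : 0 <= height j.+1 - height j <= lam * B / D + 1.
Proof.
have -> : height j.+1 - height j = (lam * B - (V (j.+1%:R * P) - V (j%:R * P))) / D.
  by rewrite /height -mulrBl; congr (_ / _); rewrite -(natr1 j); ring.
have := Vstep j; rewrite ler_norml => /andP[h1 h2]; apply/andP; split.
  by rewrite divr_ge0 ?(ltW D0)//; move: DB; lra.
rewrite ler_pdivrMr// (_ : (lam * B / D + 1) * D = lam * B + D); first by lra.
by field; rewrite !gt_eqF//; move: lam_gt0 le_lam_Lam; lra.
Qed.

Lemma height_ge0 j : 0 <= height j.
Proof.
elim: j => [|j IH]; first by rewrite /height !mul0r mulr0 subrr subr0 mul0r.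
by have /andP[h _] := height_step j; lra.
Qed.

Let M0 : dislocations 0 = 0%N.
Proof. by rewrite /dislocations /height !mul0r mulr0 subrr subr0 mul0r truncn0. Qed.

(** Two constraints fix the gap length B = 6 delta + D / lam. As V rises by at most D per
    period, lam B >= D keeps the numbers nondecreasing. A gap needs at most
    lam B / D + 2 dislocations, which occupy at most B / 2 + 2 delta since
    lam <= Lam; with a margin delta they fit if B >= 6 delta. *)
Lemma dislocations_fit j : (dislocations j <= dislocations j.+1)%N /\
  (dislocations j.+1 - dislocations j)%:R * delta + delta <= B.
Proof.
have /andP[h1 h2] := height_step j.
have le : (dislocations j <= dislocations j.+1)%N by apply: le_truncn; lra.
split => //; rewrite natrB//.
have a := truncn_itv (height_ge0 j); have b := truncn_itv (height_ge0 j.+1).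
have {a} a : height j < (dislocations j)%:R + 1 by rewrite natr1; case/andP: a.
have {b} b : (dislocations j.+1)%:R <= height j.+1 by case/andP: b.
have c : (dislocations j.+1)%:R - (dislocations j)%:R <= lam * B / D + 2.
  by move: a b h2; set X := (dislocations j)%:R; set Z := (dislocations _)%:R; lra.
have : ((dislocations j.+1)%:R - (dislocations j)%:R) * delta <= (lam * B / D + 2) * delta.
  by rewrite ler_pM2r.
have : lam * B / D * delta <= B / 2.
  have -> : lam * B / D * delta = B * (lam / (Lam + lam)).
    by field; rewrite !gt_eqF//; move: lam_gt0 le_lam_Lam; lra.
  apply: ler_wpM2l; first exact: ltW.
  rewrite ler_pdivrMr; last by move: lam_gt0 le_lam_Lam; lra.
  by move: le_lam_Lam; lra.
move: DeltaB; set b' := B; lra.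
Qed.

Lemma height_frac j : 0 <= lam * (j%:R * B) - D * (dislocations j)%:R - (V (j%:R * P) - V 0) <= D.
Proof.
have /andP[a1 a2] := truncn_itv (height_ge0 j); rewrite -/(dislocations j) in a1 a2.
have -> : lam * (j%:R * B) - D * (dislocations j)%:R - (V (j%:R * P) - V 0) =
    D * (height j - (dislocations j)%:R).
  by rewrite /height; field; rewrite !gt_eqF//; move: lam_gt0 le_lam_Lam; lra.
rewrite -natr1 in a2; apply/andP; split; first by rewrite mulr_ge0 ?subr_ge0// ltW.
by rewrite ler_piMr ?(ltW D0)//; lra.
Qed.

Definition modulated : seq R := stretch delta B s dislocations Y N.
Local Notation p := (contraction B q s N).
(** The last term is the constant due to the dislocations of Y at negative positions,
    which are absent from the new configuration. *)
Definition modulation_error x : R :=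
  profile modulated x - profile Y (p x) - (V x - V 0) - D * (count (fun c => (c < 0)%R) Y)%:R.
Local Notation r := modulation_error.

Lemma spaced_modulated : spaced delta modulated.
Proof. exact: (spaced_stretch delta_gt0 s0 sY dislocations_fit). Qed.

Let rE j x : (j < N)%N -> j%:R * P + delta / 2 <= x <= j%:R * P + s - delta / 2 ->
  r x = profile Y (x - j%:R * B) - profile Y (p x) +
    (lam * (j%:R * B) - D * (dislocations j)%:R - (V (j%:R * P) - V 0)) + (V (j%:R * P) - V x).
Proof.
move=> jN xj; rewrite /r (profile_stretch lam Lam delta_gt0 Y s0 M0 dislocations_fit jN xj).
ring.
Qed.

(** On the straight part of a cell the contraction is a translation: all terms but V are
    constant there. *)
Lemma error_good j x y : (j < N)%N ->
  j%:R * P + delta / 2 <= x <= j%:R * P + (s - q) ->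
  j%:R * P + delta / 2 <= y <= j%:R * P + (s - q) ->
  `|r x - r y| <= eps * `|x - y|.
Proof.
move=> jN xj yj.
have H z : j%:R * P + delta / 2 <= z <= j%:R * P + (s - q) ->
    r z = (lam * (j%:R * B) - D * (dislocations j)%:R - (V (j%:R * P) - V 0)) + (V (j%:R * P) - V z).
  move=> zj; rewrite (@rE j)//; last first.
    by move: zj dq delta_gt0 => /andP[? ?] ? ?; apply/andP; split; lra.
  rewrite (contraction_flat B0 q0 qs' (ltnW jN)) ?subrr ?add0r//.
  by move: zj delta_gt0 => /andP[? ?] ?; apply/andP; split; lra.
rewrite !H// distrC [`|x - y|]distrC.
apply: le_trans (Vlip _ _); rewrite distrC.
set a := lam * _ - _ - _; set b := V (_ * _).
by have -> : a + (b - V x) - (a + (b - V y)) = V y - V x by ring.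
Qed.

(** The contraction is within B of the translation of the cell, rounding the number of
    dislocations costs at most D, and V varies by at most D over a period. *)
Lemma error_mid j x : (j < N)%N -> j%:R * P + delta / 2 <= x <= j%:R * P + s - delta / 2 ->
  `|r x| <= Lam * B + 2 * D.
Proof.
move=> jN xj; rewrite (rE jN xj).
have xj' : j%:R * P <= x <= j.+1%:R * P.
  rewrite -(natr1 j); move: xj delta_gt0 B0 => /andP[? ?] ? ?; apply/andP; split; lra.
have h1 : `|profile Y (x - j%:R * B) - profile Y (p x)| <= Lam * B.
  apply: le_trans (profile_lip lam_gt0 le_lam_Lam delta_gt0 _ _ sY) _.
  apply: ler_wpM2l; first by move: lam_gt0 le_lam_Lam; lra.
  have := contraction_shift B0 q0 qs' jN xj'; rewrite -(natr1 j) => /andP[? ?].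
  by move: B0 => ?; rewrite ler_norml; apply/andP; split; lra.
have h2 := height_frac j.
have h3 : `|V (j%:R * P) - V x| <= D.
  apply: le_trans (Vlip _ _) _; apply: le_trans epsP; apply: ler_wpM2l => //.
  move: xj'; rewrite -(natr1 j) => /andP[? ?]; move: P0 => ?.
  by rewrite ler_norml; apply/andP; split; lra.
move: h1 h2 h3; rewrite !ler_norml.
set a := profile _ _ - _; set b := lam * _ - _ - _; set d := V _ - V x.
by move=> /andP[? ?] /andP[? ?] /andP[? ?]; apply/andP; split; lra.
Qed.

Lemma error_lip x y : `|r x - r y| <= 3 * Lam * `|x - y|.
Proof.
have h1 := profile_lip lam_gt0 le_lam_Lam delta_gt0 x y spaced_modulated.
have h2 := profile_lip lam_gt0 le_lam_Lam delta_gt0 (p x) (p y) sY.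
have h3 := contraction_lip B0 q0 qs' N x y.
have L0 : 0 <= Lam by move: lam_gt0 le_lam_Lam; lra.
have h4 : Lam * `|p x - p y| <= Lam * `|x - y| by exact: ler_wpM2l.
have h5 : eps * `|x - y| <= Lam * `|x - y| by exact: ler_wpM2r.
have h6 := Vlip x y.
have -> : r x - r y = (profile modulated x - profile modulated y) -
   (profile Y (p x) - profile Y (p y)) - (V x - V y) by rewrite /r; ring.
apply: le_trans (ler_normB _ _) _; apply: le_trans (lerD (ler_normB _ _) (lexx _)) _.
lra.
Qed.

Definition error_bound_cst := Lam * B + 2 * D + 3 * Lam * (B + delta).

(** Every point is within B + delta of the middle part of a cell. *)
Lemma error_bound x : 0 <= x < N%:R * P -> `|r x| <= error_bound_cst.
Proof.
move=> /andP[x0 xN].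
have xP0 : 0 <= x / P by rewrite divr_ge0// ltW.
have /andP[j1 j2] := truncn_itv xP0; set j := Num.truncn _ in j1 j2.
rewrite ler_pdivlMr// in j1; rewrite ltr_pdivrMr// in j2.
have jN : (j < N)%N by rewrite -(ltr_nat R) -(ltr_pM2r P0); exact: le_lt_trans xN.
rewrite -natr1 in j2.
pose x' := Num.max (j%:R * P + delta / 2) (Num.min x (j%:R * P + s - delta / 2)).
have [x'1 x'2] : j%:R * P + delta / 2 <= x' <= j%:R * P + s - delta / 2 /\ `|x - x'| <= B + delta.
  move: dq delta_gt0 qs B0 => ? ? ? ?; rewrite /x' ler_norml /Num.max /Num.min.
  case: (ltP x (j%:R * P + s - delta / 2)) => ?.
    by case: (ltP (j%:R * P + delta / 2) x) => ?; split; apply/andP; split; lra.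
  by case: (ltP (j%:R * P + delta / 2) (j%:R * P + s - delta / 2)) => ?; split; apply/andP; split; lra.
have h1 := error_mid jN x'1; have h2 := error_lip x x'.
have h3 : 3 * Lam * `|x - x'| <= 3 * Lam * (B + delta).
  by apply: ler_wpM2l => //; move: lam_gt0 le_lam_Lam; lra.
have -> : r x = r x' + (r x - r x') by ring.
by apply: le_trans (ler_normD _ _) _; rewrite /error_bound_cst; lra.
Qed.

Lemma measurable_error : measurable_fun [set: R] r.
Proof.
by apply: continuous_measurable_fun; apply: continuous_lip => x y; exact: error_lip.
Qed.

(** Away from the transition layers the error inherits the small slope of V,
    so only a small proportion of the interval contributes. *)
Lemma error_energy l d : 0 < d -> 0 < l <= N%:R * P ->
  (energy_on (box l) r <= ((2 * d * eps ^+ 2 + 8 * error_bound_cst ^+ 2 / d) * l +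
   (2 * (3 * Lam) ^+ 2 + 8 * error_bound_cst ^+ 2) * (N.+1%:R * (B + q + 2 * d + delta)))%:E)%E.
Proof.
move=> d0 /andP[l0 lN].
pose I (j : nat) : set R := `[j%:R * P - B - q - d, j%:R * P + delta / 2 + d]%classic.
have mI j : measurable (I j) by exact: measurable_itv.
pose bad := \big[setU/set0]_(j < N.+1) I j.
have mbad : measurable bad by exact: bigsetU_measurable.
have c0 : 0 <= 2 * (3 * Lam) ^+ 2 + 8 * error_bound_cst ^+ 2.
  by rewrite addr_ge0// mulr_ge0// sqr_ge0.
have muI (j : nat) : (mu (I j) <= (B + q + 2 * d + delta)%:E)%E.
  rewrite /I lebesgue_measure_itv/= lte_fin; case: ifP => _.
    rewrite -EFinB lee_fin; move: delta_gt0; set b := B; lra.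
  by rewrite lee_fin !addr_ge0 ?mulr_ge0 ?invr_ge0// ?(ltW q0) ?(ltW d0) ?(ltW lam_gt0) ?(ltW delta_gt0)//;
    move: lam_gt0 le_lam_Lam; lra.
have mubad : (mu (bad `&` `]0%R, l[) <= (N.+1%:R * (B + q + 2 * d + delta))%:E)%E.
  apply: (@le_trans _ _ (mu bad)).
    by apply: le_measure; rewrite ?inE//; apply: measurableI => //; exact: measurable_itv.
  apply: (le_trans (Boole_inequality mu (fun i _ => mI i))).
  apply: (@le_trans _ _ (\sum_(j < N.+1) (B + q + 2 * d + delta)%:E)%E).
    by apply: lee_sum => j _; exact: muI.
  rewrite sumEFin lee_fin sumr_const card_ord [leRHS]mulr_natl; exact: lexx.
have H := @sparse_energy R l d eps error_bound_cst (3 * Lam) bad r measurable_error mbad d0 l0.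
apply: (@le_trans _ _ (((2 * d * eps ^+ 2 + 8 * error_bound_cst ^+ 2 / d) * l)%:E +
     (2 * (3 * Lam) ^+ 2 + 8 * error_bound_cst ^+ 2)%:E * mu (bad `&` `]0%R, l[))%E); last first.
  by rewrite [leRHS]EFinD [X in (_ <= _ + X)%E]EFinM; apply: leeD2l; apply: lee_wpmul2l.
apply: H.
- by move=> x y _ _; exact: error_lip.
- move=> x y /andP[x0 x1] /andP[y0 y1].
  have hx : `|r x| <= error_bound_cst by apply: error_bound; rewrite ltW//= (lt_le_trans x1).
  have hy : `|r y| <= error_bound_cst by apply: error_bound; rewrite ltW//= (lt_le_trans y1).
  by apply: le_trans (ler_normB _ _) _; lra.
move=> x y _ /andP[y0 y1] ybad xy.
have yP0 : 0 <= y / P by rewrite divr_ge0// ltW.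
have /andP[j1 j2] := truncn_itv yP0; set j := Num.truncn _ in j1 j2.
rewrite ler_pdivlMr// in j1; rewrite ltr_pdivrMr// in j2.
have jN : (j < N)%N.
  by rewrite -(ltr_nat R) -(ltr_pM2r P0); apply: (le_lt_trans j1); exact: lt_le_trans lN.
have nI i : (i < N.+1)%N -> ~ I i y.
  move=> iN h; apply: ybad; rewrite /bad -bigcup_mkord; by exists i.
have n1 := nI j (ltnW jN); have n2 := nI j.+1 jN.
move: n1 n2; rewrite /I/= !in_itv/= -(natr1 j) => /negP + /negP.
rewrite -(natr1 j) in j2; rewrite !negb_and -!ltNge.
move: xy; rewrite ler_norml => /andP[xy1 xy2] n1 n2.
apply: (error_good jN).
  move: n1 n2 j1 j2 B0 q0 d0 delta_gt0; set b := B.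
  by move=> /orP[?|?] /orP[?|?] ? ? ? ? ? ?; apply/andP; split; lra.
move: n1 n2 j1 j2 B0 q0 d0 delta_gt0; set b := B.
by move=> /orP[?|?] /orP[?|?] ? ? ? ? ? ?; apply/andP; split; lra.
Qed.

End Error.
End Modulation.

(** * Separation of scales and near-optimal configurations *)

Section EnergyTools.
Context {R : realType}.
Local Notation mu := (@lebesgue_measure R).
Local Notation I01 := (`]0%R, 1%R[%classic : set R).
Implicit Types (f g w : R -> R) (A : set (R * R)).

(** Differences are quotients multiplied by distances: at most rho in the near part, at
    most 1 in the far part. *)
Lemma spread_near_far rho f : measurable_fun [set: R] f -> 0 < rho ->
  (spread_on (box 1) f <=
   (rho ^+ 2)%:E * energy_on (box 1) f + energy_on (box 1 `&` far rho) f)%E.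
Proof.
move=> mf rho0.
have mb := @measurable_box R 1.
have mn := measurable_box_near 1 rho; have mF := measurable_box_far 1 rho.
have mq : measurable_fun (box 1 `\` far rho) (fun z => (dq f z ^+ 2)%:E).
  by apply: measurable_funTS; exact: measurable_dq2.
have -> : spread_on (box 1) f = spread_on ((box 1 `\` far rho) `|` (box 1 `&` far rho)) f.
  by congr spread_on; rewrite setUC setUIDK.
rewrite /spread_on ge0_integral_setU//; last 3 first.
- by apply: measurable_funTS; exact: measurable_diff2.
- by move=> z _; rewrite lee_fin sqr_ge0.
- by apply/disj_setPS => z [[_ h] [_ h']].
apply: leeD.
  apply: (@le_trans _ _ ((rho ^+ 2)%:E * energy_on (box 1 `\` far rho) f)%E); last first.
    by apply: lee_wpmul2l; [rewrite lee_fin sqr_ge0|apply: energy_on_subset => // z []].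
  rewrite /energy_on -ge0_integralZl//; last 2 first.
  - by move=> z _; rewrite lee_fin sqr_ge0.
  - by rewrite lee_fin sqr_ge0.
  apply: ge0_le_integral => //.
  - by move=> z _; rewrite lee_fin sqr_ge0.
  - by apply: measurable_funTS; exact: measurable_diff2.
  - exact: measurable_funeM.
  move=> z [_ hz]; rewrite -EFinM lee_fin -exprMn; apply: sqr_le_norm.
  have [e|ne] := eqVneq z.1 z.2; first by rewrite e subrr normr0.
  have n0 : z.1 - z.2 != 0 by rewrite subr_eq0.
  rewrite -[X in `|X|](divfK n0) -/(dq f z) mulrC !normrM; apply: ler_wpM2r => //.
  by rewrite (gtr0_norm rho0) ltW// ltNge; apply/negP.
apply: ge0_le_integral => //.
- by move=> z _; rewrite lee_fin sqr_ge0.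
- by apply: measurable_funTS; exact: measurable_diff2.
- by apply: measurable_funTS; exact: measurable_dq2.
move=> z [[/= z1 z2] hz]; rewrite lee_fin; apply: sqr_le_norm.
have n0 : z.1 - z.2 != 0.
  by rewrite -normr_gt0; apply: lt_le_trans hz.
rewrite -[X in `|X|](divfK n0) -/(dq f z) normrM ler_piMr//.
move: z1 z2; rewrite !in_itv/= => /andP[? ?] /andP[? ?]; rewrite ler_norml; apply/andP; split; lra.
Qed.

(** The spread is the mean over y of the square distances from f to its value f y, so
    some y does not exceed it by much. A value of f thus replaces its mean. *)
Lemma recenter f (S e : R) : measurable_fun [set: R] f -> (spread_on (box 1) f <= S%:E)%E ->
  0 < e -> exists y0, (\int[mu]_(x in I01) ((f x - f y0) ^+ 2)%:E <= (S + e)%:E)%E.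
Proof.
move=> mf hS e0; apply: contrapT => /forallNP h.
have {}h y : ((S + e)%:E <= \int[mu]_(x in I01) ((f x - f y) ^+ 2)%:E)%E.
  by have /negP := h y; rewrite -ltNge => /ltW.
have mI : measurable I01 by exact: measurable_itv.
have Se : 0 <= S + e.
  have : ((0 : R)%:E <= S%:E)%E by apply: le_trans hS; exact: spread_on_ge0.
  by rewrite lee_fin; lra.
have : ((S + e)%:E <= S%:E)%E; last by rewrite lee_fin; lra.
apply: le_trans hS; rewrite /spread_on /box.
rewrite iterated_integral//; last 2 first.
- by apply: measurable_funTS; exact: measurable_diff2.
- by move=> z; rewrite lee_fin sqr_ge0.
apply: (@le_trans _ _ (\int[mu]_(y in I01) (S + e)%:E)%E).
  by rewrite integral_cst// [X in (_ * X)%E](_ : _ = 1%E) ?mule1//; exact: unit_measure.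
apply: ge0_le_integral => //.
  apply: (measurable_iterated mI mI (f := fun z => ((f z.1 - f z.2) ^+ 2)%:E)).
    by apply: measurable_funTS; exact: measurable_diff2.
  by move=> z; rewrite lee_fin sqr_ge0.
by move=> y _; exact: h.
Qed.

(** Young's inequality is used with opposite weights at short and at long range, so that
    the large weight always falls on the summand with little energy there. *)
Lemma energy_separated rho (t : R) f g : measurable_fun [set: R] f -> measurable_fun [set: R] g ->
  0 < t ->
  (energy_on (box 1) (fun x => f x + g x)%R <=
   (1 + t)%:E * (energy_on (box 1) f + energy_on (box 1) g) +
   (1 + t^-1)%:E * (energy_on (box 1 `&` far rho) f + energy_on (box 1 `\` far rho) g))%E.
Proof.
move=> mf mg t0.
have mb := @measurable_box R 1.
have mn := measurable_box_near 1 rho; have mF := measurable_box_far 1 rho.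
have mfg : measurable_fun [set: R] (fun x => f x + g x) by exact: measurable_funD.
have t1 : (0 <= (1 + t)%:E)%E by rewrite lee_fin addr_ge0// ltW.
have t2 : (0 <= (1 + t^-1)%:E)%E by rewrite lee_fin addr_ge0// invr_ge0 ltW.
have h := @energy_onU_le R (box 1 `&` far rho) (box 1 `\` far rho) (box 1) _ mfg mF mn mb.
have {}h := h ltac:(by rewrite setUIDK).
apply: (le_trans h).
have hn := energy_on_young mf mg mn t0.
have hf := energy_on_young mg mf mF t0.
rewrite (_ : (fun x => g x + f x) = (fun x => f x + g x)) in hf; last first.
  by apply/funext => x; rewrite addrC.
apply: (le_trans (leeD hf hn)).
have sf : (energy_on (box 1 `\` far rho) f <= energy_on (box 1) f)%E.
  by apply: energy_on_subset => // z [].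
have sg : (energy_on (box 1 `&` far rho) g <= energy_on (box 1) g)%E.
  by apply: energy_on_subset => // z [].
rewrite addeACA [X in (X + _)%E]addeC; apply: leeD.
  rewrite -ge0_muleDr; [|exact: energy_on_ge0|exact: energy_on_ge0].
  by apply: lee_wpmul2l => //; exact: leeD.
by rewrite -ge0_muleDr; [|exact: energy_on_ge0|exact: energy_on_ge0].
Qed.

Lemma lipschitz_H12 (K : R) w : (forall x y, `|w x - w y| <= K * `|x - y|) ->
  (energy_on (box 1) w < +oo)%E -> H12 w.
Proof.
move=> hK fin.
have mw : measurable_fun [set: R] w.
  by apply: continuous_measurable_fun; exact: continuous_lip hK.
have mwI : measurable_fun I01 w by exact: measurable_funTS.
split => //; last by rewrite gagliardoE.
have mI : measurable I01 by exact: measurable_itv.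
have K0 : 0 <= K by have := hK 1 0; rewrite subr0 normr1 mulr1; apply: le_trans.
apply: (@le_lt_trans _ _ ((`|w 0| + K) ^+ 2)%:E); last exact: ltry.
rewrite sqL2E; apply: integral_sqr_le => // x x0 x1; apply: sqr_le_norm.
rewrite [leRHS]ger0_norm ?addr_ge0// -[w x](subrK (w 0)) addrC.
apply: le_trans (ler_normD _ _) _; rewrite lerD2l.
apply: le_trans (hK _ _) _; rewrite subr0 gtr0_norm//.
by rewrite ler_piMr ?(ltW x1).
Qed.

End EnergyTools.

Section Recovery.
Context {R : realType} (lam Lam delta : R).
Hypotheses (lam_gt0 : 0 < lam) (le_lam_Lam : lam <= Lam) (delta_gt0 : 0 < delta).
Local Notation profile := (profile lam Lam delta).
Local Notation c_ := (c_ lam Lam delta).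
Implicit Types (x y c : R) (X Y : seq R) (j N : nat).

(** Dislocations outside the interval only contribute a constant, so the configuration
    need not be admissible for the length l. *)
Lemma rescaled_scaled l X k : 0 < l -> spaced delta X ->
  rescaled lam Lam delta l (scaled_profile lam Lam delta l X k).
Proof.
move=> l0 sX; have sl : 0 < Num.sqrt l by rewrite sqrtr_gt0.
have [k' hk] := profile_window lam Lam delta_gt0 0 l X.
have AX := window_AD lam_gt0 le_lam_Lam delta_gt0 0 l sX.
exists (fun x => profile (window delta 0 l X) x + (k' + k * Num.sqrt l)).
  exact: profile_displacement.
move=> z; rewrite in_itv/= => /andP[z0 z1].
have := hk (l * z); rewrite addr0 /scaled_profile /rescale => ->.
  by rewrite addrA [in RHS]mulrDl mulfK ?gt_eqF.
by rewrite mulr_ge0 ?(ltW l0) ?(ltW z0)//= ler_piMr ?(ltW l0)// ltW.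
Qed.

Section Cell.
Variable cs : R.
Hypothesis c_le_cs : forall l, 0 < l -> (c_ l <= cs%:E)%E.
Hypothesis c_ge_cs : forall e, 0 < e ->
  exists2 L0, 0 < L0 & forall l, L0 <= l -> ((cs - e)%:E <= c_ l)%E.

(** Large near-optimal configurations have little long-range energy: the
    diagonal blocks already use up almost all of it. *)
Lemma near_optimal (eta rho : R) : 0 < eta -> 0 < rho -> exists2 m0, 0 < m0 &
  forall m, m0 <= m -> exists Y, [/\ spaced delta Y,
    (energy_on (box m) (profile Y) <= (m * (cs + eta))%:E)%E &
    (energy_on (box m `&` far (rho * m)) (profile Y) <= (m * eta)%:E)%E].
Proof.
move=> eta0 rho0; have eta2 : 0 < eta / 2 by rewrite divr_gt0.
have [L0 L00 hL] := c_ge_cs eta2.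
pose k := Num.truncn rho^-1.
have kn : 0 < k.+1%:R :> R by rewrite ltr0Sn.
have krho : k.+1%:R^-1 <= rho.
  by rewrite invf_ple ?posrE// ltW// truncnS_gt.
exists (L0 * k.+1%:R); first by rewrite mulr_gt0.
move=> m hm; have m0 : 0 < m by apply: lt_le_trans hm; rewrite mulr_gt0.
have : (c_ m < (cs + eta / 2)%:E)%E.
  by apply: le_lt_trans (c_le_cs m0) _; rewrite lte_fin; lra.
move=> /ereal_inf_lt[_ [u du <-] hu].
have [Y AY hY] := gagliardo_displacement lam_gt0 le_lam_Lam delta_gt0 m0 du.
have [sY _] := (AD_spaced lam_gt0 le_lam_Lam delta_gt0 m Y).1 AY.
have hE : (energy_on (box m) (profile Y) <= (m * (cs + eta / 2))%:E)%E.
  rewrite hY in hu.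
  have -> : energy_on (box m) (profile Y) = (m%:E * ((m^-1)%:E * energy_on (box m) (profile Y)))%E.
    by rewrite muleA -EFinM mulfV ?gt_eqF// mul1e.
  rewrite [leRHS]EFinM.
  by apply: lee_wpmul2l; [rewrite lee_fin ltW|exact: ltW].
have mF : measurable (box m `&` far (rho * m)) by exact: measurable_box_far.
have mF' : measurable (box m `&` far (m / k.+1%:R)) by exact: measurable_box_far.
have mp := measurable_profile lam_gt0 le_lam_Lam delta_gt0 sY.
exists Y; split => //.
  by apply: le_trans hE _; rewrite lee_fin ler_pM2l//; lra.
have L1 : 0 < m / k.+1%:R by rewrite divr_gt0.
have kL : k.+1%:R * (m / k.+1%:R) = m by rewrite mulrC divfK ?gt_eqF.
have := @energy_blocks_c R lam Lam delta lam_gt0 le_lam_Lam delta_gt0 (m / k.+1%:R) m k.+1 Y L1.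
rewrite kL => /(_ (lexx _) sY) hb.
have cL : ((cs - eta / 2)%:E <= c_ (m / k.+1%:R))%E by apply: hL; rewrite ler_pdivlMr.
have h1 : ((m * (cs - eta / 2))%:E + energy_on (box m `&` far (m / k.+1%:R)) (profile Y) <=
    (m * (cs + eta / 2))%:E)%E.
  apply: le_trans hE; apply: le_trans hb; apply: leeD2r.
  by rewrite EFinM; apply: lee_wpmul2l => //; rewrite lee_fin ltW.
apply: (@le_trans _ _ (energy_on (box m `&` far (m / k.+1%:R)) (profile Y))).
  apply: energy_on_subset => // z [bz] fz; split => //; apply: le_trans fz.
  by rewrite /= mulrC ler_pM2r.
rewrite -(@leeD2lE _ (m * (cs - eta / 2))%:E)// -EFinD.
by apply: le_trans h1 _; rewrite lee_fin; lra.
Qed.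

End Cell.
End Recovery.

(** * The upper bound *)

Section Assembly.
Context {R : realType} (lam Lam delta : R).
Hypotheses (lam_gt0 : 0 < lam) (le_lam_Lam : lam <= Lam) (delta_gt0 : 0 < delta).
Local Notation mu := (@lebesgue_measure R).
Local Notation I01 := (`]0%R, 1%R[%classic : set R).
Local Notation D := ((Lam + lam) * delta).
Local Notation B := (6 * delta + D / lam).
Local Notation profile := (profile lam Lam delta).
Local Notation A := (error_bound_cst lam Lam delta).
Local Notation C3 := (2 * (3 * Lam) ^+ 2 + 8 * A ^+ 2).
Implicit Types (x y c : R) (X Y : seq R) (j N : nat).

Let D0 : 0 < D. Proof. by rewrite mulr_gt0//; move: lam_gt0 le_lam_Lam; lra. Qed.
Let B0 : 0 < B. Proof. by apply: addr_gt0; [exact: mulr_gt0|exact: divr_gt0]. Qed.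
Let C30 : 0 <= C3. Proof. by rewrite addr_ge0// mulr_ge0// sqr_ge0. Qed.
Let A0 : 0 <= A.
Proof.
have L0 : 0 <= Lam by move: lam_gt0 le_lam_Lam; lra.
rewrite /error_bound_cst; apply: addr_ge0.
  by apply: addr_ge0; apply: mulr_ge0; rewrite ?(ltW B0) ?(ltW D0).
by apply: mulr_ge0; [rewrite mulr_ge0|rewrite addr_ge0 ?(ltW B0) ?(ltW delta_gt0)].
Qed.

Lemma contracted_energy (q s k l : R) N (S C : set (R * R)) Y :
  0 < q -> q <= s -> B / q <= k -> 0 < l -> measurable S -> measurable C -> spaced delta Y ->
  S `<=` [set z | C (contraction B q s N z.1, contraction B q s N z.2)] ->
  (energy_on [set z | S (l * z.1, l * z.2)%R] (rescale l (profile Y \o contraction B q s N)) <=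
   (l^-1 * (1 + k) ^+ 2)%:E * energy_on C (profile Y))%E.
Proof.
move=> q0 qs Bk l0 mS mC sY SC.
have mp := measurable_contraction B0 q0 qs N.
have mY := measurable_profile lam_gt0 le_lam_Lam delta_gt0 sY.
have mYp : measurable_fun [set: R] (profile Y \o contraction B q s N) by exact: measurableT_comp.
have k0 : 0 <= k by apply: le_trans Bk; rewrite divr_ge0 ?(ltW B0) ?(ltW q0).
have K0 : 0 < 1 + k by lra.
apply: le_trans (energy_rescale l0 mS mYp) _; rewrite EFinM -muleA.
apply: lee_wpmul2l; first by rewrite lee_fin invr_ge0 ltW.
apply: (@le_trans _ _ (energy_on [set z | C (contraction B q s N z.1, contraction B q s N z.2)]
  (profile Y \o contraction B q s N))).
  by apply: energy_on_subset => //; exact: measurable_pair_preim.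
apply: energy_on_comp => //; last exact: contraction_lip.
move=> x y; apply: le_trans (contraction_expand B0 q0 qs N x y) _.
by apply: ler_wpM2r => //; rewrite lerD2l.
Qed.

Section Fixed.
(** The parameters are chosen in this order: the precision kappa; the scale rho which
    separates w from the oscillations; t, for cells of length t ^ 2 and transitions of
    length t, so that contracting the gaps distorts little and the transitions occupy a
    proportion of order 1 / t; and at last l. *)
Variables (w : R -> R) (Kw cs Ew kappa rho t : R).
Hypotheses (wlip : forall x y, `|w x - w y| <= Kw * `|x - y|).
Hypothesis EwE : energy_on (box 1) w = Ew%:E.
Hypotheses (k0 : 0 < kappa) (k1 : kappa <= 1) (rho0 : 0 < rho) (rhok : rho <= kappa).
Hypothesis near_w : (energy_on (box 1 `\` far rho) w <= (kappa ^+ 2)%:E)%E.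
Hypotheses (cs0 : 0 <= cs).
Hypotheses (tge : 2 + delta + B <= t) (tB : B / kappa <= t) (tA : 32 * A ^+ 2 / kappa ^+ 2 <= t)
  (tC : 24 * C3 / kappa ^+ 2 <= t).
Variables (m0 : R).
Hypothesis hm0 : forall m, m0 <= m -> exists Y, [/\ spaced delta Y,
    (energy_on (box m) (profile Y) <= (m * (cs + kappa ^+ 2 / 16))%:E)%E &
    (energy_on (box m `&` far (rho / 4 * m)) (profile Y) <= (m * (kappa ^+ 2 / 16))%:E)%E].

Local Notation s := (t ^+ 2).
Local Notation P := (s + B).

Let t0 : 0 < t. Proof. by apply: lt_le_trans tge; apply: addr_gt0 => //; apply: addr_gt0. Qed.
Let Kw0 : 0 <= Kw. Proof. by have := wlip 1 0; rewrite subr0 normr1 mulr1; apply: le_trans. Qed.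
Let Lam0 : 0 < Lam. Proof. by move: lam_gt0 le_lam_Lam; lra. Qed.
Let ts : t + delta <= s.
Proof.
rewrite expr2; have : 2 * t <= t * t by rewrite ler_pM2r//; move: tge delta_gt0 B0; set b := B; lra.
by move: tge B0; set b := B; lra.
Qed.
Let ts' : t <= s. Proof. by move: ts delta_gt0; lra. Qed.
Let Bt : B / t <= kappa.
Proof. by rewrite ler_pdivrMr// [leRHS]mulrC -ler_pdivrMr. Qed.
Let Ps : P <= 2 * s.
Proof. by move: ts tge delta_gt0; set b := B; lra. Qed.
Let P0 : 0 < P. Proof. by apply: addr_gt0 => //; exact: exprn_gt0. Qed.

Variable l : R.
Hypotheses (lP : P <= l) (ls : s / kappa <= l) (lm : 2 * m0 <= l)
  (lD : (Kw * P / D) ^+ 2 <= l) (lLam : (Kw / Lam) ^+ 2 <= l)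
  (lK : 8 * t * Kw ^+ 2 / kappa ^+ 2 <= l) (lA : A ^+ 2 / kappa <= l).

Let l0 : 0 < l. Proof. exact: lt_le_trans lP. Qed.
Let sl0 : 0 < Num.sqrt l. Proof. by rewrite sqrtr_gt0. Qed.
Let le_sqrt c : 0 <= c -> c ^+ 2 <= l -> c <= Num.sqrt l.
Proof. by move=> c0 h; rewrite -(ger0_norm c0) -sqrtr_sqr; apply: ler_wsqrtr. Qed.

Let N := (Num.truncn (l / P)).+1.
Let m := N%:R * s.
Let eps := Kw / Num.sqrt l.
Let V x := Num.sqrt l * w (x / l).

Let lP1 : 1 <= l / P. Proof. by rewrite ler_pdivlMr// mul1r. Qed.
Let lN : l <= N%:R * P.
Proof. by rewrite -ler_pdivrMr// ltW// truncnS_gt. Qed.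
Let N3 : N.+1%:R <= 3 * (l / P).
Proof.
have /andP[h _] := truncn_itv (le_trans ler01 lP1).
have -> : N.+1%:R = (Num.truncn (l / P))%:R + 2 :> R by rewrite /N -natrD addn2.
by move: lP1 h; set u := l / P; lra.
Qed.
Let ml : m <= l * (1 + kappa).
Proof.
have /andP[h _] := truncn_itv (le_trans ler01 lP1).
have h2 : (Num.truncn (l / P))%:R * s <= l.
  have : (Num.truncn (l / P))%:R * P <= l by rewrite -ler_pdivlMr.
  have : 0 <= (Num.truncn (l / P))%:R * B by rewrite mulr_ge0 ?(ltW B0).
  by set b := B; lra.
have h3 : s <= l * kappa by rewrite -ler_pdivrMr.
by rewrite /m /N -natr1 mulrDl mul1r mulrDr mulr1; exact: lerD.
Qed.
Let ml2 : m <= 2 * l.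
Proof.
have : l * kappa <= l by rewrite ler_piMr// ltW.
by move: ml; rewrite mulrDr mulr1; lra.
Qed.
Let mm0 : m0 <= m.
Proof.
have : N%:R * P <= N%:R * (2 * s) by rewrite ler_pM2l// ltr0n.
rewrite mulrCA -/m; move: lN lm; lra.
Qed.

Let Vlip x y : `|V x - V y| <= eps * `|x - y|.
Proof.
rewrite /V -mulrBr normrM (gtr0_norm sl0).
apply: (@le_trans _ _ (Num.sqrt l * (Kw * `|x / l - y / l|))).
  by apply: ler_wpM2l; [exact: ltW|exact: wlip].
rewrite -mulrBl normrM [`|l^-1|]gtr0_norm ?invr_gt0//.
have -> : l^-1 = (Num.sqrt l)^-1 * (Num.sqrt l)^-1.
  by rewrite -invfM -expr2 sqr_sqrtr// ltW.
rewrite /eps le_eqVlt; apply/orP; left; apply/eqP; field; exact: lt0r_neq0.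
Qed.
Let epsP : eps * P <= D.
Proof.
rewrite /eps mulrAC ler_pdivrMr// [leRHS]mulrC -ler_pdivrMr//; apply: le_sqrt => //.
by rewrite divr_ge0 ?(ltW D0)// mulr_ge0// ltW.
Qed.
Let epsL : eps <= Lam.
Proof.
rewrite /eps ler_pdivrMr// [leRHS]mulrC -ler_pdivrMr//; apply: le_sqrt => //.
by rewrite divr_ge0// ltW.
Qed.
Let eps2 : eps ^+ 2 = Kw ^+ 2 / l.
Proof. by rewrite /eps expr_div_n sqr_sqrtr// ltW. Qed.
Let td : delta <= t. Proof. by move: tge B0; set b := B; lra. Qed.
Let k2 : 0 < kappa ^+ 2. Proof. exact: exprn_gt0. Qed.

(** Per unit length the error costs t eps^2 for its slope in the cells, where eps tends to
    0 as l grows, and terms of order 1 / t for its oscillation beyond distance t and for the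
    transitions. *)
Lemma small_error Y : spaced delta Y ->
  (energy_on (box 1) (rescale l (modulation_error lam Lam delta s t Y V N)) <= (kappa ^+ 2)%:E)%E.
Proof.
move=> sY.
have mr := measurable_error lam_gt0 le_lam_Lam delta_gt0 N t0 ts sY Vlip epsP epsL.
have h1 := energy_rescale l0 (@measurable_box R l) mr.
rewrite box_dilate// in h1; apply: (le_trans h1).
have lNP : 0 < l <= N%:R * P by rewrite l0.
have h2 := error_energy lam_gt0 le_lam_Lam delta_gt0 t0 ts td sY Vlip epsP epsL t0 lNP.
apply: (@le_trans _ _ ((l^-1)%:E * ((2 * t * eps ^+ 2 + 8 * A ^+ 2 / t) * l +
  C3 * (N.+1%:R * (B + t + 2 * t + delta)))%:E)%E).
  by apply: lee_wpmul2l h2; rewrite lee_fin invr_ge0 ltW.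
rewrite -EFinM lee_fin mulrDr mulrC mulfK ?gt_eqF//.
have a1 : 2 * t * eps ^+ 2 <= kappa ^+ 2 / 4.
  rewrite eps2 mulrA ler_pdivrMr//.
  have : 8 * t * Kw ^+ 2 <= l * kappa ^+ 2 by rewrite -ler_pdivrMr.
  lra.
have a2 : 8 * A ^+ 2 / t <= kappa ^+ 2 / 4.
  rewrite ler_pdivrMr//.
  have : 32 * A ^+ 2 <= t * kappa ^+ 2 by rewrite -ler_pdivrMr.
  lra.
have a3 : l^-1 * (C3 * (N.+1%:R * (B + t + 2 * t + delta))) <= kappa ^+ 2 / 2.
  rewrite mulrC ler_pdivrMr//.
  have b1 : B + t + 2 * t + delta <= 4 * t by move: tge; set b := B; lra.
  have b2 : N.+1%:R * (B + t + 2 * t + delta) <= 12 * (l / t).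
    apply: (@le_trans _ _ (3 * (l / P) * (4 * t))).
      apply: ler_pM => //; move: B0 t0 delta_gt0; set b := B; lra.
    have : l / P <= l / s.
      by rewrite ler_pM2l// lef_pV2 ?posrE ?exprn_gt0// lerDl ltW.
    have -> : l / t = l / s * t by field; exact: lt0r_neq0.
    move=> h; have : l / P * t <= l / s * t by rewrite ler_pM2r.
    rewrite (_ : 3 * (l / P) * (4 * t) = 12 * (l / P * t)); last by ring.
    by rewrite ler_pM2l.
  apply: (@le_trans _ _ (C3 * (12 * (l / t)))); first exact: ler_wpM2l.
  have c1 : 24 * C3 <= t * kappa ^+ 2 by rewrite -ler_pdivrMr.
  have -> : C3 * (12 * (l / t)) = 24 * C3 * (l / t / 2) by field; exact: lt0r_neq0.
  apply: (@le_trans _ _ (t * kappa ^+ 2 * (l / t / 2))).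
    by apply: ler_wpM2r => //; rewrite !divr_ge0 ?(ltW l0) ?(ltW t0).
  rewrite le_eqVlt; apply/orP; left; apply/eqP; field; exact: lt0r_neq0.
by move: a1 a2 a3; set u := l^-1 * _; lra.
Qed.

(** The rescaled profile is phi + w + error: the transported near-optimal profile phi and w
    have separated scales, and the error is absorbed by Young's inequality. *)
Lemma recovery_fixed : exists X k, [/\ spaced delta X,
  (energy_on (box 1) (scaled_profile lam Lam delta l X k) <=
    (Ew + cs + kappa * (31 * cs + 3 * Ew + 42))%:E)%E &
  (\int[mu]_(x in I01) ((scaled_profile lam Lam delta l X k x - w x) ^+ 2)%:E <=
    (kappa * (16 * cs + 24))%:E)%E].
Proof.
have [Y [sY hY hF]] := hm0 mm0.
have mw : measurable_fun [set: R] w.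
  by apply: continuous_measurable_fun; exact: continuous_lip wlip.
pose p := contraction B t s N.
pose phi := rescale l (profile Y \o p).
pose r := modulation_error lam Lam delta s t Y V N.
pose X := modulated lam Lam delta s Y V N.
have mp : measurable_fun [set: R] p by exact: measurable_contraction.
have mY := measurable_profile lam_gt0 le_lam_Lam delta_gt0 sY.
have mphi : measurable_fun [set: R] phi.
  by apply: measurable_rescale; exact: measurableT_comp.
have mr : measurable_fun [set: R] r := measurable_error lam_gt0 le_lam_Lam delta_gt0 N t0 ts sY Vlip epsP epsL.
have sX : spaced delta X := spaced_modulated lam_gt0 le_lam_Lam delta_gt0 N t0 ts sY Vlip epsP.
have me := measurable_rescale l mr.
have mb := @measurable_box R 1.
have prange x : 0 < x < l -> 0 < p x < m.
  move=> /andP[x0 x1]; apply: contraction_range => //; rewrite x0/=; exact: lt_le_trans lN.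
have boxp : box l `<=` [set z | box m (p z.1, p z.2)].
  by move=> [x y] [/=]; rewrite !in_itv/= => /prange ? /prange ?; split; rewrite /= in_itv.
have mbm := @measurable_box R m; have mbl := @measurable_box R l.
have kk : 0 <= l^-1 * (1 + kappa) ^+ 2 by rewrite mulr_ge0 ?sqr_ge0// invr_ge0 ltW.
have mlk : l^-1 * m <= 1 + kappa by rewrite mulrC ler_pdivrMr// mulrC.
have Ephi : (energy_on (box 1) phi <= ((1 + kappa) ^+ 3 * (cs + kappa))%:E)%E.
  have := contracted_energy t0 ts' Bt l0 mbl mbm sY boxp; rewrite box_dilate// => h.
  apply: (le_trans h); apply: (@le_trans _ _ ((l^-1 * (1 + kappa) ^+ 2)%:E * (m * (cs + kappa ^+ 2 / 16))%:E)%E).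
    by apply: lee_wpmul2l.
  rewrite -EFinM lee_fin.
  have -> : l^-1 * (1 + kappa) ^+ 2 * (m * (cs + kappa ^+ 2 / 16)) =
    (1 + kappa) ^+ 2 * (l^-1 * m * (cs + kappa ^+ 2 / 16)) by ring.
  rewrite [(1 + kappa) ^+ 3]exprSr -[leRHS]mulrA; apply: ler_wpM2l; first exact: sqr_ge0.
  have h1 : kappa ^+ 2 <= kappa by rewrite expr2 ler_piMr// ltW.
  apply: ler_pM => //.
  - by rewrite mulr_ge0 ?invr_ge0 ?(ltW l0)// mulr_ge0// sqr_ge0.
  - by rewrite addr_ge0// divr_ge0// ltW.
  - by rewrite lerD2l; move: k0; lra.
have Fphi : (energy_on (box 1 `&` far rho) phi <= (kappa ^+ 2)%:E)%E.
  have mS : measurable (box l `&` far (rho * l)) by exact: measurable_box_far.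
  have mC : measurable (box m `&` far (rho / 4 * m)) by exact: measurable_box_far.
  have sub : box l `&` far (rho * l) `<=` [set z | (box m `&` far (rho / 4 * m)) (p z.1, p z.2)].
    move=> z [bz]; rewrite /far/= => hz; split; first exact: boxp.
    rewrite /=; have := contraction_expand B0 t0 ts' N z.1 z.2; rewrite -/p => hexp.
    have : `|z.1 - z.2| <= 2 * `|p z.1 - p z.2|.
      apply: le_trans hexp _; apply: ler_wpM2r => //; move: Bt k1; set u := B / t; lra.
    have : rho * m <= rho * (2 * l) by rewrite ler_pM2l.
    lra.
  have := contracted_energy t0 ts' Bt l0 mS mC sY sub; rewrite box_far_dilate// => h.
  apply: (le_trans h).
  apply: (@le_trans _ _ ((l^-1 * (1 + kappa) ^+ 2)%:E * (m * (kappa ^+ 2 / 16))%:E)%E).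
    by apply: lee_wpmul2l.
  rewrite -EFinM lee_fin.
  have -> : l^-1 * (1 + kappa) ^+ 2 * (m * (kappa ^+ 2 / 16)) =
    (l^-1 * m * (1 + kappa) ^+ 2) * (kappa ^+ 2 / 16) by ring.
  have : l^-1 * m * (1 + kappa) ^+ 2 <= 16.
    apply: (@le_trans _ _ ((1 + kappa) * (1 + kappa) ^+ 2)); first by apply: ler_wpM2r; rewrite ?sqr_ge0.
    rewrite -exprS; apply: (@le_trans _ _ (2 ^+ 3)); last by rewrite -natrX ler_nat.
    by apply: lerXn2r; rewrite ?nnegrE//; move: k0 k1; lra.
  move=> h16; apply: (@le_trans _ _ (16 * (kappa ^+ 2 / 16))); last by rewrite mulrC divfK.
  by apply: ler_wpM2r => //; rewrite divr_ge0// ltW.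
have Eerr := small_error sY; rewrite -/r in Eerr.
have S1 : (spread_on (box 1) phi <= (kappa * (8 * cs + 9))%:E)%E.
  apply: (le_trans (spread_near_far mphi rho0)).
  apply: (@le_trans _ _ ((rho ^+ 2)%:E * ((1 + kappa) ^+ 3 * (cs + kappa))%:E + (kappa ^+ 2)%:E)%E).
    apply: leeD => //; apply: lee_wpmul2l => //; by rewrite lee_fin sqr_ge0.
  rewrite -EFinM -EFinD lee_fin.
  have h1 : kappa ^+ 2 <= kappa by rewrite expr2 ler_piMr// ltW.
  have h2 : rho ^+ 2 <= kappa.
    by apply: le_trans h1; apply: lerXn2r; rewrite ?nnegrE ?(ltW rho0) ?(ltW k0).
  have h3 : (1 + kappa) ^+ 3 * (cs + kappa) <= 8 * (cs + 1).
    apply: ler_pM => //.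
    - by rewrite exprn_ge0//; move: k0; lra.
    - by move: k0 cs0; lra.
    - apply: (@le_trans _ _ (2 ^+ 3)); last by rewrite -natrX ler_nat.
      by apply: lerXn2r; rewrite ?nnegrE//; move: k0 k1; lra.
    - by rewrite lerD2l.
  have h4 : rho ^+ 2 * ((1 + kappa) ^+ 3 * (cs + kappa)) <= kappa * (8 * (cs + 1)).
    apply: ler_pM => //; first exact: sqr_ge0.
    by rewrite mulr_ge0 ?exprn_ge0//; move: k0 cs0; lra.
  by move: h4; rewrite !mulrDr; set u := rho ^+ 2 * _; lra.
have [y0 hy0] := recenter mphi S1 k0.
pose n0 := (count (fun c => (c < 0)%R) Y)%:R : R.
exists X, (- phi y0 + (V 0 - D * n0) / Num.sqrt l).
have vE x : scaled_profile lam Lam delta l X (- phi y0 + (V 0 - D * n0) / Num.sqrt l) x =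
    (phi x + w x) + (rescale l r x + - phi y0).
  rewrite /scaled_profile /phi /rescale /r /modulation_error -/X -/p -/n0.
  have -> : V (l * x) = Num.sqrt l * w x by rewrite /V mulrAC divff ?mul1r// gt_eqF.
  by rewrite /=; field; exact: lt0r_neq0.
split => //.
  rewrite (_ : scaled_profile _ _ _ _ _ _ = fun x => (phi x + w x) + (rescale l r x + - phi y0)); last first.
    by apply/funext => x; exact: vE.
  have mpw : measurable_fun [set: R] (fun x => phi x + w x) by exact: measurable_funD.
  have mec : measurable_fun [set: R] (fun x => rescale l r x + - phi y0) by exact: measurable_funD.
  apply: (le_trans (energy_on_young mpw mec mb k0)); rewrite energy_on_addc.
  have hs := energy_separated rho mphi mw k0; rewrite EwE in hs.
  have kp : 0 <= 1 + kappa by move: k0; lra.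
  have ki : 0 <= 1 + kappa^-1 by rewrite addr_ge0// invr_ge0 ltW.
  have hs2 : (energy_on (box 1) (fun x => phi x + w x)%R <=
     ((1 + kappa) * ((1 + kappa) ^+ 3 * (cs + kappa) + Ew) + (1 + kappa^-1) * (kappa ^+ 2 + kappa ^+ 2))%:E)%E.
    apply: (le_trans hs); rewrite [leRHS]EFinD; apply: leeD; rewrite EFinM; apply: lee_wpmul2l => //.
      by rewrite EFinD; apply: leeD2r.
    by rewrite EFinD; apply: leeD.
  apply: (@le_trans _ _ ((1 + kappa)%:E * ((1 + kappa) * ((1 + kappa) ^+ 3 * (cs + kappa) + Ew) +
     (1 + kappa^-1) * (kappa ^+ 2 + kappa ^+ 2))%:E + (1 + kappa^-1)%:E * (kappa ^+ 2)%:E)%E).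
    by apply: leeD; apply: lee_wpmul2l.
  rewrite -!EFinM -EFinD lee_fin.
  have i1 : (1 + kappa^-1) * kappa ^+ 2 <= 2 * kappa.
    have -> : (1 + kappa^-1) * kappa ^+ 2 = kappa * kappa + kappa by field; exact: lt0r_neq0.
    have : kappa * kappa <= kappa by rewrite ler_piMr// ltW.
    lra.
  have i2 : (1 + kappa) ^+ 2 <= 1 + 3 * kappa by move: k0 k1 => ? ?; nra.
  (* 31 = 2 ^ 5 - 1: the fifth power is convex on the unit interval. *)
  have i5 : (1 + kappa) ^+ 5 <= 1 + 31 * kappa.
    have j3 : (1 + kappa) ^+ 3 <= 1 + 7 * kappa.
      rewrite exprS; apply: (@le_trans _ _ ((1 + kappa) * (1 + 3 * kappa))); first exact: ler_wpM2l.
      by move: k0 k1 => ? ?; nra.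
    rewrite (exprD _ 3 2); apply: (@le_trans _ _ ((1 + 7 * kappa) * (1 + 3 * kappa))).
      by apply: ler_pM => //; rewrite ?exprn_ge0 ?sqr_ge0.
    by move: k0 k1 => ? ?; nra.
  have Ew0 : 0 <= Ew by rewrite -lee_fin -EwE energy_on_ge0.
  have -> : (1 + kappa) * ((1 + kappa) * ((1 + kappa) ^+ 3 * (cs + kappa) + Ew) +
     (1 + kappa^-1) * (kappa ^+ 2 + kappa ^+ 2)) + (1 + kappa^-1) * kappa ^+ 2 =
     (1 + kappa) ^+ 5 * (cs + kappa) + (1 + kappa) ^+ 2 * Ew +
     (2 * (1 + kappa) + 1) * ((1 + kappa^-1) * kappa ^+ 2) by ring.
  have u1 : (1 + kappa) ^+ 5 * (cs + kappa) <= (1 + 31 * kappa) * (cs + kappa).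
    by apply: ler_wpM2r => //; rewrite addr_ge0// ltW.
  have u2 : (1 + kappa) ^+ 2 * Ew <= (1 + 3 * kappa) * Ew by exact: ler_wpM2r.
  have u3 : (2 * (1 + kappa) + 1) * ((1 + kappa^-1) * kappa ^+ 2) <= 5 * (2 * kappa).
    apply: ler_pM => //; [|rewrite mulr_ge0 ?sqr_ge0//|]; move: k0 k1; lra.
  have u4 : (1 + 31 * kappa) * (cs + kappa) <= cs + 31 * kappa * cs + 32 * kappa.
    by move: k0 k1 => ? ?; nra.
  by move: u1 u2 u3 u4; set a := _ * (cs + kappa); set b := (_ ^+ 2 * Ew); set c := _ * (_ * _ ^+ 2); lra.
apply: (@le_trans _ _ (2 * (kappa + (kappa * (8 * cs + 9) + kappa)))%:E); last first.
  by rewrite lee_fin; move: k0 cs0 => ? ?; lra.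
apply: (sqr_dist_triangle (g := fun x => w x + (phi x - phi y0))).
- apply: measurable_funTS; exact: measurable_scaled_profile.
- by apply: measurable_funTS; apply: measurable_funD => //; exact: measurable_funB.
- exact: measurable_funTS.
- apply: integral_sqr_le => [|x x0 x1].
    apply: measurable_funTS; apply: measurable_funB; first exact: measurable_scaled_profile.
    by apply: measurable_funD => //; exact: measurable_funB.
  rewrite vE (_ : _ - _ = rescale l r x); last by ring.
  rewrite /rescale expr_div_n sqr_sqrtr ?(ltW l0)// ler_pdivrMr//.
  apply: (@le_trans _ _ (A ^+ 2)); last by rewrite mulrC -ler_pdivrMr.
  apply: sqr_le_norm; rewrite (ger0_norm A0).
  apply: (error_bound lam_gt0 le_lam_Lam delta_gt0 t0 ts td sY Vlip epsP epsL (N := N)).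
  rewrite mulr_ge0 ?(ltW l0) ?(ltW x0)//=; apply: lt_le_trans lN.
  by rewrite -[ltRHS]mulr1 ltr_pM2l.
- by under eq_integral => x _ do rewrite addrC addKr.
Qed.

End Fixed.
End Assembly.

Section Final.
Context {R : realType} (lam Lam delta : R).
Hypotheses (lam_gt0 : 0 < lam) (le_lam_Lam : lam <= Lam) (delta_gt0 : 0 < delta).
Local Notation mu := (@lebesgue_measure R).
Local Notation I01 := (`]0%R, 1%R[%classic : set R).
Local Notation D := ((Lam + lam) * delta).
Local Notation B := (6 * delta + D / lam).
Local Notation rescaled := (rescaled lam Lam delta).
Local Notation c_ := (c_ lam Lam delta).
Local Notation A := (error_bound_cst lam Lam delta).
Local Notation C3 := (2 * (3 * Lam) ^+ 2 + 8 * A ^+ 2).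
Implicit Types (l : R) (w v : R -> R).

Lemma scaled_profile_H12 l X k : 0 < l -> spaced delta X ->
  (energy_on (box 1) (scaled_profile lam Lam delta l X k) < +oo)%E ->
  H12 (scaled_profile lam Lam delta l X k).
Proof.
move=> l0 sX; apply: (@lipschitz_H12 _ (Lam * l / Num.sqrt l)) => x y.
have s0 : 0 < Num.sqrt l by rewrite sqrtr_gt0.
rewrite /scaled_profile /rescale opprD addrACA subrr addr0 -mulrBl normrM [`|_^-1|]gtr0_norm ?invr_gt0//.
rewrite mulrAC; apply: ler_wpM2r; first by rewrite invr_ge0 ltW.
apply: le_trans (profile_lip lam_gt0 le_lam_Lam delta_gt0 _ _ sX) _.
by rewrite -mulrBr normrM (gtr0_norm l0) mulrA.
Qed.

Variable cs : R.
Hypotheses (cs0 : 0 <= cs) (c_le_cs : forall l, 0 < l -> (c_ l <= cs%:E)%E).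
Hypothesis c_ge_cs : forall e, 0 < e ->
  exists2 L0, 0 < L0 & forall l, L0 <= l -> ((cs - e)%:E <= c_ l)%E.

Definition good w l e v := [/\ rescaled l v, H12 v,
  (gagliardo 1 v <= (ipb (box 1) w w + cs + e)%:E)%E &
  (\int[mu]_(x in I01) ((v x - w x) ^+ 2)%:E <= e%:E)%E].

Lemma recovery_lipschitz w K kappa : H12 w -> (forall x y, `|w x - w y| <= K * `|x - y|) ->
  0 < kappa -> kappa <= 1 -> exists2 l0, 0 < l0 & forall l, l0 <= l -> exists v,
  [/\ rescaled l v, H12 v,
   (gagliardo 1 v <=
     (ipb (box 1) w w + cs + kappa * (31 * cs + 3 * ipb (box 1) w w + 42))%:E)%E &
   (\int[mu]_(x in I01) ((v x - w x) ^+ 2)%:E <= (kappa * (16 * cs + 24))%:E)%E].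
Proof.
move=> hw wK k0 k1; have mb := @measurable_box R 1.
have k2 : 0 < kappa ^+ 2 by exact: exprn_gt0.
have [n hn] := far_exhausts hw k2.
pose rho := Num.min kappa (n.+1%:R^-1).
have rho0 : 0 < rho by rewrite lt_min k0 invr_gt0 ltr0Sn.
have rhok : rho <= kappa by rewrite ge_min lexx.
have mw : measurable_fun [set: R] w.
  by apply: continuous_measurable_fun; exact: continuous_lip wK.
have near_w : (energy_on (box 1 `\` far rho) w <= (kappa ^+ 2)%:E)%E.
  have mn := measurable_box_near 1 (n.+1%:R^-1 : R).
  apply: (@le_trans _ _ (energy_on (box 1 `\` far (n.+1%:R^-1)) w)).
    apply: energy_on_subset => //; first exact: measurable_box_near.
    move=> z [bz nz]; split => // hz; apply: nz; apply: le_trans hz.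
    by rewrite ge_min lexx orbT.
  rewrite -(ipb_energy mn _ hw); last by move=> z [].
  by rewrite lee_fin; move: hn; rewrite (ipb_near_far (n.+1%:R^-1) hw hw); lra.
have EwE : energy_on (box 1) w = (ipb (box 1) w w)%:E by rewrite ipb_energy.
have eta0 : 0 < kappa ^+ 2 / 16 by rewrite divr_gt0.
have rho40 : 0 < rho / 4 by rewrite divr_gt0.
have [m0 m00 hm0] := near_optimal lam_gt0 le_lam_Lam delta_gt0 c_le_cs c_ge_cs eta0 rho40.
have D0 : 0 < D by rewrite mulr_gt0//; move: lam_gt0 le_lam_Lam; lra.
have B0 : 0 < B by apply: addr_gt0; [exact: mulr_gt0|exact: divr_gt0].
have C0 : 0 <= C3 by rewrite addr_ge0// mulr_ge0// sqr_ge0.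
have p1 : 0 <= B / kappa by rewrite divr_ge0// ltW.
have p2 : 0 <= 32 * A ^+ 2 / kappa ^+ 2 by rewrite divr_ge0 ?(ltW k2)// mulr_ge0// sqr_ge0.
have p3 : 0 <= 24 * C3 / kappa ^+ 2 by rewrite divr_ge0 ?(ltW k2)// mulr_ge0.
pose t := 2 + delta + B + B / kappa + 32 * A ^+ 2 / kappa ^+ 2 + 24 * C3 / kappa ^+ 2.
have [t1 t2 t3 t4] : [/\ 2 + delta + B <= t, B / kappa <= t, 32 * A ^+ 2 / kappa ^+ 2 <= t &
    24 * C3 / kappa ^+ 2 <= t].
  rewrite /t; move: p1 p2 p3 B0 delta_gt0.
  move: (B / kappa) (32 * _ / _) (24 * _ / _) (B) => a b c d *; split; lra.
have t0 : 0 < t by apply: lt_le_trans t1; rewrite addr_gt0// addr_gt0.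
pose s := t ^+ 2; pose P := s + B.
have s0 : 0 < s by exact: exprn_gt0.
have P0 : 0 < P by exact: addr_gt0.
have q1 : 0 <= s / kappa by rewrite divr_ge0// ltW.
have q2 : 0 <= (K * P / D) ^+ 2 by exact: sqr_ge0.
have q3 : 0 <= (K / Lam) ^+ 2 by exact: sqr_ge0.
have q4 : 0 <= 8 * t * K ^+ 2 / kappa ^+ 2.
  by rewrite divr_ge0 ?(ltW k2)// mulr_ge0 ?sqr_ge0// mulr_ge0// ltW.
have q5 : 0 <= A ^+ 2 / kappa by rewrite divr_ge0 ?sqr_ge0// ltW.
exists (P + s / kappa + 2 * m0 + (K * P / D) ^+ 2 + (K / Lam) ^+ 2 +
  8 * t * K ^+ 2 / kappa ^+ 2 + A ^+ 2 / kappa).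
  by move: P0 m00 q1 q2 q3 q4 q5; move: (s / kappa) (_ ^+ 2) (_ ^+ 2) (_ / _) (_ / _) P => *; lra.
move=> l hl.
have [r1 r2 r3 [r4 r5 r6 r7]] : [/\ P <= l, s / kappa <= l, 2 * m0 <= l &
   [/\ (K * P / D) ^+ 2 <= l, (K / Lam) ^+ 2 <= l, 8 * t * K ^+ 2 / kappa ^+ 2 <= l &
   A ^+ 2 / kappa <= l]].
  move: hl P0 m00 q1 q2 q3 q4 q5.
  move: ((K * P / D) ^+ 2) ((K / Lam) ^+ 2) (8 * t * K ^+ 2 / kappa ^+ 2) (A ^+ 2 / kappa) (s / kappa) => a b c d f *.
  by split; last split; lra.
have l0 : 0 < l by exact: lt_le_trans r1.
have [X [k [sX h1 h2]]] := recovery_fixed lam_gt0 le_lam_Lam delta_gt0 wK EwE k0 k1 rho0 rhok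
  near_w cs0 t1 t2 t3 t4 hm0 r1 r2 r3 r4 r5 r6 r7.
exists (scaled_profile lam Lam delta l X k); split; last exact: h2.
- exact: rescaled_scaled.
- by apply: scaled_profile_H12; [exact: l0|exact: sX|apply: le_lt_trans h1 _; rewrite ltry].
- rewrite gagliardoE; first exact: h1.
  apply: measurable_funTS; exact: (measurable_scaled_profile lam_gt0 le_lam_Lam delta_gt0 l k sX).
Qed.

Lemma recovery w e : H12 w -> 0 < e ->
  exists2 l0, 0 < l0 & forall l, l0 <= l -> exists v, good w l e v.
Proof.
move=> hw e0; have mb := @measurable_box R 1.
have e4 : 0 < e / 4 by rewrite divr_gt0.
have [w' [K [wK Ew' dw']]] := lipschitz_approx hw e4.
have fin : (energy_on (box 1) w' < +oo)%E.
  apply: le_lt_trans Ew' _; rewrite -(ipb_energy _ _ hw)// ltry//.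
have hw' := lipschitz_H12 wK fin.
have Ew'r : ipb (box 1) w' w' <= ipb (box 1) w w by rewrite -lee_fin !ipb_energy.
have E0 := ipb_ge0 (box 1) w.
pose C := 31 * cs + 3 * ipb (box 1) w w + 42 + 4 * (16 * cs + 24).
have C0 : 0 < C by rewrite /C; move: cs0 E0; lra.
pose kappa := Num.min 1 (e / C).
have k0 : 0 < kappa by rewrite lt_min ltr01 divr_gt0.
have k1 : kappa <= 1 by rewrite ge_min lexx.
have kC : kappa * C <= e by rewrite -ler_pdivlMr// ge_min lexx orbT.
have [l0 l00 h] := recovery_lipschitz hw' wK k0 k1; exists l0 => // l hl.
have [v [rv hv Ev dv]] := h l hl; exists v; split => //.
  apply: le_trans Ev _; rewrite lee_fin.
  have a1 : kappa * (31 * cs + 3 * ipb (box 1) w' w' + 42) <= kappa * C.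
    by apply: ler_wpM2l; [exact: ltW|rewrite /C; move: cs0 Ew'r; lra].
  lra.
have [mv _ _] := hv; have [mw _ _] := hw; have [mw' _ _] := hw'.
rewrite (_ : e = 2 * (e / 4 + e / 4)); last by field.
apply: (sqr_dist_triangle (g := w')) => //; apply: le_trans dv _; rewrite lee_fin.
have a2 : kappa * (4 * (16 * cs + 24)) <= kappa * C.
  by apply: ler_wpM2l; [exact: ltW|rewrite /C; move: cs0 E0; lra].
lra.
Qed.

(** For each length, a configuration that is good at the finest available
    tolerance; the tolerance then tends to zero with the length. *)
Lemma recovery_family w : H12 w -> exists v : R -> R -> R,
  (forall l, 0 < l -> rescaled l (v l)) /\
  forall e, 0 < e -> \forall l \near +oo%R, good w l e (v l).
Proof.
move=> hw.
pose ok l (n : nat) := exists v, good w l n.+1%:R^-1 v.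
have mono l e e' v : e <= e' -> good w l e v -> good w l e' v.
  move=> ee [h1 h2 h3 h4]; split => //.
    by apply: le_trans h3 _; rewrite lee_fin lerD2l.
  by apply: le_trans h4 _; rewrite lee_fin.
have H l : exists v, 0 < l -> rescaled l v /\
    forall n : nat, (n <= Num.truncn l)%N -> ok l n -> good w l n.+1%:R^-1 v.
  have [l0|l0] := ltP 0 l; last by exists w.
  (* Only finitely many tolerances compete at a given length, so a finest one exists. *)
  pose Q n := (n <= Num.truncn l)%N && `[< ok l n >].
  have [[n0 Qn0]|nQ] := pselect (exists n, Q n).
    have bQ n : Q n -> (n <= Num.truncn l)%N by case/andP.
    case: (ex_maxnP (ex_intro _ n0 Qn0) bQ) => n /andP[_ /asboolP[v gv]] nmax.
    exists v => _; split; first by case: gv.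
    move=> i il oki; apply: mono gv; rewrite lef_pV2 ?posrE ?ltr0Sn// ler_nat ltnS.
    by apply: nmax; rewrite /Q il; exact/asboolP.
  exists (scaled_profile lam Lam delta l [::] 0) => _; split; first exact: rescaled_scaled.
  by move=> n nl okn; exfalso; apply: nQ; exists n; rewrite /Q nl; exact/asboolP.
have [v hv] := choice H; exists v; split; first by move=> l l0; have [] := hv l l0.
move=> e e0.
pose n := Num.truncn e^-1.
have ne : n.+1%:R^-1 <= e by rewrite invf_ple ?posrE// ltW// truncnS_gt.
have ne0 : 0 < n.+1%:R^-1 :> R by rewrite invr_gt0.
have [l0 l00 hl0] := recovery hw ne0.
have N1 : \forall l \near +oo%R, l0 <= l by exact: nbhs_pinfty_ge (num_real _).
have N2 : \forall l \near +oo%R, (n%:R : R) <= l by exact: nbhs_pinfty_ge (num_real _).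
apply: filterS2 N1 N2 => l l1 l2.
have lp : 0 < l by exact: lt_le_trans l1.
apply: mono ne _; apply: (hv l lp).2; last exact: hl0.
by rewrite truncn_ge_nat// ltW.
Qed.

End Final.

Theorem theorem3p1 (R : realType) (lam Lam delta : R)
    (lam_gt0 : 0 < lam) (le_lam_Lam : lam <= Lam) (delta_gt0 : 0 < delta) :
  Gamma_cvg (rescaled lam Lam delta) (energy lam Lam delta)
    (energy_infty lam Lam delta).
Proof.
have [cs [cs0 c_le_cs c_ge_cs cE]] := c_infty_spec lam_gt0 le_lam_Lam delta_gt0.
have Einf w : H12 w -> energy_infty lam Lam delta w = (ipb (box 1) w w + cs)%:E.
  by move=> hw; rewrite /energy_infty mem_set// cE -H12_ipb.
have EW l v : rescaled lam Lam delta l v -> energy lam Lam delta l v = gagliardo 1 v.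
  by move=> rv; rewrite /energy mem_set.
split.
- move=> v w hv vw; have [_ hw _] := vw; rewrite Einf//; apply: le_limf_einf => a ha.
  have pos : \forall l \near +oo%R, rescaled lam Lam delta l (v l).
    by near=> l; apply: hv; near: l; exact: nbhs_pinfty_gt.
  have H := liminf_bound lam_gt0 le_lam_Lam delta_gt0 c_ge_cs pos (l_ := id) (@cvg_id _ _) vw ha.
  apply: filterS2 pos (H _) => l rl; by rewrite /= EW.
- move=> l_ v w l_gt0 l_oo hv vw; have [_ hw _] := vw; rewrite Einf//; apply: le_limf_einf => a ha.
  have pos : \forall n \near \oo, rescaled lam Lam delta (l_ n) (v n) by near=> n; exact: hv.
  have H := liminf_bound lam_gt0 le_lam_Lam delta_gt0 c_ge_cs pos l_oo vw ha.
  by apply: filterS (H _) => n; rewrite /= EW.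
move=> w hw; have [v [rv gv]] := recovery_family lam_gt0 le_lam_Lam delta_gt0 cs0 c_le_cs c_ge_cs hw.
exists v; split => //.
  apply: (@weak_cvg_criterion _ _ _ _ _ _ (ipb (box 1) w w + cs + 1)) => //.
    apply: filterS (gv 1 ltr01) => l [_ hvl gl _]; split => //.
    by rewrite -lee_fin H12_ipb.
  move=> e e0; apply: filterS (gv e e0) => l [_ hvl _ dl].
  rewrite -lee_fin H12_ipa; last exact: H12_lin.
  rewrite sqL2E; apply: le_trans dl; rewrite le_eqVlt; apply/orP; left; apply/eqP.
  by apply: eq_integral => x _; congr ((_ ^+ 2)%:E); ring.
rewrite Einf//; apply: limf_esup_le => e e0; apply: filterS (gv e e0) => l [rl _ gl _].
by rewrite /= EW.
Unshelve. all: by end_near. Qed.
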